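(* Let $\boldsymbol{x}_1,\dots,\boldsymbol{x}_n$ be independent real random variables and let $f$ be the intersection (AND) of $d$ halfspaces $h_1,\dots,h_d$ over them. Suppose either the $\boldsymbol{x}_j$ are discrete, with $0<\alpha\le1$ the least nonzero probability of any outcome of any $\boldsymbol{x}_j$, or the $\boldsymbol{x}_j$ are Gaussian (possibly of different variances) or uniform on (possibly different) intervals, in which case $\alpha=1$. Then there exists an $\epsilon$-sandwiching upper polynomial for $f$ of order $k\le\widetilde{O}(d^4/\epsilon^2)\cdot\mathrm{poly}(1/\alpha)$, i.e., a generalized polynomial $p_u$ of order at most $k$ with $p_u(X)\ge f(X)$ for all $X$ in the product of the ranges and $\mathbb{E}[p_u(\boldsymbol{X})]-\epsilon\le\mathbb{E}[f(\boldsymbol{X})]$.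
   Context: A halfspace is $h(x)=\mathbf{1}[w\cdot x\ge\theta]$ for real $w,\theta$. With $\Omega=\Omega_1\times\dots\times\Omega_n$ the product of the ranges, a $k$-junta is a function $\Omega\to\mathbb{R}$ depending on at most $k$ coordinates, and a generalized polynomial of order at most $k$ is a finite sum of $k$-juntas. $\widetilde{O}$ hides polylogarithmic factors. *)

(* Defs.v *)
From HB Require Import structures.
From mathcomp Require Import all_boot all_order all_algebra.
From mathcomp Require Import all_classical all_reals all_analysis.

Set Implicit Arguments.
Unset Strict Implicit.
Unset Printing Implicit Defensive.

Import Order.TTheory GRing.Theory Num.Theory.
Import numFieldNormedType.Exports.

Local Open Scope classical_set_scope.
Local Open Scope ring_scope.

Definition halfspace (R : realType) (n : nat) (w : 'I_n -> R) (theta : R)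
    (x : 'I_n -> R) : bool :=
  theta <= \sum_(i < n) w i * x i.

Definition halfspaces_inter (R : realType) (n d : nat) (w : 'I_d -> 'I_n -> R)
    (theta : 'I_d -> R) (x : 'I_n -> R) : R :=
  [forall i : 'I_d, halfspace (w i) (theta i) x]%:R.

(* Functions on a product space [Om] are represented by functions on R^n, only
   their values on [Om] being relevant. *)
Definition junta (R : realType) (n : nat) (Om : set ('I_n -> R)) (k : nat)
    (q : ('I_n -> R) -> R) : Prop :=
  exists2 J : {set 'I_n}, (#|J| <= k)%N &
    forall x y, Om x -> Om y -> (forall i, i \in J -> x i = y i) -> q x = q y.

Definition gen_poly (R : realType) (n : nat) (Om : set ('I_n -> R)) (k : nat)
    (p : ('I_n -> R) -> R) : Prop :=
  exists (m : nat) (q : 'I_m -> ('I_n -> R) -> R),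
    (forall i, junta Om k (q i)) /\
    (forall x, Om x -> p x = \sum_(i < m) q i x).

Section RandomVariables.
Context (disp : measure_display) (T : measurableType disp) (R : realType).
Context (P : probability T R) (n : nat).
Implicit Types (X : 'I_n -> {RV P >-> R}) (Y : {RV P >-> R}).

Definition mutually_independent X : Prop :=
  forall (J : {set 'I_n}) (A : 'I_n -> set R),
    (forall j, measurable (A j)) ->
    P (\bigcap_(j in [set` J]) (X j @^-1` A j)) =
    (\prod_(j in J) P (X j @^-1` A j))%E.

Definition discrete_rv Y : Prop := countable (range Y).

(* [normal_prob] is parametrized by the standard deviation, and is only a
   normal law when it is nonzero. *)
Definition gaussian_rv Y : Prop :=
  exists mu sigma : R, 0 < sigma /\
    forall A : set R, measurable A -> distribution P Y A = normal_prob mu sigma A.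

Definition uniform_rv Y : Prop :=
  exists (a b : R) (ab : a < b),
    forall A : set R, measurable A -> distribution P Y A = uniform_prob ab A.

Definition nonzero_outcome_probs X : set R :=
  [set r | r != 0 /\ exists (j : 'I_n) (v : R), r = pmf (X j) v].

Definition is_least_outcome_prob X (alpha : R) : Prop :=
  nonzero_outcome_probs X alpha /\ lbound (nonzero_outcome_probs X) alpha.

Definition range_prod X : set ('I_n -> R) :=
  [set x | forall j, range (X j) (x j)].

(* Integrability of [p (X)] is part of the meaning of its expectation: the
   library's expectation is total. *)
Definition sandwiching_upper X (eps : R) (f p : ('I_n -> R) -> R) : Prop :=
  [/\ forall x, range_prod X x -> f x <= p x,
      P.-integrable setT (fun t => (p (fun j => X j t))%:E) &
      ('E_P[fun t => p (fun j => X j t)] - eps%:E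
         <= 'E_P[fun t => f (fun j => X j t)])%E].

End RandomVariables.

(* A function bounded by C t log^c t; the shift by 2 only serves to keep the
   logarithm bounded away from 0. *)
Definition softO (R : realType) (C : R) (c : nat) (t : R) : R :=
  C * t * ln (2 + t) ^+ c.

(* Main.v *)
Require Import Defs.
From HB Require Import structures.
From mathcomp Require Import all_boot all_order all_algebra.
From mathcomp Require Import all_classical all_reals all_analysis.
From mathcomp Require Import measurable_realfun.
From mathcomp Require Import ring lra zify.

Set Implicit Arguments.
Unset Strict Implicit.
Unset Printing Implicit Defensive.

Import Order.TTheory GRing.Theory Num.Theory.
Import numFieldNormedType.Exports.

Local Open Scope classical_set_scope.
Local Open Scope ring_scope.

(* After centering, each variable is subgaussian relative to its own deviation.
   For one halfspace, remove heavy coordinates greedily. Either after few steps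
   no remaining coordinate carries more than a tau2-fraction of the variance of
   what remains, or the removed coordinates contain a chain, each of whose
   elements dominates everything that comes after it. In the first case the
   linear form is unlikely to be within sigma/N of the threshold (Fejer kernel
   against the characteristic function); in the second, each link of the chain
   leaves a constant chance to escape the threshold. The removed coordinates H
   may occur freely in a junta; as a function of the remaining ones, the halfspace
   is bounded above by a univariate polynomial of degree K in their linear form,
   an integrated squared Chebyshev polynomial, squared, whose growth far from the
   threshold is beaten by the subgaussian moments. The product of the d upper
   bounds is the upper polynomial for the intersection. With N ~ d/eps the moments
   of the product force K ~ d N^2, whence the order d K ~ d^4/eps^2, while
   |H| ~ N^2 up to logarithms. *)

(** * Expectations and independence *)

Section Independence.
Context (d : measure_display) (T : measurableType d) (R : realType).
Variable (P : probability T R).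

(** The degree K comes out of a loop. A polynomial of degree K grows like a K-th power outside the
    window of r deviations in which it is controlled. A product of d of them is dominated by moments
    of order K d of single forms, and the subgaussian moments of that order are small once r^2
    exceeds a multiple of kappa K d. The step has to happen within 1/N deviations, a fraction 1/(r
    N) of the window, and Chebyshev growth achieves this with K of order r N up to logarithms.
    Together, r is of order N d and K of order d N^2. In the chain case there is no step to resolve:
    the removed coordinates alone decide the halfspace outside a rare event, and a pure power takes
    care of the rest. The upper bound has to hold at every point, also on null events, so a
    remaining form of zero variance still needs a polynomial of its own. Powers of 1/alpha enter
    through kappa, which is of order 1/alpha for discrete variables. The quadratic behaviour of a
    characteristic function is only guaranteed at frequencies below a multiple of 1/kappa, whence a
    factor kappa^2 both in the length of a chain and in the number of coordinates removed per
    link. *)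

Lemma indep_tonelli d1 d2 (T1 : measurableType d1) (T2 : measurableType d2)
    (U : T -> T1) (Z : T -> T2) (f : T1 * T2 -> \bar R) :
  measurable_fun setT U -> measurable_fun setT Z ->
  (forall A B, measurable A -> measurable B ->
     P (U @^-1` A `&` Z @^-1` B) = (P (U @^-1` A) * P (Z @^-1` B))%E) ->
  measurable_fun [set: T1 * T2] f -> (forall x, 0 <= f x)%E ->
  (\int[P]_t f (U t, Z t) = \int[P]_t \int[P]_s f (U t, Z s))%E.
Proof.
move=> mU mZ ind mf f0.
pose U' : {RV P >-> T1} := HB.pack U (isMeasurableFun.Build _ _ _ _ U mU).
pose Z' : {RV P >-> T2} := HB.pack Z (isMeasurableFun.Build _ _ _ _ Z mZ).
have mUZ : measurable_fun setT (fun t => (U t, Z t)).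
  exact/measurable_fun_pair.
pose W : {RV P >-> (T1 * T2)%type} :=
  HB.pack (fun t => (U t, Z t)) (isMeasurableFun.Build _ _ _ _ _ mUZ).
transitivity (\int[distribution P W]_z f z)%E.
  by rewrite ge0_integral_distribution.
transitivity (\int[(distribution P U' \x distribution P Z')%E]_z f z)%E.
  (* Independence on rectangles determines the joint law: it is the product of the two laws. *)
  apply: eq_measure_integral => A mA _; apply/esym.
  apply: (@product_measure_unique _ _ _ _ _ (distribution P U') (distribution P Z')) => //.
rewrite fubini_tonelli1// ge0_integral_distribution//; last 2 first.
- exact: measurable_fun_fubini_tonelli_F.
- by move=> y; exact: integral_ge0.
apply: eq_integral => t _ /=.
rewrite /fubini_F ge0_integral_distribution//.
exact: measurableT_comp.
Qed.

End Independence.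

Section Expectation.
Context (d : measure_display) (T : measurableType d) (R : realType).
Variable (P : probability T R).
Implicit Types (Y Z : T -> R) (c : R).

Definition itg Y := P.-integrable setT (EFin \o Y).
Definition Ex Y : R := \int[P]_t Y t.

Lemma itg_measurable Y : itg Y -> measurable_fun setT Y.
Proof. by move=> /measurable_int/measurable_EFinP. Qed.

Lemma itg_cst c : itg (fun=> c).
Proof. exact: finite_measure_integrable_cst. Qed.

Lemma itgD Y Z : itg Y -> itg Z -> itg (fun t => Y t + Z t).
Proof. by move=> iY iZ; exact: (integrableD measurableT iY iZ). Qed.

Lemma itgZ c Y : itg Y -> itg (fun t => c * Y t).
Proof. by move=> iY; exact: (integrableZl measurableT c iY). Qed.

Lemma itgB Y Z : itg Y -> itg Z -> itg (fun t => Y t - Z t).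
Proof. by move=> iY iZ; exact: (integrableB measurableT iY iZ). Qed.

Lemma itg_le Z Y : itg Z -> measurable_fun setT Y ->
  (forall t, `|Y t| <= Z t) -> itg Y.
Proof.
move=> iZ mY YZ; apply: (le_integrable _ _ _ iZ) => //.
  exact/measurable_EFinP.
by move=> t _ /=; rewrite lee_fin (le_trans (YZ t))// ler_norm.
Qed.

Lemma itg_bnd c Y : measurable_fun setT Y -> (forall t, `|Y t| <= c) -> itg Y.
Proof. by move=> mY Yc; exact: (itg_le (itg_cst c)). Qed.

Lemma Ex_cst c : Ex (fun=> c) = c.
Proof. by rewrite /Ex Rintegral_cst//= probability_setT mulr1. Qed.

Lemma ExD Y Z : itg Y -> itg Z -> Ex (fun t => Y t + Z t) = Ex Y + Ex Z.
Proof. by move=> iY iZ; exact: RintegralD. Qed.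

Lemma ExB Y Z : itg Y -> itg Z -> Ex (fun t => Y t - Z t) = Ex Y - Ex Z.
Proof. by move=> iY iZ; exact: RintegralB. Qed.

Lemma ExZ c Y : itg Y -> Ex (fun t => c * Y t) = c * Ex Y.
Proof. by move=> iY; exact: RintegralZl. Qed.

Lemma eq_Ex Y Z : Y =1 Z -> Ex Y = Ex Z.
Proof. by move=> YZ; apply: eq_Rintegral => t _. Qed.

Lemma Ex_le Y Z : itg Y -> itg Z -> (forall t, Y t <= Z t) -> Ex Y <= Ex Z.
Proof. by move=> iY iZ YZ; apply: le_Rintegral => //. Qed.

Lemma Ex_ge0 Y : (forall t, 0 <= Y t) -> 0 <= Ex Y.
Proof. by move=> Y0; apply: Rintegral_ge0. Qed.

Lemma itg_sum (I : Type) (s : seq I) (Q : pred I) (F : I -> T -> R) :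
  (forall i, itg (F i)) -> itg (fun t => \sum_(i <- s | Q i) F i t).
Proof.
move=> iF; elim: s => [|i s IH].
  under eq_fun do rewrite big_nil.
  exact: itg_cst.
under eq_fun do rewrite big_cons.
by case: (Q i) => //; exact: itgD.
Qed.

Lemma Ex_sum (I : Type) (s : seq I) (Q : pred I) (F : I -> T -> R) :
  (forall i, itg (F i)) ->
  Ex (fun t => \sum_(i <- s | Q i) F i t) = \sum_(i <- s | Q i) Ex (F i).
Proof.
move=> iF; elim: s => [|i s IH].
  rewrite big_nil; under eq_Ex do rewrite big_nil.
  exact: Ex_cst.
rewrite big_cons.
under eq_Ex do rewrite big_cons.
case: (Q i) => //.
by rewrite ExD ?IH//; exact: itg_sum.
Qed.

Lemma EFin_Ex Y : itg Y -> (\int[P]_t (Y t)%:E = (Ex Y)%:E)%E.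
Proof. by move=> iY; rewrite /Ex /Rintegral fineK//; exact: integrable_fin_num. Qed.

Lemma itg_ge0P Y : measurable_fun setT Y -> (forall t, 0 <= Y t) ->
  (\int[P]_t (Y t)%:E < +oo)%E -> itg Y.
Proof.
move=> mY Y0 Yoo; apply/integrableP; split; first exact/measurable_EFinP.
rewrite (eq_integral (fun t => (Y t)%:E))// => t _ /=.
by rewrite ger0_norm.
Qed.

Lemma measurable_bR d1 (T1 : measurableType d1) (b : T1 -> bool) :
  measurable_fun setT b -> measurable_fun setT (fun t => (b t)%:R : R).
Proof.
move=> mb; apply: (@measurableT_comp _ _ _ _ _ _ (fun b : bool => b%:R : R)) => //.
Qed.

Lemma itg_bool (b : T -> bool) : measurable_fun setT b -> itg (fun t => (b t)%:R).
Proof.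
move=> mb; apply: (@itg_bnd 1); first exact: measurable_bR.
by move=> t; case: (b t); rewrite ?normr1// normr0.
Qed.

End Expectation.

(** * Independence of one variable from a group of others *)

Section GeneratedAlgebra.
Context (d : measure_display) (T : measurableType d) (R : realType).
Variables (P : probability T R) (n : nat) (X : 'I_n -> {RV P >-> R}).

(** Boxes over all of [J]: a family closed under intersection, on which [mutually_independent]
    speaks directly. *)
Definition cylinders (J : {set 'I_n}) : set (set T) :=
  [set A | exists2 B : 'I_n -> set R, (forall j, measurable (B j)) &
     A = \bigcap_(j in [set` J]) X j @^-1` B j].

Lemma cylinders_measurable J : cylinders J `<=` measurable.
Proof.
move=> _ [B mB ->]; apply: fin_bigcap_measurable => // j _.
by rewrite -[X in measurable X]setTI; exact: measurable_funP.
Qed.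

Lemma cylinders_setI J : setI_closed (cylinders J).
Proof.
move=> _ _ [B mB ->] [C mC ->]; exists (fun j => B j `&` C j).
  by move=> j; exact: measurableI.
by rewrite -bigcapI; apply: eq_bigcapr => j _; rewrite preimage_setI.
Qed.

Lemma cylindersT J : cylinders J setT.
Proof.
by exists (fun=> setT) => //; apply/esym/seteqP; split => t.
Qed.

Lemma cylinders_sub (J K : {set 'I_n}) : J \subset K -> cylinders J `<=` cylinders K.
Proof.
move=> JK _ [B mB ->]; exists (fun j => if j \in J then B j else setT).
  by move=> j; case: ifP.
apply/seteqP; split => t /= h j /=; have := h j => /= /[swap] jK.
  by case: ifP => // jJ; apply.
by rewrite jK; apply; exact: (fintype.subsetP JK).
Qed.

(** The space [T] with the sigma-algebra generated by the [X j], [j] in [J]. Measurability from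
    [sigJ J] is how dependence on these variables alone is expressed. *)
Definition sigJ (J : {set 'I_n}) := g_sigma_algebraType (cylinders J).

Lemma sigJ_measurable J (A : set T) : <<s cylinders J >> A -> measurable A.
Proof. by apply: smallest_sub => //; [exact: sigma_algebra_measurable|exact:
    cylinders_measurable]. Qed.

Lemma sigJ_sub (J K : {set 'I_n}) d1 (T1 : measurableType d1) (f : T -> T1) : J \subset K ->
  measurable_fun setT (f : sigJ J -> T1) -> measurable_fun setT (f : sigJ K -> T1).
Proof.
move=> JK mf _ B mB; have := mf measurableT B mB.
by apply: sub_sigma_algebra2; exact: cylinders_sub.
Qed.

Lemma sigJ_fun J d1 (T1 : measurableType d1) (f : T -> T1) :
  measurable_fun setT (f : sigJ J -> T1) -> measurable_fun setT f.
Proof. by move=> mf _ B mB; apply: sigJ_measurable; exact: mf. Qed.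

Lemma measurable_id_sigJ J : measurable_fun setT (id : T -> sigJ J).
Proof. by move=> _ B mB; rewrite setTI preimage_id; exact: sigJ_measurable mB. Qed.

Lemma measurable_coord (J : {set 'I_n}) j : j \in J -> measurable_fun setT (X j : sigJ J -> R).
Proof.
move=> jJ _ B mB; rewrite setTI; apply: sub_sigma_algebra.
exists (fun k => if k == j then B else setT).
  by move=> k; case: ifP.
apply/seteqP; split => t /=.
  by move=> XB k /= _; case: eqP => // ->.
by move=> /(_ j) /=; rewrite eqxx; exact.
Qed.

Hypothesis indep : mutually_independent X.

(** For fixed [B] both sides are finite measures in [A]; they agree on the cylinders, hence on the
    sigma-algebra that these generate. *)
Lemma sigJ_indep (J : {set 'I_n}) j (A : set T) (B : set R) : j \notin J ->
  <<s cylinders J >> A -> measurable B ->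
  P (A `&` X j @^-1` B) = (P A * P (X j @^-1` B))%E.
Proof.
move=> jJ sA mB.
have mXB : measurable (X j @^-1` B).
  by rewrite -[X in measurable X]setTI; exact: measurable_funP.
have pfin : P (X j @^-1` B) \is a fin_num by exact: fin_num_measure.
(* The right-hand side becomes a measure through [mscale], whose factor is a nonnegative real. *)
pose c : {nonneg R} := NngNum (fine_ge0 (measure_ge0 P (X j @^-1` B))).
have cE : (c%:num%:E = P (X j @^-1` B))%E by rewrite /= fineK.
have -> : P (A `&` X j @^-1` B) = mrestr P mXB A by [].
have -> : (P A * P (X j @^-1` B) = mscale c P A)%E by rewrite /mscale/= fineK// muleC.
apply: (g_sigma_algebra_measure_unique (cylinders J) _ (fun=> setT)) => //.
- exact: cylinders_measurable.
- by move=> _; exact: cylindersT.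
- by rewrite bigcup_const//; exists 0%N.
- exact: cylinders_setI.
- move=> _ [C mC ->]; rewrite /mrestr -[RHS]/(c%:num%:E * P _)%E cE.
  pose D k := if k == j then B else C k.
  have mD k : measurable (D k) by rewrite /D; case: ifP.
  have DE k : k \in J -> D k = C k.
    by rewrite /D; case: eqP => // -> /(negP jJ).
  have := indep (j |: J) mD; rewrite big_setU1//= {2}/D eqxx.
  rewrite (eq_bigr (fun k => P (X k @^-1` C k))); last first.
    by move=> k kJ; rewrite DE.
  rewrite -(indep J mC) muleC => <-; congr (P _).
  apply/seteqP; split => t /=.
    move=> [h hj] k /=; rewrite in_setU1 => /orP[/eqP ->|kJ].
      by rewrite /D eqxx.
    by rewrite DE//; exact: h.
  move=> h; split; last by have := h j; rewrite /= /D eqxx; apply; rewrite setU11.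
  by move=> k kJ; rewrite -DE//; apply: h; rewrite /= in_setU1 kJ orbT.
- by move=> _; rewrite /mrestr (le_lt_trans (probability_le1 _ _)) ?ltry//; apply: measurableI.
Qed.

(** The first of the two independent variables is the identity, read as a map into [sigJ J]; thus
    [f] may depend on the whole group [J] at once. *)
Lemma tonelli_coord (J : {set 'I_n}) j (f : sigJ J * R -> \bar R) : j \notin J ->
  measurable_fun setT f -> (forall x, 0 <= f x)%E ->
  (\int[P]_t f (t, X j t) = \int[P]_t \int[P]_s f (t, X j s))%E.
Proof.
move=> jJ mf f0.
apply: (@indep_tonelli _ _ _ P _ _ (sigJ J) _ id (X j) f) => //.
- exact: measurable_id_sigJ.
- by move=> A B mA mB; rewrite preimage_id; exact: (sigJ_indep jJ mA mB).
Qed.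

Lemma Ex_indep_ge0 (J : {set 'I_n}) j (a : T -> R) (b : R -> R) : j \notin J ->
  measurable_fun setT (a : sigJ J -> R) -> measurable_fun setT b ->
  (forall t, 0 <= a t) -> (forall x, 0 <= b x) ->
  itg P a -> itg P (b \o X j) ->
  itg P (fun t => a t * b (X j t)) /\
  Ex P (fun t => a t * b (X j t)) = Ex P a * Ex P (b \o X j).
Proof.
move=> jJ ma mb a0 b0 ia ib.
have E : (\int[P]_t (a t * b (X j t))%:E = (Ex P a * Ex P (b \o X j))%:E)%E.
  rewrite (@tonelli_coord J j (fun x => (a x.1 * b x.2)%:E))//; last 2 first.
  - apply/measurable_EFinP; apply: measurable_funM.
      exact: (measurableT_comp ma measurable_fst).
    exact: (measurableT_comp mb measurable_snd).
  - by move=> x; rewrite lee_fin mulr_ge0.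
  transitivity (\int[P]_t ((a t)%:E * \int[P]_s (b (X j s))%:E))%E.
    apply: eq_integral => t _ /=; under eq_integral do rewrite EFinM.
    rewrite ge0_integralZl//.
    - by apply/measurable_EFinP; exact: (itg_measurable ib).
    - by move=> s _; rewrite lee_fin.
    - by rewrite lee_fin.
  rewrite (EFin_Ex ib) EFinM -(EFin_Ex ia) ge0_integralZr//.
  - by apply/measurable_EFinP; exact: (itg_measurable ia).
  - by move=> s _; rewrite lee_fin.
  - by rewrite lee_fin; apply: Ex_ge0 => t; exact: b0.
split; last by rewrite {1}/Ex /Rintegral E.
apply: itg_ge0P.
- apply: measurable_funM; first exact: itg_measurable ia.
  exact: (itg_measurable ib).
- by move=> t; rewrite mulr_ge0.
- by rewrite E ltry.
Qed.

Lemma Ex_indep_bnd (J : {set 'I_n}) j (a : T -> R) (b : R -> R) : j \notin J ->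
  measurable_fun setT (a : sigJ J -> R) -> measurable_fun setT b ->
  (forall t, `|a t| <= 1) -> (forall x, `|b x| <= 1) ->
  Ex P (fun t => a t * b (X j t)) = Ex P a * Ex P (b \o X j).
Proof.
move=> jJ ma mb a1 b1.
have ma' := sigJ_fun ma.
have mbX : measurable_fun setT (b \o X j) by exact: measurableT_comp.
have ia : itg P a by exact: itg_bnd a1.
have ib : itg P (b \o X j) by apply: (@itg_bnd _ _ _ _ 1) => // t; exact: b1.
have iab : itg P (fun t => a t * b (X j t)).
  apply: (@itg_bnd _ _ _ _ 1); first exact: measurable_funM.
  by move=> t; rewrite normrM mulr_ile1.
(* Adding 1 makes both bounded factors nonnegative; the extra terms cancel after expansion. *)
have [] := @Ex_indep_ge0 J j (fun t => 1 + a t) (fun x => 1 + b x) jJ.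
- by apply: measurable_funD.
- by apply: measurable_funD.
- by move=> t; rewrite -lerBlDl sub0r lerNl (le_trans _ (a1 t))// -normrN ler_norm.
- by move=> x; rewrite -lerBlDl sub0r lerNl (le_trans _ (b1 x))// -normrN ler_norm.
- by apply: itgD => //; exact: itg_cst.
- by apply: itgD => //; exact: itg_cst.
move=> _.
have i1 := itg_cst P 1.
rewrite (@eq_Ex _ _ _ _ _ (fun t => (1 + b (X j t)) + (a t + a t * b (X j t)))); last first.
  by move=> t; rewrite mulrDl mul1r mulrDr mulr1.
rewrite (_ : (fun x => 1 + b x) \o X j = fun t => 1 + (b \o X j) t)//.
rewrite !ExD ?Ex_cst//; last 2 first.
- exact: itgD.
- exact: itgD.
rewrite (_ : Ex P (fun t => b (X j t)) = Ex P (b \o X j))// => H.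
by apply: (addrI (1 + Ex P (b \o X j) + Ex P a)); rewrite -[LHS]addrA H mulrDl !mulrDr !mul1r
    !mulr1 !addrA.
Qed.

(** Once the coordinates in [J] are fixed, [Y] is a constant shift, and the hypothesis is uniform in
    the shift. *)
Lemma Ex_small_ball (J : {set 'I_n}) j (A : T -> bool) (Y : T -> R) (g : R -> R) (c q : R) :
  j \notin J ->
  measurable_fun setT (A : sigJ J -> bool) -> measurable_fun setT (Y : sigJ J -> R) ->
  measurable_fun setT g ->
  (forall y : R, Ex P (fun t => (`|y + g (X j t)| <= c)%R%:R) <= q) ->
  Ex P (fun t => (A t && (`|Y t + g (X j t)| <= c))%R%:R) <= q * Ex P (fun t => (A t)%:R).
Proof.
move=> jJ mA mY mg H.
have mA' := sigJ_fun mA. have mY' := sigJ_fun mY.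
have mgX : measurable_fun setT (g \o X j) by exact: measurableT_comp.
have q0 : 0 <= q by apply: le_trans (H 0); apply: Ex_ge0 => t; exact: ler0n.
have mlt y : measurable_fun setT (fun t => `|y + g (X j t)| <= c).
  apply: measurable_fun_ler => //; apply: measurableT_comp => //.
  exact: measurable_funD.
have mb : measurable_fun setT (fun t => A t && (`|Y t + g (X j t)| <= c)).
  apply: measurable_and => //; apply: measurable_fun_ler => //.
  by apply: measurableT_comp => //; exact: measurable_funD.
rewrite -lee_fin -ExZ; last exact: itg_bool.
rewrite -!EFin_Ex; last 2 first.
- by apply: itgZ; exact: itg_bool.
- exact: itg_bool.
rewrite (@tonelli_coord J j (fun x => (A x.1 && (`|Y x.1 + g x.2| <= c))%R%:R%:E))//.
- apply: ge0_le_integral => //=.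
  + by move=> t _; apply: integral_ge0 => s _; rewrite lee_fin.
  + apply: (@measurable_fun_fubini_tonelli_F _ _ _ _ _ P
      (fun x => (A x.1 && (`|Y x.1 + g (X j x.2)| <= c))%R%:R%:E)) => //.
    apply/measurable_EFinP; apply: measurable_bR; apply: measurable_and.
      exact: (measurableT_comp mA' measurable_fst).
    apply: measurable_fun_ler => //; apply: measurableT_comp => //.
    apply: measurable_funD; first exact: (measurableT_comp mY' measurable_fst).
    exact: (measurableT_comp mgX measurable_snd).
  + by apply/measurable_EFinP; apply: measurable_funM => //; exact: measurable_bR.
  + move=> t _; rewrite EFin_Ex; last first.
      by apply: itg_bool; apply: measurable_and.
    rewrite lee_fin; case: (A t) => /=; first by rewrite mulr1.
    by rewrite Ex_cst mulr0.
- apply/measurable_EFinP; apply: measurable_bR; apply: measurable_and.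
    exact: (measurableT_comp mA measurable_fst).
  apply: measurable_fun_ler => //; apply: measurableT_comp => //.
  apply: measurable_funD; first exact: (measurableT_comp mY measurable_fst).
  exact: (measurableT_comp mg measurable_snd).
Qed.

End GeneratedAlgebra.

(** * A polynomial approximating a step from above *)

Section RealInequalities.
Variable R : realType.
Implicit Types x y : R.

Lemma norm_sqr x : `|x| ^+ 2 = x ^+ 2.
Proof. exact/real_normK/num_real. Qed.

Lemma ler_exp n x y : 0 <= x -> x <= y -> x ^+ n <= y ^+ n.
Proof. by move=> x0 xy; rewrite lerXn2r ?nnegrE// (le_trans x0). Qed.

Lemma increment_le (f df : R -> R) (u a b : R) :
  (forall x, is_derive x 1 f (df x)) -> a <= b ->
  (forall x, a <= x <= b -> df x <= u) -> f b - f a <= u * (b - a).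
Proof.
move=> fd ab H.
have cf : {within `[a, b], continuous f}.
  apply: derivable_within_continuous => x _.
  by have := fd x => /@ex_derive.
have [c cab ->] := MVT_segment ab (fun x _ => fd x) cf.
have uc : df c <= u by apply: H; rewrite in_itv /= in cab.
by rewrite !ler_wpM2r// subr_ge0.
Qed.

Lemma increment_ge (f df : R -> R) (l a b : R) :
  (forall x, is_derive x 1 f (df x)) -> a <= b ->
  (forall x, a <= x <= b -> l <= df x) -> l * (b - a) <= f b - f a.
Proof.
move=> fd ab H; rewrite -lerN2 opprB -mulNr.
have := @increment_le (fun x => - f x) (fun x => - df x) (- l) a b _ ab.
rewrite opprK addrC; apply => x.
by move=> /H; rewrite lerN2.
Qed.

Lemma derive_ge0_le (f df : R -> R) (a b : R) :
  (forall x, is_derive x 1 f (df x)) -> a <= b ->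
  (forall x, a <= x <= b -> 0 <= df x) -> f a <= f b.
Proof.
move=> fd ab H.
have cf : {within `[a, b], continuous f}.
  apply: derivable_within_continuous => x _.
  by have := fd x => /@ex_derive.
have [c cab E] := MVT_segment ab (fun x _ => fd x) cf.
rewrite -subr_ge0 E mulr_ge0// ?subr_ge0//.
by apply: H; rewrite in_itv /= in cab.
Qed.

(** From here to [cos_le_quartic] each bound yields the next: the difference vanishes at 0 and its
    derivative is the preceding difference. The Taylor part is a [{poly R}] so that its derivative
    is computed formally. *)
Lemma sin_le_id x : 0 <= x -> sin x <= x.
Proof.
move=> x0.
have := @derive_ge0_le (fun y => horner ('X) y - sin y) (fun y => (deriv ('X : {poly R})).[y] -
    cos y) 0 x _ x0.
rewrite !hornerX sin0 subr0 subr_ge0; apply.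
by move=> y _; rewrite derivX hornerC subr_ge0 cos_le1.
Qed.

Lemma cos_ge_quad x : 1 - x ^+ 2 / 2 <= cos x.
Proof.
wlog x0 : x / 0 <= x.
  move=> H; have [/H//|/ltW x0] := leP 0 x.
  by rewrite -cosN -sqrrN; apply: H; rewrite oppr_ge0.
pose p : {poly R} := 1 - 2^-1 *: 'X^2.
have := @derive_ge0_le (fun y => cos y - horner p y) (fun y => - sin y - (deriv p).[y]) 0 x _ x0.
rewrite cos0 !hornerE/= => H.
suff : 0 <= cos x - (1 - x ^+ 2 / 2) by rewrite subr_ge0.
have /H : forall y, 0 <= y <= x -> 0 <= - sin y - (deriv p).[y].
  move=> y /andP[y0 _]; rewrite /p !poly.derivE !hornerE/=.
  have := sin_le_id y0; lra.
lra.
Qed.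

Lemma sin_ge_cubic x : 0 <= x -> x - x ^+ 3 / 6 <= sin x.
Proof.
move=> x0.
pose p : {poly R} := 'X - 6^-1 *: 'X^3.
have := @derive_ge0_le (fun y => sin y - horner p y) (fun y => cos y - (deriv p).[y]) 0 x _ x0.
rewrite sin0 !hornerE/= => H.
have /H : forall y, 0 <= y <= x -> 0 <= cos y - (deriv p).[y].
  move=> y _; rewrite /p !poly.derivE !hornerE/=.
  have := cos_ge_quad y; lra.
lra.
Qed.

Lemma cos_le_quartic x : cos x <= 1 - x ^+ 2 / 2 + x ^+ 4 / 24.
Proof.
wlog x0 : x / 0 <= x.
  move=> H; have [/H//|/ltW x0] := leP 0 x.
  have := H (- x); rewrite oppr_ge0 cosN => /(_ x0).
  by rewrite -(sqrrN x) (_ : x ^+ 4 = (- x) ^+ 4)// exprNn -signr_odd expr0 mul1r.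
pose p : {poly R} := 1 - 2^-1 *: 'X^2 + 24^-1 *: 'X^4.
have := @derive_ge0_le (fun y => horner p y - cos y) (fun y => (deriv p).[y] - - sin y) 0 x _ x0.
rewrite cos0 !hornerE/= => H.
have /H : forall y, 0 <= y <= x -> 0 <= (deriv p).[y] - - sin y.
  move=> y /andP[y0 _]; rewrite /p !poly.derivE !hornerE/=.
  have := sin_ge_cubic y0; lra.
lra.
Qed.

Lemma sin_sub_id_le x : `|sin x - x| <= x ^+ 2 / 2.
Proof.
wlog x0 : x / 0 <= x.
  move=> H; have [/H//|/ltW x0] := leP 0 x.
  have := H (- x); rewrite oppr_ge0 sinN => /(_ x0).
  by rewrite sqrrN -opprD normrN.
have h1 := sin_le_id x0; have h2 := sin_ge_cubic x0; have h3 := sin_geN1 x.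
rewrite ler_norml; apply/andP; split; last by nra.
(* Up to 3 the cubic bound suffices, as x^3/6 <= x^2/2; beyond 3, sin x >= -1 does. *)
have [x3|x3] := leP x 3; nra.
Qed.

(** The linear term is kept apart because it vanishes in the mean of a centered variable; what
    remains is a subgaussian bound for bounded variables. *)
Lemma expR_le_id_sqr x : expR x <= x + expR (4 * x ^+ 2).
Proof.
have e1 := expR_ge1Dx (4 * x ^+ 2).
have [x1|x1] := leP x (- 2^-1).
  have : expR x <= 1 by rewrite expR_le1; lra.
  nra.
have [x2|x2] := leP x (2^-1).
  have e2 := expR_ge1Dx (- x).
  have : expR x <= 1 + x + 2 * x ^+ 2.
    have e0 := expR_gt0 x.
    have : expR x * expR (- x) = 1 by rewrite -expRD subrr expR0.
    set A := expR x in e0 *; set B := expR (- x) in e2 *.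
    move=> AB; have : A * (1 - x) <= A * B by rewrite ler_pM2l.
    have : (1 + x + 2 * x ^+ 2) * (1 - x) >= 1 by nra.
    nra.
  nra.
have : expR x <= expR (4 * x ^+ 2) by rewrite ler_expR; nra.
lra.
Qed.

(** The k-th power of y <= exp y at y = |x|/k. It turns bounds on moment generating functions into
    bounds on moments. *)
Lemma pow_le_expR x k : (0 < k)%N -> `|x| ^+ k <= k%:R ^+ k * (expR x + expR (- x)).
Proof.
move=> k0; have k0' : 0 < k%:R :> R by rewrite ltr0n.
have H : (`|x| / k%:R) ^+ k <= expR x + expR (- x).
  apply: (@le_trans _ _ (expR `|x|)).
    rewrite (_ : expR `|x| = expR (`|x| / k%:R) ^+ k).
      by rewrite lerXn2r ?nnegrE ?expR_ge0// ?divr_ge0//; have := expR_ge1Dx (`|x| / k%:R); lra.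
    by rewrite -expRM_natl mulrC divfK// gt_eqF.
  have := expR_gt0 x; have := expR_gt0 (- x).
  by case: (ger0P x); lra.
rewrite expr_div_n ler_pdivrMr ?exprn_gt0// in H.
by rewrite mulrC.
Qed.

End RealInequalities.

(** * Chebyshev polynomials and the smoothed step *)

Section StepPolynomial.
Variable R : realType.
Implicit Types (x y a : R) (p : {poly R}).

(** Two consecutive Chebyshev polynomials of the first kind, so that the two-term recurrence is
    structural. *)
Fixpoint cheb_pair (n : nat) : {poly R} * {poly R} :=
  if n is m.+1 then let: (p, q) := cheb_pair m in (q, 2%:P * 'X * q - p)
  else (1, 'X).

Definition cheb n := (cheb_pair n).1.

Lemma cheb0 : cheb 0 = 1. Proof. by []. Qed.

Lemma cheb1 : cheb 1 = 'X. Proof. by []. Qed.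

Lemma chebSS n : cheb n.+2 = 2%:P * 'X * cheb n.+1 - cheb n.
Proof. by rewrite /cheb /=; case: (cheb_pair n). Qed.

Lemma cheb_ind (Q : nat -> Prop) :
  Q 0%N -> Q 1%N -> (forall n, Q n -> Q n.+1 -> Q n.+2) -> forall n, Q n.
Proof.
move=> Q0 Q1 QS n; suff [] : Q n /\ Q n.+1 by [].
by elim: n => // n [Qn QSn]; split => //; exact: QS.
Qed.

Lemma size_cheb n : (size (cheb n) <= n.+1)%N.
Proof.
elim/cheb_ind: n => [||n IH IHS].
- by rewrite cheb0 size_poly1.
- by rewrite cheb1 size_polyX.
rewrite chebSS (leq_trans (size_polyD _ _))// geq_max size_polyN.
rewrite (leq_trans IH) ?andbT; last by rewrite ltnS ltnW.
rewrite -mulrA mul_polyC (leq_trans (size_scale_leq _ _))//.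
rewrite mulrC; have [->|p0] := eqVneq (cheb n.+1) 0; first by rewrite mul0r size_poly0.
by rewrite size_mulX// ltnS.
Qed.

Lemma cheb_cos n x : (cheb n).[cos x] = cos (n%:R * x).
Proof.
elim/cheb_ind: n => [||n IH IHS].
- by rewrite cheb0 hornerC mul0r cos0.
- by rewrite cheb1 hornerX mul1r.
rewrite chebSS !hornerE IH IHS.
rewrite (_ : n.+2%:R * x = n.+1%:R * x + x); last by rewrite -(addn1 n.+1) natrD mulrDl mul1r.
rewrite (_ : n%:R * x = n.+1%:R * x - x); last by rewrite -(addn1 n) natrD mulrDl mul1r addrK.
by rewrite cosB cosD; ring.
Qed.

Lemma cheb_le1 n x : `|x| <= 1 -> `|(cheb n).[x]| <= 1.
Proof.
rewrite ler_norml => x1; rewrite -(acosK x1) cheb_cos ler_norml.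
by rewrite cos_geN1 cos_le1.
Qed.

Lemma cheb_hyp n y : y != 0 -> (cheb n).[(y + y^-1) / 2] = (y ^+ n + y ^- n) / 2.
Proof.
move=> y0; elim/cheb_ind: n => [||n IH IHS].
- by rewrite cheb0 hornerC !expr0 invr1; field.
- by rewrite cheb1 hornerX !expr1.
rewrite chebSS !hornerE IH IHS !exprS /=.
have := expf_neq0 n y0; set A := y ^+ n => A0.
by field; rewrite A0 y0.
Qed.

(** With z = sqrt(x^2 - 1), x + z and x - z are inverse to each other and [cheb_hyp] applies. An
    excess of x over 1 of order a^2 already gives z >= a, hence growth at rate 1 + a: this
    square-root gain is what keeps the degree of order 1/a up to logarithms. *)
Lemma cheb_ge n x a : 0 < a <= 1 -> 1 + 3 / 4 * a ^+ 2 <= x ->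
  (1 + a) ^+ n / 2 <= (cheb n).[x].
Proof.
move=> /andP[a0 a1] xa.
have x1 : 1 <= x by nra.
pose z := Num.sqrt (x ^+ 2 - 1).
have z2 : z ^+ 2 = x ^+ 2 - 1 by rewrite sqr_sqrtr//; nra.
have z0 : 0 <= z by exact: sqrtr_ge0.
have za : a <= z by rewrite -(@ler_pXn2r _ 2) ?nnegrE// ?ltW// z2; nra.
have y0 : 0 < x + z by nra.
have yV : (x + z)^-1 = x - z.
  apply: (mulfI (lt0r_neq0 y0)); rewrite mulfV ?gt_eqF//; nra.
have -> : x = ((x + z) + (x + z)^-1) / 2 by rewrite yV; field.
rewrite cheb_hyp ?gt_eqF// ler_pM2r ?invr_gt0//.
rewrite (@le_trans _ _ ((x + z) ^+ n))//.
  by rewrite lerXn2r ?nnegrE//; nra.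
by rewrite lerDl invr_ge0 exprn_ge0// ltW.
Qed.

Lemma cheb_growth n x : 1 <= `|x| -> `|(cheb n).[x]| <= (3 * `|x|) ^+ n.
Proof.
move=> x1; elim/cheb_ind: n => [||n IH IHS].
- by rewrite cheb0 hornerC normr1.
- by rewrite cheb1 hornerX expr1; lra.
rewrite chebSS !hornerE (le_trans (ler_normB _ _))// !normrM.
rewrite ger0_norm//.
move: IH IHS; rewrite !exprS; set A := (3 * `|x|) ^+ n => IH IHS.
have A0 : 0 <= A by rewrite exprn_ge0// mulr_ge0.
have : 2 * `|x| * `|(cheb n.+1).[x]| <= 2 * `|x| * (3 * `|x| * A).
  by rewrite ler_wpM2l// mulr_ge0.
have : A <= `|x| * (`|x| * A).
  rewrite mulrA ler_peMl//; nra.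
nra.
Qed.

Definition antideriv p : {poly R} :=
  \poly_(i < (size p).+1) (if i is j.+1 then p`_j / j.+1%:R else 0).

Lemma antiderivK p : deriv (antideriv p) = p.
Proof.
apply/polyP => i; rewrite coef_deriv coef_poly ltnS.
case: ltnP => ip; last by rewrite mul0rn nth_default.
by rewrite -[LHS]mulr_natr divfK// pnatr_eq0.
Qed.

Lemma size_antideriv p : (size (antideriv p) <= (size p).+1)%N.
Proof. exact: size_poly. Qed.

(* The integrand of the smoothed step: it is at most 1 on [a <= |s| <= 1] and
   exponentially large on [|s| <= a / 2]. *)
Definition bump a m : {poly R} := (cheb m \Po ((1 + a ^+ 2)%:P - 'X^2)) ^+ 2.

Lemma bumpE a m x : (bump a m).[x] = (cheb m).[1 + a ^+ 2 - x ^+ 2] ^+ 2.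
Proof. by rewrite /bump horner_exp horner_comp !hornerE. Qed.

Lemma bump_ge0 a m x : 0 <= (bump a m).[x].
Proof. by rewrite bumpE sqr_ge0. Qed.

Lemma bump_le1 a m x : 0 < a <= 1 -> a <= `|x| <= 1 -> (bump a m).[x] <= 1.
Proof.
move=> /andP[a0 a1] /andP[ax x1].
rewrite bumpE -[X in X <= _]norm_sqr expr_le1//; apply: cheb_le1.
have : a ^+ 2 <= x ^+ 2 by rewrite -(norm_sqr x) ler_exp// ltW.
have : x ^+ 2 <= 1 by rewrite -(norm_sqr x) expr_le1.
have : a ^+ 2 <= 1 by rewrite expr_le1// ltW.
have := sqr_ge0 a; rewrite ler_norml; lra.
Qed.

Lemma bump_peak a m x : 0 < a <= 1 -> `|x| <= a / 2 ->
  (1 + a) ^+ (2 * m) / 4 <= (bump a m).[x].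
Proof.
move=> a01 xa.
have /andP[a0 a1] := a01.
have x2 : x ^+ 2 <= a ^+ 2 / 4.
  rewrite (_ : a ^+ 2 / 4 = (a / 2) ^+ 2); last by field.
  by rewrite -(norm_sqr x) ler_exp.
have H := @cheb_ge m (1 + a ^+ 2 - x ^+ 2) a a01.
rewrite bumpE (_ : _ / 4 = ((1 + a) ^+ m / 2) ^+ 2); last first.
  by rewrite mulnC exprM expr_div_n; congr (_ / _); ring.
have A0 : 0 <= (1 + a) ^+ m / 2 by rewrite divr_ge0// exprn_ge0//; lra.
have := H; rewrite -[3 / 4 * _]/(3 / 4 * _) => {}H.
have {}H : (1 + a) ^+ m / 2 <= (cheb m).[1 + a ^+ 2 - x ^+ 2] by apply: H; lra.
by apply: ler_exp.
Qed.

Lemma bump_growth a m x : 0 < a <= 1 -> 1 <= `|x| ->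
  (bump a m).[x] <= (9 * x ^+ 2) ^+ (2 * m).
Proof.
move=> /andP[a0 a1] x1.
have x2 : 1 <= x ^+ 2 by rewrite -(norm_sqr x) exprn_ege1.
have B0 : 1 <= (9 * x ^+ 2) ^+ (2 * m) by rewrite exprn_ege1//; lra.
rewrite bumpE -[X in X <= _]norm_sqr.
have [y1|y1] := leP `|1 + a ^+ 2 - x ^+ 2| 1.
  by apply: le_trans B0; rewrite expr_le1//; exact: cheb_le1.
have a2 : a ^+ 2 <= 1 by rewrite expr_le1// ltW.
have a20 : 0 <= a ^+ 2 by exact: sqr_ge0.
rewrite exprM -exprM mulnC exprM; apply: ler_exp => //.
apply: (le_trans (cheb_growth m (ltW y1))).
apply: ler_exp; first by rewrite mulr_ge0.
have : `|1 + a ^+ 2 - x ^+ 2| <= 3 * x ^+ 2 by rewrite ler_norml; lra.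
lra.
Qed.

(** The integral of [bump] from -1. It climbs by at least the mass of the peak across [-a, a] and by
    at most 1 on either side within [-1, 1]. *)
Definition cumul a m : {poly R} := antideriv (bump a m) - (antideriv (bump a m)).[-1]%:P.

Lemma cumul_deriv a m x : is_derive x 1 (horner (cumul a m)) (bump a m).[x].
Proof.
have := is_derive_poly (cumul a m) x.
by rewrite /cumul derivB derivC subr0 antiderivK.
Qed.

Lemma cumulN1 a m : (cumul a m).[-1] = 0.
Proof. by rewrite /cumul !hornerE subrr. Qed.

Lemma cumul_le a m x y : x <= y -> (cumul a m).[x] <= (cumul a m).[y].
Proof.
move=> xy; apply: (derive_ge0_le (cumul_deriv a m) xy) => z _.
exact: bump_ge0.
Qed.

Lemma cumul_peak a m : 0 < a <= 1 ->
  a / 4 * (1 + a) ^+ (2 * m) <= (cumul a m).[a].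
Proof.
move=> a01; have /andP[a0 a1] := a01.
have h1 : 0 <= (cumul a m).[- (a / 2)].
  by rewrite -(cumulN1 a m) cumul_le//; lra.
have h2 : (cumul a m).[a / 2] <= (cumul a m).[a] by rewrite cumul_le//; lra.
have h3 : - (a / 2) <= a / 2 by lra.
have /(increment_ge (cumul_deriv a m) h3) :
    forall x, - (a / 2) <= x <= a / 2 -> (1 + a) ^+ (2 * m) / 4 <= (bump a m).[x].
  by move=> x xa; apply: bump_peak => //; rewrite ler_norml.
lra.
Qed.

Lemma cumul_left a m x : 0 < a <= 1 -> -1 <= x <= - a -> (cumul a m).[x] <= 1.
Proof.
move=> a01 /andP[x1 xa]; have /andP[a0 a1] := a01.
have : forall y, -1 <= y <= x -> (bump a m).[y] <= 1.
  move=> y /andP[y1 yx]; apply: bump_le1 => //.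
  by rewrite ler0_norm; lra.
move=> /(increment_le (cumul_deriv a m) x1); rewrite cumulN1; lra.
Qed.

Lemma cumul_right a m x : 0 < a <= 1 -> a <= x <= 1 -> (cumul a m).[x] <= (cumul a m).[a] + 1.
Proof.
move=> a01 /andP[ax x1]; have /andP[a0 a1] := a01.
have : forall y, a <= y <= x -> (bump a m).[y] <= 1.
  move=> y /andP[y1 yx]; apply: bump_le1 => //.
  by rewrite ger0_norm; lra.
move=> /(increment_le (cumul_deriv a m) ax); lra.
Qed.

Lemma cumul_growth a m x : 0 < a <= 1 -> 1 <= `|x| ->
  `|(cumul a m).[x]| <= (cumul a m).[a] + 1 + `|x| * (9 * x ^+ 2) ^+ (2 * m).
Proof.
move=> a01 x1; have /andP[a0 a1] := a01.
have Ca : 0 <= (cumul a m).[a] by rewrite -(cumulN1 a m) cumul_le//; lra.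
set B := (9 * x ^+ 2) ^+ (2 * m).
have B0 : 0 <= B by rewrite exprn_ge0// mulr_ge0// sqr_ge0.
have HB y : 1 <= `|y| -> `|y| <= `|x| -> (bump a m).[y] <= B.
  move=> y1 yx; apply: (le_trans (bump_growth m a01 y1)).
  apply: ler_exp; first by rewrite mulr_ge0// sqr_ge0.
  by rewrite ler_pM2l// -(norm_sqr x) -(norm_sqr y) ler_exp.
have [x0|x0] := leP 0 x.
  rewrite ger0_norm in x1 HB *; last by [].
  have C1 : 0 <= (cumul a m).[x] by rewrite -(cumulN1 a m) cumul_le//; lra.
  rewrite (ger0_norm C1).
  have h1 : (cumul a m).[1] <= (cumul a m).[a] + 1 by apply: cumul_right => //; lra.
  have : forall y, 1 <= y <= x -> (bump a m).[y] <= B.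
    by move=> y /andP[y1 yx]; apply: HB; rewrite ger0_norm//; lra.
  move=> /(increment_le (cumul_deriv a m) x1); nra.
rewrite ltr0_norm in x1 HB *; last by [].
have x1' : x <= -1 by lra.
have C1 : (cumul a m).[x] <= 0 by rewrite -(cumulN1 a m) cumul_le.
rewrite (ler0_norm C1).
have : forall y, x <= y <= -1 -> (bump a m).[y] <= B.
  by move=> y /andP[y1 yx]; apply: HB; rewrite ler0_norm//; lra.
move=> /(increment_le (cumul_deriv a m) x1'); rewrite cumulN1; nra.
Qed.

Lemma size_cumul a m : (size (cumul a m) <= (4 * m).+2)%N.
Proof.
rewrite /cumul (leq_trans (size_polyD _ _))// geq_max; apply/andP; split; last first.
  by rewrite size_polyN (leq_trans (size_polyC_leq1 _)).
rewrite (leq_trans (size_antideriv _))// ltnS /bump.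
have s2 : (size ((1 + a ^+ 2)%:P - 'X^2 : {poly R})%R <= 3)%N.
  rewrite (leq_trans (size_polyD _ _))// geq_max size_polyN size_polyXn andbT.
  by rewrite (leq_trans (size_polyC_leq1 _)).
have s1 : (size (cheb m \Po ((1 + a ^+ 2)%:P - 'X^2)) <= (2 * m).+1)%N.
  rewrite (leq_trans (size_comp_poly_leq _ _))// ltnS mulnC leq_mul//.
    by case: (size _) s2 => [|[|[|]]].
  by have := size_cheb m; case: (size _).
rewrite expr2 (leq_trans (size_polyMleq _ _))//.
by move: s1; set k := size _; lia.
Qed.

(** Normalized by its value at [a], which is at least [Z], the integral of [bump] is of order 1/Z
    before its jump and at most 1 + 1/Z after it. Squaring makes it nonnegative everywhere and keeps
    it above 1 on the right. For |t| <= 1/2 the argument t + a stays in [-1, 1], where [bump] is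
    controlled. *)
Lemma step_polynomial a m : 0 < a <= 1 / 4 ->
  let Z := a / 4 * (1 + a) ^+ (2 * m) in 1 <= Z ->
  exists p : {poly R}, [/\ (size p <= (8 * m).+3)%N,
    forall t, 0 <= p.[t],
    forall t, 0 <= t -> 1 <= p.[t],
    (forall t, `|t| <= 1 / 2 -> p.[t] <= (1 + Z^-1) ^+ 2) /\
    (forall t, -(1 / 2) <= t <= - (2 * a) -> p.[t] <= Z ^- 2) &
    forall t, 1 / 2 <= `|t| -> p.[t] <= (12 * `|t|) ^+ (8 * m).+2].
Proof.
move=> /andP[a0 a4] Z Z1.
have a01 : 0 < a <= 1 by rewrite a0; lra.
set c := (cumul a m).[a].
have cZ : Z <= c by exact: cumul_peak.
have c0 : 0 < c by lra.
have cV : c^-1 <= Z^-1 by rewrite lef_pV2 ?posrE//; lra.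
have cV0 : 0 < c^-1 by rewrite invr_gt0.
have Z10 : Z^-1 <= 1 by rewrite invf_le1//; lra.
(* The shift by [a] moves the jump from [-a, a] to [-2a, 0], so that [q] is at least 1 on all t >=
   0. *)
pose q := c^-1 *: (cumul a m \Po ('X + a%:P)).
have qE t : q.[t] = (cumul a m).[t + a] / c.
  by rewrite /q hornerZ horner_comp !hornerE mulrC.
exists (q ^+ 2); split.
(* The degrees are 4m for [bump], 4m + 1 for [q] and 8m + 2 for its square. *)
- have sq : (size q <= (4 * m).+2)%N.
    rewrite (leq_trans (size_scale_leq _ _))//.
    rewrite (leq_trans (size_comp_poly_leq _ _))// size_XaddC muln1.
    by have := size_cumul a m; case: (size _).
  rewrite expr2 (leq_trans (size_polyMleq _ _))//.
  by move: sq; set k := size _; lia.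
- by move=> t; rewrite horner_exp sqr_ge0.
- move=> t t0; rewrite horner_exp exprn_ege1// qE ler_pdivlMr// mul1r.
  by rewrite cumul_le//; lra.
- split => t.
    rewrite ler_norml => /andP[t1 t2]; rewrite horner_exp qE.
    have l0 : 0 <= (cumul a m).[t + a] by rewrite -(cumulN1 a m) cumul_le//; lra.
    apply: ler_exp; first by rewrite divr_ge0// ltW.
    rewrite ler_pdivrMr//.
    have : 1 <= Z^-1 * c by rewrite mulrC ler_pdivlMr; lra.
    suff : (cumul a m).[t + a] <= c + 1 by lra.
    have [ta|ta] := leP a (t + a); first by apply: cumul_right => //; lra.
    by rewrite (le_trans (cumul_le _ _ (ltW ta))) ?lerDl.
  move=> /andP[t1 t2]; rewrite horner_exp qE -exprVn.
  have l0 : 0 <= (cumul a m).[t + a] by rewrite -(cumulN1 a m) cumul_le//; lra.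
  apply: ler_exp; first by rewrite divr_ge0// ltW.
  apply: le_trans cV; rewrite ler_pdivrMr// mulVf ?gt_eqF//.
  by apply: cumul_left => //; lra.
- move=> t t2; rewrite horner_exp qE.
  rewrite (_ : (8 * m).+2 = ((4 * m).+1 * 2)%N); last by lia.
  rewrite exprM -norm_sqr; apply: ler_exp => //.
  rewrite normrM (gtr0_norm cV0) ler_pdivrMr//.
  set s := t + a.
  have st : `|s| <= 2 * `|t|.
    rewrite (le_trans (ler_normD _ _))// (gtr0_norm a0); lra.
  set B := (144 * t ^+ 2) ^+ (2 * m).
  have tt : 1 <= 144 * t ^+ 2.
    rewrite -(norm_sqr t); nra.
  have B1 : 1 <= B by rewrite exprn_ege1.
  have -> : (12 * `|t|) ^+ (4 * m).+1 = 12 * `|t| * B.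
    have -> : (4 * m = 2 * (2 * m))%N by rewrite mulnA.
    have E : 144 * t ^+ 2 = (12 * `|t|) ^+ 2 by rewrite exprMn norm_sqr; ring.
    by rewrite /B E exprS -exprM.
  have big : 3 * c <= 6 * `|t| * B * c.
    by rewrite ler_pM2r//; nra.
  have tB : 0 <= 6 * `|t| * B * c by rewrite !mulr_ge0// ?ltW//; lra.
  have [s1|s1] := leP `|s| 1.
    have l0 : 0 <= (cumul a m).[s] by rewrite -(cumulN1 a m) cumul_le//; rewrite ler_norml in s1;
        lra.
    rewrite (ger0_norm l0).
    suff : (cumul a m).[s] <= c + 1 by lra.
    have [ta|ta] := leP a s.
      by apply: cumul_right => //; rewrite ler_norml in s1; lra.
    by rewrite (le_trans (cumul_le _ _ (ltW ta))) ?lerDl.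
  apply: (le_trans (cumul_growth m a01 (ltW s1))); rewrite -/c.
  have : `|s| * (9 * s ^+ 2) ^+ (2 * m) <= 2 * `|t| * B.
    apply: ler_pM => //; first by rewrite exprn_ge0// mulr_ge0// sqr_ge0.
    apply: ler_exp; first by rewrite mulr_ge0// sqr_ge0.
    rewrite -(norm_sqr s) -(norm_sqr t).
    have := normr_ge0 s; nra.
  have : 2 * `|t| * B <= 2 * `|t| * B * c by rewrite ler_peMr ?mulr_ge0//; lra.
  lra.
Qed.

End StepPolynomial.

(** * Subgaussian variables *)

Section SubGaussian.
Context (d : measure_display) (T : measurableType d) (R : realType).
Variable (P : probability T R).
Implicit Types (Y : T -> R) (kappa s u : R).

Definition mgf_bound kappa V Y := forall l : R,
  itg P (fun t => expR (l * Y t)) /\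
  Ex P (fun t => expR (l * Y t)) <= expR (kappa * l ^+ 2 * V).

(** One scale [s] serves both sides: it bounds the variance from below, for anticoncentration, and
    up to [kappa] the moment generating function from above, for tails. It need not be the standard
    deviation, and s = 0 covers constants. *)
Definition subgauss kappa s Y :=
  [/\ 0 <= s, measurable_fun setT Y, Ex P Y = 0,
      s ^+ 2 <= Ex P (fun t => Y t ^+ 2) & mgf_bound kappa (s ^+ 2) Y].

Lemma mgf_pow kappa V Y k : measurable_fun setT Y -> mgf_bound kappa V Y -> (0 < k)%N ->
  itg P (fun t => `|Y t| ^+ k) /\
  forall l, Ex P (fun t => `|l * Y t| ^+ k) <=
            2 * k%:R ^+ k * expR (kappa * l ^+ 2 * V).
Proof.
move=> mY H k0.
have mn l : measurable_fun setT (fun t => `|l * Y t| ^+ k).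
  by apply: measurable_funX; apply: measurableT_comp => //; exact: measurable_funM.
have [i1 _] := H 1; have [i2 _] := H (-1).
have HN l : expR (kappa * (- l) ^+ 2 * V) = expR (kappa * l ^+ 2 * V) by rewrite sqrrN.
have B l t : `| `|l * Y t| ^+ k | <= k%:R ^+ k * (expR (l * Y t) + expR (- l * Y t)).
  by rewrite ger0_norm ?exprn_ge0// mulNr pow_le_expR.
have I l : itg P (fun t => k%:R ^+ k * (expR (l * Y t) + expR (- l * Y t))).
  have [j1 _] := H l; have [j2 _] := H (- l).
  by apply: itgZ; exact: itgD.
split.
  rewrite (_ : (fun t => _) = (fun t => `|1 * Y t| ^+ k)).
    exact: (itg_le (I 1) (mn 1) (B 1)).
  by apply/funext => t; rewrite mul1r.
move=> l.
have [j1 b1] := H l; have [j2 b2] := H (- l).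
rewrite (le_trans (Ex_le (itg_le (I l) (mn l) (B l)) (I l) _))//.
  by move=> t; rewrite (le_trans _ (B l t))// ler_norm.
rewrite ExZ; last exact: itgD.
rewrite ExD// -mulrA mulrCA ler_wpM2l ?exprn_ge0//.
by rewrite HN in b2; lra.
Qed.

Lemma expR1_le4 : expR (1 : R) <= 4.
Proof.
have h : 1 / 2 <= expR (- (1 / 2) : R) by have := expR_ge1Dx (- (1 / 2) : R); lra.
have e : expR (1 / 2 : R) * expR (- (1 / 2)) = 1 by rewrite -expRD subrr expR0.
have -> : (1 : R) = 1 / 2 + 1 / 2 by field.
rewrite expRD; have := expR_gt0 (1 / 2 : R); nra.
Qed.

Lemma tail_moment kappa V Y M c : measurable_fun setT Y -> mgf_bound kappa V Y ->
  (0 < M)%N -> 0 < c -> 64 * kappa * M%:R * V <= c ^+ 2 ->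
  itg P (fun t => (Y t / c) ^+ (2 * M)) /\
  Ex P (fun t => (Y t / c) ^+ (2 * M)) <= 2^-1 ^+ M.
Proof.
move=> mY H M0 c0 Hc.
have k0 : (0 < 2 * M)%N by rewrite muln_gt0.
have [i b] := mgf_pow mY H k0.
have E t : (Y t / c) ^+ (2 * M) = (c ^- (2 * M)) * `|Y t| ^+ (2 * M).
  by rewrite expr_div_n mulrC; congr (_ * _); rewrite !exprM norm_sqr.
rewrite (_ : (fun t => _) = (fun t => (c ^- (2 * M)) * `|Y t| ^+ (2 * M))); last first.
  by apply/funext.
split; first exact: itgZ.
(* With l = 8M/c the exponent kappa l^2 V is at most M, and the powers combine to 2 * 4^M / 16^M <=
   2^-M. *)
pose l := 4 * (2 * M)%:R / c.
have l0 : 0 < l by rewrite divr_gt0// mulr_gt0// ltr0n.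
have M0' : 0 < M%:R :> R by rewrite ltr0n.
have e1 : kappa * l ^+ 2 * V <= M%:R.
  rewrite (_ : _ * V = 64 * kappa * M%:R * V * (M%:R / c ^+ 2)); last first.
    by rewrite /l natrM; field; rewrite gt_eqF.
  rewrite -[leRHS]mul1r (_ : 1 * M%:R = c ^+ 2 * (M%:R / c ^+ 2)); last first.
    by field; rewrite gt_eqF.
  by rewrite ler_wpM2r// divr_ge0 ?ler0n ?sqr_ge0.
have e2 : expR (kappa * l ^+ 2 * V) <= 4 ^+ M.
  apply: (@le_trans _ _ (expR M%:R)); first by rewrite ler_expR.
  by rewrite -[M%:R]mulr1 expRM_natl; apply: ler_exp; [exact: expR_ge0|exact: expR1_le4].
have := b l.
rewrite (_ : (fun t => `|l * Y t| ^+ _) = (fun t => l ^+ (2 * M) * `|Y t| ^+ (2 * M))); last first.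
  by apply/funext => t; rewrite normrM (gtr0_norm l0) exprMn.
rewrite !ExZ// => b'.
have {}b' : l ^+ (2 * M) * Ex P (fun t => `|Y t| ^+ (2 * M)) <= 2 * (2 * M)%:R ^+ (2 * M) * 4 ^+ M.
  by apply: (le_trans b'); rewrite ler_wpM2l// mulr_ge0// exprn_ge0.
have -> : c ^- (2 * M) = (4 * (2 * M)%:R) ^- (2 * M) * l ^+ (2 * M).
  rewrite /l expr_div_n mulrA mulVf ?mul1r// expf_neq0// mulf_neq0// pnatr_eq0.
  by rewrite -lt0n.
rewrite -mulrA (le_trans (ler_wpM2l _ b'))//.
rewrite exprMn invfM [2 * _]mulrC -!mulrA [X in _ * X]mulrA mulVf ?mul1r; last first.
  by rewrite expf_neq0// pnatr_eq0 -lt0n.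
rewrite exprM (_ : (4 ^+ 2) = 4 * 4 :> R); last by ring.
rewrite exprMn invfM -mulrA [X in _ * X]mulrCA mulVf ?mulr1 ?expf_neq0//.
rewrite (_ : 4 = 2 * 2 :> R); last by ring.
rewrite exprMn invfM -!exprVn -mulrA -[leRHS]mulr1 ler_wpM2l ?exprn_ge0//.
case: M M0 {k0 i b E l l0 M0' e1 e2 b' Hc} => // M _.
by rewrite exprS mulrAC mulVf// mul1r exprn_ile1// invf_le1// ler1n.
Qed.

Lemma tail_prob Y M c p : measurable_fun setT Y -> 0 < c ->
  itg P (fun t => (Y t / c) ^+ (2 * M)) ->
  Ex P (fun t => (Y t / c) ^+ (2 * M)) <= p ->
  Ex P (fun t => (c < `|Y t|)%R%:R) <= p.
Proof.
move=> mY c0 i; apply: le_trans; apply: Ex_le => //.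
  apply: itg_bool; apply: measurable_fun_ltr => //.
  exact: measurableT_comp.
move=> t; rewrite exprM; case: ltP => h; last by rewrite exprn_ge0// sqr_ge0.
rewrite exprn_ege1// -norm_sqr exprn_ege1// normrM normfV (gtr0_norm c0).
by rewrite ler_pdivlMr// mul1r ltW.
Qed.

(** The squared modulus of the characteristic function of [Y] at [u]. *)
Definition chf_sqr Y u :=
  Ex P (fun t => cos (u * Y t)) ^+ 2 + Ex P (fun t => sin (u * Y t)) ^+ 2.

Lemma measurable_cos : measurable_fun setT (@cos R).
Proof. by apply: continuous_measurable_fun; exact: continuous_cos. Qed.

Lemma measurable_sin : measurable_fun setT (@sin R).
Proof. by apply: continuous_measurable_fun; exact: continuous_sin. Qed.

Lemma itg_cos Y : measurable_fun setT Y -> itg P (fun t => cos (Y t)).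
Proof.
move=> mY; apply: (@itg_bnd _ _ _ _ 1); last by move=> t; exact: cos_max.
by apply: measurableT_comp => //; exact: measurable_cos.
Qed.

Lemma itg_sin Y : measurable_fun setT Y -> itg P (fun t => sin (Y t)).
Proof.
move=> mY; apply: (@itg_bnd _ _ _ _ 1); last by move=> t; exact: sin_max.
by apply: measurableT_comp => //; exact: measurable_sin.
Qed.

(** The mean on the left is the real part of the characteristic function rotated by the angle [b],
    hence at most its modulus. *)
Lemma Ex_cos_shift Y u b : measurable_fun setT Y ->
  Ex P (fun t => cos (u * Y t - b)) ^+ 2 <= chf_sqr Y u.
Proof.
move=> mY; have muY : measurable_fun setT (fun t => u * Y t) by exact: measurable_funM.
have -> : Ex P (fun t => cos (u * Y t - b)) =
    cos b * Ex P (fun t => cos (u * Y t)) + sin b * Ex P (fun t => sin (u * Y t)).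
  rewrite -!ExZ; [|exact: itg_sin|exact: itg_cos].
  rewrite -ExD; [|by apply: itgZ; exact: itg_cos|by apply: itgZ; exact: itg_sin].
  by apply: eq_Ex => t; rewrite cosB; ring.
rewrite /chf_sqr; have := cos2Dsin2 b.
set x := Ex _ _; set y := Ex _ _; set p := cos b; set q := sin b => pq.
have -> : x ^+ 2 + y ^+ 2 = (p * x + q * y) ^+ 2 + (p * y - q * x) ^+ 2.
  by rewrite -[LHS]mul1r -pq; ring.
by rewrite lerDl sqr_ge0.
Qed.

Lemma sqr_Ex_le Y : measurable_fun setT Y -> (forall t, `|Y t| <= 1) ->
  Ex P Y ^+ 2 <= Ex P (fun t => Y t ^+ 2).
Proof.
move=> mY Y1; set m := Ex P Y.
have iY : itg P Y by exact: (itg_bnd P mY Y1).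
have iY2 : itg P (fun t => Y t ^+ 2).
  apply: (@itg_bnd _ _ _ _ 1); first exact: measurable_funX.
  by move=> t; rewrite ger0_norm ?sqr_ge0// -norm_sqr expr_le1.
have : 0 <= Ex P (fun t => (Y t ^+ 2 - 2 * m * Y t) + m ^+ 2).
  by apply: Ex_ge0 => t; have := sqr_ge0 (Y t - m); lra.
have iA : itg P (fun t => 2 * m * Y t) by exact: itgZ.
have iB : itg P (fun t => Y t ^+ 2 - 2 * m * Y t) by exact: itgB.
have iC := itg_cst P (m ^+ 2).
by rewrite ExD// ExB// ExZ// Ex_cst -/m; lra.
Qed.

Lemma chf_sqr_le1 Y u : measurable_fun setT Y -> chf_sqr Y u <= 1.
Proof.
move=> mY; have muY : measurable_fun setT (fun t => u * Y t) by exact: measurable_funM.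
have mc : measurable_fun setT (fun t => cos (u * Y t)).
  by apply: measurableT_comp => //; exact: measurable_cos.
have ms : measurable_fun setT (fun t => sin (u * Y t)).
  by apply: measurableT_comp => //; exact: measurable_sin.
have h1 := sqr_Ex_le mc (fun t => cos_max _).
have h2 := sqr_Ex_le ms (fun t => sin_max _).
rewrite (le_trans (lerD h1 h2))// -ExD.
- by rewrite (eq_Ex _ (Z := fun=> 1)) ?Ex_cst// => t; exact: cos2Dsin2.
- apply: (@itg_bnd _ _ _ _ 1); first exact: measurable_funX.
  by move=> t; rewrite ger0_norm ?sqr_ge0// -norm_sqr expr_le1// cos_max.
- apply: (@itg_bnd _ _ _ _ 1); first exact: measurable_funX.
  by move=> t; rewrite ger0_norm ?sqr_ge0// -norm_sqr expr_le1// sin_max.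
Qed.

Lemma chf_sqr_ge0 Y u : 0 <= chf_sqr Y u.
Proof. by rewrite addr_ge0// sqr_ge0. Qed.

(** Below the frequency 1/sqrt([chf_const kappa]), in units of 1/s, the quadratic term of the
    characteristic function dominates. The factor kappa^2 comes from the fourth moment and from the
    square of the mean sine. *)
Definition chf_const kappa := 2 * 10 ^+ 3 * kappa ^+ 2.

Lemma chf_const_ge2 kappa : 1 <= kappa -> 2 <= chf_const kappa.
Proof. by move=> k1; have : 1 <= kappa ^+ 2 by [rewrite exprn_ege1]; rewrite /chf_const; lra. Qed.

(** With v = u s, expansion gives a mean cosine of at most 1 - v^2/2 + 86 kappa^2 v^4 and, [Y] being
    centered, a mean sine of modulus at most 16 kappa v^2; for small v the sum of squares falls
    below 1 - v^2/2. *)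
Lemma chf_sqr_bound kappa s Y u : 1 <= kappa -> subgauss kappa s Y ->
  chf_const kappa * (u * s) ^+ 2 <= 1 ->
  chf_sqr Y u <= 1 - (u * s) ^+ 2 / 2.
Proof.
rewrite /chf_const => k1 [s0 mY Y0 Y2 H] Hv.
have [s0'|s0'] := eqVneq s 0.
  by rewrite s0' mulr0 expr0n/= mul0r subr0 chf_sqr_le1.
have {}s0 : 0 < s by rewrite lt_neqAle eq_sym s0'.
have muY : measurable_fun setT (fun t => u * Y t) by exact: measurable_funM.
have [i1 _] := mgf_pow mY H (isT : (0 < 1)%N).
have [i2 b2] := mgf_pow mY H (isT : (0 < 2)%N).
have [i4 b4] := mgf_pow mY H (isT : (0 < 4)%N).
(* This [l] makes the exponent in [mgf_pow] equal to 1. The second and fourth moments are then at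
   most 2 * 2^2 * 4 = 32 and 2 * 4^4 * 4 = 2048, in units of kappa s^2 and its square. *)
pose l := (Num.sqrt kappa * s)^-1.
have k0 : 0 < kappa by lra.
have l2 : l ^+ 2 = (kappa * s ^+ 2)^-1.
  by rewrite /l exprVn exprMn sqr_sqrtr// ltW.
have l4 : l ^+ 4 = (kappa ^+ 2 * s ^+ 4)^-1.
  by rewrite (_ : 4 = 2 * 2)%N// exprM l2 exprVn exprMn -exprM.
have e4 : expR (kappa * l ^+ 2 * s ^+ 2) <= 4.
  rewrite l2 (_ : _ * s ^+ 2 = 1); first exact: expR1_le4.
  by field; rewrite !gt_eqF.
have iY2 : itg P (fun t => Y t ^+ 2).
  by rewrite (_ : (fun t => _) = (fun t => `|Y t| ^+ 2))//; apply/funext => t; rewrite norm_sqr.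
have iY4 : itg P (fun t => Y t ^+ 4).
  rewrite (_ : (fun t => _) = (fun t => `|Y t| ^+ 4))//; apply/funext => t.
  by rewrite (_ : 4 = 2 * 2)%N// !exprM norm_sqr.
have iY : itg P Y by apply: (itg_le i1) => // t; rewrite expr1.
have B2 : Ex P (fun t => Y t ^+ 2) <= 32 * kappa * s ^+ 2.
  have : Ex P (fun t => `|l * Y t| ^+ 2) <= 32 by have := b2 l; lra.
  rewrite (_ : (fun t => _) = (fun t => l ^+ 2 * Y t ^+ 2)); last first.
    by apply/funext => t; rewrite norm_sqr exprMn.
  rewrite ExZ// l2 mulrC ler_pdivrMr ?mulr_gt0 ?exprn_gt0// => /le_trans; apply.
  by rewrite -mulrA.
have B4 : Ex P (fun t => Y t ^+ 4) <= 2048 * kappa ^+ 2 * s ^+ 4.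
  have : Ex P (fun t => `|l * Y t| ^+ 4) <= 2048 by have := b4 l; lra.
  rewrite (_ : (fun t => _) = (fun t => l ^+ 4 * Y t ^+ 4)); last first.
    by apply/funext => t; rewrite -exprMn (_ : 4 = 2 * 2)%N// !exprM norm_sqr.
  rewrite ExZ// l4 mulrC ler_pdivrMr ?mulr_gt0 ?exprn_gt0// => /le_trans; apply.
  by rewrite -mulrA.
set v2 := (u * s) ^+ 2 in Hv *.
have v20 : 0 <= v2 by exact: sqr_ge0.
have hc : Ex P (fun t => cos (u * Y t)) <= 1 - v2 / 2 + 86 * kappa ^+ 2 * v2 ^+ 2.
  have : Ex P (fun t => cos (u * Y t)) <=
      Ex P (fun t => (1 - (u ^+ 2 / 2) * Y t ^+ 2) + (u ^+ 4 / 24) * Y t ^+ 4).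
    apply: Ex_le; first exact: itg_cos.
      by apply: itgD; [apply: itgB; [exact: itg_cst|exact: itgZ]|exact: itgZ].
    by move=> t; have := cos_le_quartic (u * Y t); rewrite !exprMn; lra.
  move/le_trans; apply.
  rewrite ExD ?ExB ?ExZ ?Ex_cst//; [|exact: itg_cst|exact: itgZ| |exact: itgZ]; last first.
    by apply: itgB; [exact: itg_cst|exact: itgZ].
  have h1 : (u ^+ 2 / 2) * s ^+ 2 <= (u ^+ 2 / 2) * Ex P (fun t => Y t ^+ 2).
    by rewrite ler_wpM2l// divr_ge0// sqr_ge0.
  have h2 : (u ^+ 4 / 24) * Ex P (fun t => Y t ^+ 4) <= (u ^+ 4 / 24) * (2048 * kappa ^+ 2 * s ^+
      4).
    by rewrite ler_wpM2l// divr_ge0// exprn_even_ge0.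
  have h3 : (u ^+ 4 / 24) * (2048 * kappa ^+ 2 * s ^+ 4) <= 86 * kappa ^+ 2 * v2 ^+ 2.
    rewrite (_ : v2 ^+ 2 = u ^+ 4 * s ^+ 4); last by rewrite /v2; ring.
    have : 0 <= (kappa * u ^+ 2 * s ^+ 2) ^+ 2 by exact: sqr_ge0.
    lra.
  have h4 : v2 = u ^+ 2 * s ^+ 2 by rewrite /v2; ring.
  lra.
have uE : u ^+ 2 * Ex P (fun t => Y t ^+ 2) <= 32 * kappa * v2.
  rewrite (_ : _ * v2 = u ^+ 2 * (32 * kappa * s ^+ 2)); last by rewrite /v2; ring.
  by rewrite ler_wpM2l// sqr_ge0.
have hc' : 1 - 16 * kappa * v2 <= Ex P (fun t => cos (u * Y t)).
  have : Ex P (fun t => 1 - (u ^+ 2 / 2) * Y t ^+ 2) <= Ex P (fun t => cos (u * Y t)).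
    apply: Ex_le; last by move=> t; have := cos_ge_quad (u * Y t); rewrite !exprMn; lra.
      by apply: itgB; [exact: itg_cst|exact: itgZ].
    exact: itg_cos.
  apply: le_trans.
  rewrite ExB ?ExZ ?Ex_cst//; [lra|exact: itg_cst|exact: itgZ].
have iu : itg P (fun t => u * Y t) by exact: itgZ.
have EuY : Ex P (fun t => u * Y t) = 0 by rewrite ExZ// Y0 mulr0.
have hs : `|Ex P (fun t => sin (u * Y t))| <= 16 * kappa * v2.
  (* Since u Y has mean 0 it may be subtracted, which leaves a quadratic remainder. *)
  have E1 : Ex P (fun t => sin (u * Y t)) = Ex P (fun t => sin (u * Y t) - u * Y t).
    by rewrite ExB ?EuY ?subr0//; exact: itg_sin.
  have i3 : itg P (fun t => sin (u * Y t) - u * Y t) by apply: itgB => //; exact: itg_sin.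
  have i5 : itg P (fun t => (u ^+ 2 / 2) * Y t ^+ 2) by exact: itgZ.
  have E2 : Ex P (fun t => (u ^+ 2 / 2) * Y t ^+ 2) <= 16 * kappa * v2.
    by rewrite ExZ//; lra.
  rewrite E1 ler_norml; apply/andP; split.
    apply: (@le_trans _ _ (Ex P (fun t => -1 * ((u ^+ 2 / 2) * Y t ^+ 2)))).
      by rewrite ExZ//; lra.
    apply: Ex_le => //; first exact: itgZ.
    by move=> t; have := sin_sub_id_le (u * Y t); rewrite exprMn ler_norml; lra.
  apply: le_trans E2; apply: Ex_le => //.
  by move=> t; have := sin_sub_id_le (u * Y t); rewrite exprMn ler_norml; lra.
rewrite /chf_sqr -[X in _ + X]norm_sqr.
move: hc hc' hs; set x := Ex _ _; set y := `|_| => hc hc' hs.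
have y0 : 0 <= y by exact: normr_ge0.
have v21 : v2 <= 1 / (2 * 10 ^+ 3) by nra.
have kv : kappa * v2 <= 1 / (2 * 10 ^+ 3) by nra.
have k2v : kappa ^+ 2 * v2 ^+ 2 <= v2 / (2 * 10 ^+ 3) by nra.
have hx : x <= 1 - 45 / 100 * v2 by lra.
have hx0 : 0 <= x by lra.
have hx2 : x ^+ 2 <= (1 - 45 / 100 * v2) ^+ 2 by apply: ler_exp.
have hy2 : y ^+ 2 <= (16 * kappa * v2) ^+ 2 by apply: ler_exp.
nra.
Qed.

End SubGaussian.

(** * Anticoncentration of linear forms *)

Lemma set_ind (n : nat) (Q : {set 'I_n} -> Prop) :
  Q finset.set0 -> (forall (A : {set 'I_n}) j, j \notin A -> Q A -> Q (j |: A)%SET) -> forall A,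
      Q A.
Proof.
move=> Q0 QU A; have [k] := ubnP #|A|; elim: k A => // k IH A Ak.
have [->//|[j jA]] := set_0Vmem A.
rewrite -(finset.setD1K jA); apply: QU; first by rewrite !inE eqxx.
by apply: IH; move: Ak; rewrite (cardsD1 j) jA.
Qed.

Section LinearForms.
Context (d : measure_display) (T : measurableType d) (R : realType).
Variables (P : probability T R) (n : nat) (X : 'I_n -> {RV P >-> R}).
Hypothesis indep : mutually_independent X.
Variables (m s : 'I_n -> R) (kappa : R).
Hypothesis kappa1 : 1 <= kappa.
Hypothesis sg : forall j, subgauss P kappa (s j) (fun t => X j t - m j).
Implicit Types (w : 'I_n -> R) (A B : {set 'I_n}).

Definition lin w A (x : 'I_n -> R) := \sum_(j in A) w j * (x j - m j).

Definition linX w A (t : T) := lin w A (X^~ t).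

Definition var w A := \sum_(j in A) (w j * s j) ^+ 2.

Lemma var_ge0 w A : 0 <= var w A.
Proof. by apply: sumr_ge0 => j _; exact: sqr_ge0. Qed.

Lemma linX_set0 w t : linX w finset.set0 t = 0.
Proof. by rewrite /linX /lin big_set0. Qed.

Lemma linX_setU1 w A j t : j \notin A ->
  linX w (j |: A)%SET t = linX w A t + w j * (X j t - m j).
Proof. by move=> jA; rewrite /linX /lin big_setU1//= addrC. Qed.

Lemma measurable_lin w A B : A \subset B ->
  measurable_fun setT (linX w A : sigJ X B -> R).
Proof.
move=> AB; rewrite /linX /lin (_ : (fun t => _) = (fun t => \sum_j
    (if j \in A then w j * (X j t - m j) else 0))); last first.
  by apply/funext => t; rewrite big_mkcond.
apply: measurable_sum => j; case jA : (j \in A); last exact: measurable_cst.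
apply: measurable_funM; first exact: measurable_cst.
apply: measurable_funB; last exact: measurable_cst.
by apply: measurable_coord; exact: (fintype.subsetP AB).
Qed.

Lemma measurable_linX w A : measurable_fun setT (linX w A).
Proof. exact: (sigJ_fun (measurable_lin w (fintype.subxx A))). Qed.

Lemma mgf_lin w A : mgf_bound P kappa (var w A) (linX w A).
Proof.
elim/set_ind: A => [l|A j jA IH l].
  rewrite /var big_set0 mulr0 expR0 (_ : (fun t => _) = (fun=> 1)).
    by rewrite Ex_cst; split => //; exact: itg_cst.
  by apply/funext => t; rewrite linX_set0 mulr0 expR0.
have [sj mj _ _ H] := sg j.
have [iA bA] := IH l; have [ij bj] := H (l * w j).
have [] := @Ex_indep_ge0 _ _ _ P n X indep A j (fun t => expR (l * linX w A t))
  (fun x => expR (l * w j * (x - m j))) jA.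
- apply: measurableT_comp => //; apply: measurable_funM; first exact: measurable_cst.
  exact: measurable_lin.
- apply: measurableT_comp => //; apply: measurable_funM; first exact: measurable_cst.
  by apply: measurable_funB => //; exact: measurable_cst.
- by move=> t; exact: expR_ge0.
- by move=> t; exact: expR_ge0.
- exact: iA.
- exact: ij.
rewrite (_ : (fun t => expR _ * _) = (fun t => expR (l * linX w (j |: A)%SET t))); last first.
  by apply/funext => t; rewrite -expRD linX_setU1//; congr expR; ring.
move=> i ->; split => //.
rewrite /var big_setU1//= mulrDr addrC expRD.
apply: ler_pM => //; try by apply: Ex_ge0 => t; exact: expR_ge0.
by rewrite (le_trans bj)// ler_expR le_eqVlt; apply/orP; left; apply/eqP; ring.
Qed.

Lemma tail_lin w A M c : (0 < M)%N -> 0 < c -> 64 * kappa * M%:R * var w A <= c ^+ 2 ->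
  itg P (fun t => (linX w A t / c) ^+ (2 * M)) /\
  Ex P (fun t => (linX w A t / c) ^+ (2 * M)) <= 2^-1 ^+ M.
Proof. by move=> M0 c0; apply: tail_moment => //; [exact: measurable_linX|exact: mgf_lin]. Qed.

(** Addition formulas and independence, then the identity (ac - bd)^2 + (bc + ad)^2 = (a^2 +
    b^2)(c^2 + d^2). *)
Lemma chf_lin w A u :
  chf_sqr P (linX w A) u = \prod_(j in A) chf_sqr P (fun t => X j t - m j) (u * w j).
Proof.
elim/set_ind: A => [|A j jA IH].
  rewrite big_set0 /chf_sqr; under eq_Ex do rewrite linX_set0 mulr0 cos0.
  under [X in _ + X ^+ 2]eq_Ex do rewrite linX_set0 mulr0 sin0.
  by rewrite !Ex_cst expr0n/= expr1n addr0.
rewrite big_setU1//= -IH.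
have [_ mj _ _ _] := sg j.
have mA := measurable_linX w A.
have muA : measurable_fun setT (fun t => u * linX w A t) by exact: measurable_funM.
have muj : measurable_fun setT (fun t => u * w j * (X j t - m j)) by exact: measurable_funM.
have muA' : measurable_fun setT (fun t : sigJ X A => u * linX w A t).
  by apply: measurable_funM; [exact: measurable_cst|exact: measurable_lin].
have mx : measurable_fun setT (fun x : R => u * w j * (x - m j)).
  apply: measurable_funM; first exact: measurable_cst.
  by apply: measurable_funB => //; exact: measurable_cst.
have E (f g : R -> R) : measurable_fun setT f -> measurable_fun setT g ->
    (forall x, `|f x| <= 1) -> (forall x, `|g x| <= 1) ->
    itg P (fun t => f (u * linX w A t) * g (u * w j * (X j t - m j))) /\
    Ex P (fun t => f (u * linX w A t) * g (u * w j * (X j t - m j))) =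
    Ex P (fun t => f (u * linX w A t)) * Ex P (fun t => g (u * w j * (X j t - m j))).
  move=> mf mg f1 g1; split.
    apply: (@itg_bnd _ _ _ _ 1); last by move=> t; rewrite normrM mulr_ile1.
    by apply: measurable_funM; exact: measurableT_comp.
  apply: (@Ex_indep_bnd _ _ _ P n X indep A j (fun t => f (u * linX w A t))
    (fun x => g (u * w j * (x - m j)))) => //.
  - exact: measurableT_comp.
  - exact: measurableT_comp.
have [mc msn] := (@measurable_cos R, @measurable_sin R).
have [cm sm] := (@cos_max R, @sin_max R).
have [i1 E1] := E _ _ mc mc cm cm.
have [i2 E2] := E _ _ msn msn sm sm.
have [i3 E3] := E _ _ msn mc sm cm.
have [i4 E4] := E _ _ mc msn cm sm.
rewrite /chf_sqr.
have -> : Ex P (fun t => cos (u * linX w (j |: A)%SET t)) =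
  Ex P (fun t => cos (u * linX w A t)) * Ex P (fun t => cos (u * w j * (X j t - m j))) -
  Ex P (fun t => sin (u * linX w A t)) * Ex P (fun t => sin (u * w j * (X j t - m j))).
  rewrite -E1 -E2 -ExB//; apply: eq_Ex => t.
  by rewrite linX_setU1// [u * _]mulrDr [u * (w j * _)]mulrA cosD.
have -> : Ex P (fun t => sin (u * linX w (j |: A)%SET t)) =
  Ex P (fun t => sin (u * linX w A t)) * Ex P (fun t => cos (u * w j * (X j t - m j))) +
  Ex P (fun t => cos (u * linX w A t)) * Ex P (fun t => sin (u * w j * (X j t - m j))).
  rewrite -E3 -E4 -ExD//; apply: eq_Ex => t.
  by rewrite linX_setU1// [u * _]mulrDr [u * (w j * _)]mulrA sinD.
ring.
Qed.

(** Factors outside [B] are at most 1, so heavy coordinates of [A] do no harm; only those in [B]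
    must be small at frequency [u]. *)
Lemma chf_small w A B u : B \subset A ->
  (forall j, j \in B -> chf_const kappa * (u * w j * s j) ^+ 2 <= 1) ->
  chf_sqr P (linX w A) u <= expR (- (u ^+ 2 * var w B) / 2).
Proof.
move=> BA H; rewrite chf_lin (big_setID B)/= (finset.setIidPr BA).
have h1 : 0 <= \prod_(j in B) chf_sqr P (fun t => X j t - m j) (u * w j).
  by apply: prodr_ge0 => j _; exact: chf_sqr_ge0.
rewrite -[leRHS]mulr1; apply: ler_pM => //.
- by apply: prodr_ge0 => j _; exact: chf_sqr_ge0.
- rewrite /var mulr_sumr -sumrN mulr_suml expR_sum.
  apply: ler_prod => j jB; rewrite chf_sqr_ge0/=.
  apply: (le_trans (chf_sqr_bound kappa1 (sg j) (H j jB))).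
  rewrite (le_trans _ (expR_ge1Dx _))//.
  by rewrite le_eqVlt; apply/orP; left; apply/eqP; ring.
- apply: prodr_ile1 => j _; rewrite chf_sqr_ge0/=.
  by apply: chf_sqr_le1; have [] := sg j.
Qed.

Lemma Ex_cos_lin w A B u b (k : nat) : B \subset A ->
  (forall j, j \in B -> chf_const kappa * (u * w j * s j) ^+ 2 <= 1) ->
  k%:R <= u ^+ 2 * var w B ->
  Ex P (fun t => cos (u * linX w A t - b)) <= (4 / 5) ^+ k.
Proof.
move=> BA H ku.
have h := le_trans (Ex_cos_shift P u b (measurable_linX w A)) (chf_small BA H).
have {}h : Ex P (fun t => cos (u * linX w A t - b)) ^+ 2 <= ((4 / 5) ^+ k) ^+ 2.
  (* exp(-k/2) is the power 2k of exp(-1/4), and exp(1/4) >= 5/4. *)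
  apply: (le_trans h); apply: (@le_trans _ _ (expR (- (1 / 4)) ^+ (2 * k))).
    by rewrite -expRM_natl ler_expR natrM; lra.
  rewrite -exprM mulnC; apply: ler_exp; first exact: expR_ge0.
  have := expR_ge1Dx (1 / 4 : R); have := expR_gt0 (- (1 / 4) : R).
  have : expR (1 / 4 : R) * expR (- (1 / 4)) = 1 by rewrite -expRD subrr expR0.
  nra.
have p0 : 0 <= (4 / 5 : R) ^+ k by rewrite exprn_ge0//; lra.
have [x0|x0] := leP (Ex P (fun t => cos (u * linX w A t - b))) 0; first exact: le_trans p0.
by rewrite -(@ler_pXn2r _ 2)// ?nnegrE// ltW.
Qed.

(** The squared modulus of the sum of e^(ijx) over j < N, that is, N times the Fejer kernel. *)
Definition fejer N (x : R) :=
  (\sum_(i < N) cos (i%:R * x)) ^+ 2 + (\sum_(i < N) sin (i%:R * x)) ^+ 2.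

Lemma fejerS N x :
  fejer N.+1 x = fejer N x + (1 + 2 * \sum_(i < N) cos ((N - i)%:R * x)).
Proof.
rewrite /fejer !big_ord_recr/=.
have -> : \sum_(i < N) cos ((N - i)%:R * x) =
    cos (N%:R * x) * (\sum_(i < N) cos (i%:R * x)) +
    sin (N%:R * x) * (\sum_(i < N) sin (i%:R * x)).
  rewrite !mulr_sumr -big_split/=; apply: eq_bigr => i _.
  by rewrite natrB ?mulrBl ?cosB// ltnW.
have := cos2Dsin2 (N%:R * x); lra.
Qed.

Lemma fejer_lower N x : (0 < N)%N -> `|x| <= N%:R^-1 -> (N%:R / 2) ^+ 2 <= fejer N x.
Proof.
move=> N0 xN; have N0' : 0 < N%:R :> R by rewrite ltr0n.
rewrite -[leLHS]addr0 lerD ?sqr_ge0//; apply: ler_exp; first by rewrite divr_ge0// ltW.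
have -> : N%:R / 2 = \sum_(i < N) 1 / 2 :> R by rewrite sumr_const card_ord -[RHS]mulr_natl mul1r.
apply: ler_sum => i _; apply: le_trans (cos_ge_quad _).
suff : (i%:R * x) ^+ 2 <= 1 by lra.
rewrite -norm_sqr expr_le1// normrM normr_nat.
have iN : i%:R <= N%:R :> R by rewrite ler_nat ltnW.
rewrite (le_trans (ler_pM _ _ iN xN))// mulfV// gt_eqF//.
Qed.

Lemma geometric_tail N : \sum_(i < N) (4 / 5 : R) ^+ (N - i) <= 4.
Proof.
elim: N => [|N IH]; first by rewrite big_ord0.
rewrite big_ord_recr/= subSnn expr1.
rewrite (eq_bigr (fun i : 'I_N => 4 / 5 * (4 / 5 : R) ^+ (N - i))); last first.
  by move=> i _; rewrite subSn ?exprS// ltnW.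
by rewrite -mulr_sumr; lra.
Qed.

(** The function [fejer N] of (L - th)/sig, where L is the form [linX w A], is nonnegative, and at
    least (N/2)^2 on the event. Its mean is at most 9N because the mean cosine at frequency k is at
    most (4/5)^k. The quotient is 36/N. *)
Lemma anticoncentration w A B N th : B \subset A -> (0 < N)%N -> 0 < var w B ->
  (forall j, j \in B -> chf_const kappa * N%:R ^+ 2 * (w j * s j) ^+ 2 <= var w B) ->
  Ex P (fun t => (`|linX w A t - th| <= Num.sqrt (var w B) / N%:R)%R%:R) <= 36 / N%:R.
Proof.
move=> BA N0 V0 H; have N0' : 0 < N%:R :> R by rewrite ltr0n.
set sig := Num.sqrt (var w B).
have sig0 : 0 < sig by rewrite sqrtr_gt0.
have sig2 : sig ^+ 2 = var w B by rewrite sqr_sqrtr// ltW.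
pose x t := (linX w A t - th) / sig.
have mL := measurable_linX w A.
have mx : measurable_fun setT x.
  by apply: measurable_funM => //; apply: measurable_funB.
have mkx k : measurable_fun setT (fun t => k * x t) by apply: measurable_funM.
have ic (k : nat) : itg P (fun t => cos (k%:R * x t)) by exact: itg_cos.
have hcos (k : nat) : (k <= N)%N -> Ex P (fun t => cos (k%:R * x t)) <= (4 / 5) ^+ k.
  move=> kN.
  rewrite (_ : (fun t => _) = fun t => cos ((k%:R / sig) * linX w A t - k%:R * th / sig)); last
      first.
    by apply/funext => t; congr cos; rewrite /x; field; rewrite gt_eqF.
  apply: (@Ex_cos_lin w A B (k%:R / sig) (k%:R * th / sig) k BA); last first.
    rewrite expr_div_n sig2 divfK ?gt_eqF// -natrX ler_nat.
    by case: k {kN} => // k; rewrite expnS expn1 leq_pmulr.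
  move=> j jB; have := H j jB.
  rewrite (_ : chf_const kappa * (k%:R / sig * w j * s j) ^+ 2 = chf_const kappa * k%:R ^+ 2 * (w
      j * s j) ^+ 2 / var w B); last first.
    by rewrite -sig2; field; rewrite gt_eqF.
  rewrite ler_pdivrMr// mul1r; apply: le_trans.
  have K1 := chf_const_ge2 kappa1.
  rewrite ler_wpM2r ?sqr_ge0// ler_wpM2l//; first by lra.
  by rewrite ler_exp// ler_nat.
(* Each step of [fejerS] adds at most 1 + 2 * 4 = 9 to the mean, by [geometric_tail]. *)
have mF k : itg P (fun t => fejer k (x t)) /\ ((k <= N)%N -> Ex P (fun t => fejer k (x t)) <= 9 *
    k%:R).
  elim: k => [|k [iF bF]].
    rewrite (_ : (fun t => _) = fun=> 0); last first.
      by apply/funext => t; rewrite /fejer !big_ord0 expr0n addr0.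
    by rewrite Ex_cst; split; [exact: itg_cst|rewrite mulr0].
  have iS : itg P (fun t => \sum_(i < k) cos ((k - i)%:R * x t)) by apply: itg_sum.
  have i2S : itg P (fun t => 2 * \sum_(i < k) cos ((k - i)%:R * x t)) by exact: itgZ.
  have i3S : itg P (fun t => 1 + 2 * \sum_(i < k) cos ((k - i)%:R * x t)).
    by apply: itgD => //; exact: itg_cst.
  rewrite (_ : (fun t => _) = fun t => fejer k (x t) +
    (1 + 2 * \sum_(i < k) cos ((k - i)%:R * x t))); last first.
    by apply/funext => t; rewrite fejerS.
  split; first exact: itgD.
  move=> kN; have {}bF := bF (ltnW kN).
  rewrite (ExD iF i3S) (ExD (itg_cst P 1) i2S).
  rewrite Ex_cst ExZ// Ex_sum//.
  have h : \sum_(i < k) Ex P (fun t => cos ((k - i)%:R * x t)) <= 4.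
    apply: le_trans (geometric_tail k); apply: ler_sum => i _; apply: hcos.
    by rewrite (leq_trans (leq_subr _ _))// ltnW.
  rewrite -addn1 natrD; lra.
have [iF /(_ (leqnn _)) bF] := mF N.
have mb : measurable_fun setT (fun t => `|linX w A t - th| <= sig / N%:R).
  apply: measurable_fun_ler => //; apply: measurableT_comp => //.
  by apply: measurable_funB.
have ib := itg_bool P mb.
have : Ex P (fun t => (N%:R / 2) ^+ 2 * (`|linX w A t - th| <= sig / N%:R)%R%:R) <= 9 * N%:R.
  apply: le_trans bF; apply: Ex_le => //; first exact: itgZ.
  move=> t; case: (leP `|linX w A t - th|) => h; last by rewrite mulr0 addr_ge0// sqr_ge0.
  rewrite mulr1; apply: fejer_lower => //.
  by rewrite /x normrM normfV (gtr0_norm sig0) ler_pdivrMr// mulrC.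
rewrite ExZ// => h.
rewrite ler_pdivlMr//; set p := Ex _ _ in h *.
have : p * N%:R * N%:R <= 36 * N%:R by lra.
by rewrite ler_pM2r.
Qed.

(** Write K for [chf_const kappa]. On the event a suitably centered cosine is at least 1 - 1/(8K),
    while its mean is at most 1 - 1/(4K). Markov's inequality for 1 + cos then bounds the
    probability by (2 - 1/(4K)) / (2 - 1/(8K)). *)
Lemma small_ball_gt0 j wj y : 0 < wj * s j ->
  Ex P (fun t => (`|y + wj * (X j t - m j)| <= wj * s j / 2)%R%:R) <=
  1 - (16 * chf_const kappa)^-1.
Proof.
move=> ws0; have [s0 mj _ _ _] := sg j.
have sj0 : 0 < s j by rewrite lt_neqAle s0 andbT eq_sym; apply: contraTneq ws0 => ->; rewrite
    mulr0 ltxx.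
have w0 : 0 < wj by rewrite -(pmulr_lgt0 _ sj0).
set K := chf_const kappa.
have K1 : 2 <= K by exact: chf_const_ge2.
have K0 : 0 < K by lra.
pose v := (Num.sqrt K)^-1; pose u := v / s j.
have v2 : v ^+ 2 = K^-1 by rewrite /v exprVn sqr_sqrtr// ltW.
have us : u * s j = v by rewrite /u divfK// gt_eqF.
have h := chf_sqr_bound kappa1 (sg j) (u := u).
rewrite us v2 -/K mulfV ?gt_eqF// in h; have {h}h := h (lexx _).
set Y := fun t => X j t - m j in h.
have mY : measurable_fun setT Y by [].
(* The cosine is to peak where y + wj Y vanishes. *)
pose b := - (u * y / wj).
have {h}h : Ex P (fun t => cos (u * Y t - b)) <= 1 - K^-1 / 4.
  have h' := le_trans (Ex_cos_shift P u b mY) h.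
  have KV : K^-1 <= 1 / 2 by rewrite -div1r ler_pdivrMr//; lra.
  have [x0|x0] := leP (Ex P (fun t => cos (u * Y t - b))) 0.
    by apply: (le_trans x0); lra.
  rewrite -(@ler_pXn2r _ 2)// ?nnegrE; [|exact: ltW|lra].
  by have := sqr_ge0 (K^-1); lra.
have my : measurable_fun setT (fun t => `|y + wj * Y t| <= wj * s j / 2).
  apply: measurable_fun_ler => //; apply: measurableT_comp => //.
  by apply: measurable_funD => //; exact: measurable_funM.
have ib := itg_bool P my.
have icos : itg P (fun t => cos (u * Y t - b)).
  by apply: itg_cos; apply: measurable_funB => //; exact: measurable_funM.
have KV0 : 0 < K^-1 by rewrite invr_gt0.
have : Ex P (fun t => (2 - K^-1 / 8) * (`|y + wj * Y t| <= wj * s j / 2)%R%:R) <=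
       Ex P (fun t => 1 + cos (u * Y t - b)).
  apply: Ex_le; [exact: itgZ|by apply: itgD => //; exact: itg_cst|move=> t].
  case: (leP `|y + wj * Y t|) => H; last by rewrite mulr0; have := cos_geN1 (u * Y t - b); lra.
  rewrite mulr1; apply: le_trans (lerD (lexx 1) (cos_ge_quad _)).
  suff : (u * Y t - b) ^+ 2 <= K^-1 / 4 by lra.
  rewrite (_ : K^-1 / 4 = (v / 2) ^+ 2); last by rewrite -v2; field.
  rewrite -norm_sqr; apply: ler_exp => //.
  rewrite (_ : u * Y t - b = (u / wj) * (y + wj * Y t)); last first.
    by rewrite /b; field; rewrite gt_eqF.
  have u0 : 0 < u / wj by rewrite divr_gt0// divr_gt0// invr_gt0 sqrtr_gt0.
  rewrite normrM (gtr0_norm u0) -us.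
  rewrite (_ : u * s j / 2 = u / wj * (wj * s j / 2)); last by field; rewrite gt_eqF.
  by rewrite ler_pM2l.
rewrite ExZ// ExD//; last exact: itg_cst.
rewrite Ex_cst => H.
rewrite invfM; set p := Ex _ _ in H *.
have KV1 : K^-1 <= 1 by rewrite invf_le1//; lra.
have p1 : (2 - K^-1 / 8) * p <= 2 - K^-1 / 4 by lra.
rewrite -(@ler_pM2l _ (2 - K^-1 / 8)); last by lra.
by apply: (le_trans p1); have := sqr_ge0 (K^-1); lra.
Qed.

Lemma small_ball j wj y : wj * s j != 0 ->
  Ex P (fun t => (`|y + wj * (X j t - m j)| <= `|wj * s j| / 2)%R%:R) <=
  1 - (16 * chf_const kappa)^-1.
Proof.
move=> ws0; have [p|] := ltP 0 (wj * s j).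
  by have := small_ball_gt0 y p; rewrite gtr0_norm.
rewrite le_eqVlt (negbTE ws0)/= => p.
have := @small_ball_gt0 j (- wj) (- y); rewrite mulNr oppr_gt0 => /(_ p).
rewrite (ltr0_norm p); congr (_ <= _); apply: eq_Ex => t.
by rewrite mulNr -opprD normrN.
Qed.

Lemma linX_setU w A B t : fintype.disjoint (mem A) (mem B) ->
  linX w (A :|: B)%SET t = linX w A t + linX w B t.
Proof. move=> AB; rewrite /linX /lin -bigU//=.
by apply: eq_bigl => i; rewrite !inE. Qed.

Lemma var_sub w A B : A \subset B -> var w A <= var w B.
Proof.
move=> AB; rewrite /var [leRHS](big_setID A)/= (finset.setIidPr AB) lerDl.
by apply: sumr_ge0 => j _; exact: sqr_ge0.
Qed.

Lemma var_setD1 w A j : j \in A -> var w (A :\ j)%SET = var w A - (w j * s j) ^+ 2.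
Proof. by move=> jA; rewrite /var (big_setD1 j jA)/= [RHS]addrC addKr. Qed.

(* Each [j] of the chain outweighs, by a factor [D] in deviation, all the
   coordinates still available after it; [C] is what remains at the end. *)
Fixpoint chain w (D : R) (A : {set 'I_n}) (js : seq 'I_n) (C : {set 'I_n}) : Prop :=
  if js is j :: js' then
    exists A1 : {set 'I_n}, [/\ A1 \subset (A :\ j)%SET, j \in A, w j * s j != 0,
      D ^+ 2 * var w A1 <= (w j * s j) ^+ 2 & chain w D A1 js' C]
  else A = C.

Lemma chain_sub w D A js C : chain w D A js C ->
  [/\ C \subset A, uniq js, {subset js <= A} & fintype.disjoint (mem js) (mem C)].
Proof.
elim: js A => [A ->|j js IH A [A1 [A1A jA _ _ /IH[CA1 u jsA1 dis]]]].
  by split => //; rewrite disjoint_has.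
have A1A' : A1 \subset A by rewrite (fintype.subset_trans A1A)// subD1set.
have jA1 : j \notin A1.
  by apply/negP => /(fintype.subsetP A1A); rewrite !inE eqxx.
split.
- exact: fintype.subset_trans A1A'.
- by rewrite /= u andbT; apply/negP => /jsA1; rewrite (negbTE jA1).
- move=> k; rewrite inE => /orP[/eqP ->//|/jsA1]; exact: (fintype.subsetP A1A').
- rewrite disjoint_cons dis andbT; apply: contra jA1; exact: (fintype.subsetP CA1).
Qed.

(** Going down the chain, [J] holds the coordinates already revealed and [A] an event they
    determine, refined at each link. The next partial sum stays within half the weight of [j] with
    conditional probability at most 1 - 1/(16 [chf_const kappa]), whatever the shift [Y]; once it
    has left, the lighter links behind it bring it back to the window with probability at most
    2^-M. *)
Lemma chain_prob w (M : nat) (r : R) (js : seq 'I_n) (A0 C J : {set 'I_n}) (A : T -> bool) (Y : T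
    -> R) :
  (0 < M)%N -> 0 < r -> 64 * kappa * M%:R <= r ^+ 2 ->
  chain w (4 * r) A0 js C -> fintype.disjoint (mem J) (mem js) ->
  measurable_fun setT (A : sigJ X J -> bool) -> measurable_fun setT (Y : sigJ X J -> R) ->
  Ex P (fun t => (A t && (`|Y t + linX w [set j in js]%SET t| <= r * Num.sqrt (var w C))%R)%:R) <=
  (1 - (16 * chf_const kappa)^-1) ^+ size js * Ex P (fun t => (A t)%:R) + (size js)%:R * 2^-1 ^+ M.
Proof.
move=> M0 r0 Hr; elim: js A0 J A Y => [|j js IH] A0 J A Y /=.
  move=> _ _ mA mY; rewrite expr0 mul1r mul0r addr0.
  have mA' := sigJ_fun mA; have mY' := sigJ_fun mY.
  apply: Ex_le; [|exact: itg_bool|].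
    apply: itg_bool; apply: measurable_and => //; apply: measurable_fun_ler => //.
    by apply: measurableT_comp => //; apply: measurable_funD => //; exact: measurable_linX.
  by move=> t; rewrite ler_nat; case: (A t) => //=; case: (_ <= _)%R.
move=> [A1 [A1A jA wj0 DA ch]] dis mA mY.
have [CA1 ujs jsA1 _] := chain_sub ch.
have jJ : j \notin J by move: dis; rewrite disjoint_sym disjoint_cons => /andP[].
have dis' : fintype.disjoint (mem (j |: J)%SET) (mem js).
  move: dis; rewrite disjoint_sym disjoint_cons => /andP[_ d1].
  rewrite disjoint_sym disjoint_has; apply/hasPn => k kjs; rewrite !inE negb_or.
  rewrite (disjointFr d1 kjs) andbT; apply/negP => /eqP kj.
  by have := fintype.subsetP A1A k (jsA1 _ kjs); rewrite kj !inE eqxx.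
have jjs : j \notin js.
  by apply/negP => /jsA1/(fintype.subsetP A1A); rewrite !inE eqxx.
set q := 1 - _.
have q0 : 0 <= q.
  rewrite subr_ge0 invf_le1; have := chf_const_ge2 kappa1; lra.
pose Y' t := Y t + w j * (X j t - m j).
pose A' t := A t && (`|Y' t| <= `|w j * s j| / 2).
have JJ : J \subset (j |: J)%SET by exact: finset.subsetUr.
have mXj : measurable_fun setT (X j : sigJ X (j |: J)%SET -> R).
  by apply: measurable_coord; rewrite setU11.
have mY' : measurable_fun setT (Y' : sigJ X (j |: J)%SET -> R).
  apply: measurable_funD; first exact: sigJ_sub mY.
  apply: measurable_funM; first exact: measurable_cst.
  by apply: measurable_funB => //; exact: measurable_cst.
have mA' : measurable_fun setT (A' : sigJ X (j |: J)%SET -> bool).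
  apply: measurable_and; first exact: sigJ_sub mA.
  apply: measurable_fun_ler; last exact: measurable_cst.
  exact: measurableT_comp.
have {IH}IH := IH A1 (j |: J)%SET A' Y' ch dis' mA' mY'.
have EA' : Ex P (fun t => (A' t)%:R) <= q * Ex P (fun t => (A t)%:R).
  apply: (@Ex_small_ball _ _ _ P n X indep J j A Y (fun x => w j * (x - m j))) => //.
    apply: measurable_funM; first exact: measurable_cst.
    by apply: measurable_funB => //; exact: measurable_cst.
  by move=> y; exact: small_ball.
have mL := measurable_linX w [set k in js]%SET.
(* A common bound for the sum over the later links, up to probability 2^-M, and for the radius of
   the final window. *)
pose c := r * Num.sqrt (var w A1).
have Etail : Ex P (fun t => (c < `|linX w [set k in js]%SET t|)%R%:R) <= 2^-1 ^+ M.
  have [V0|V0] := ltP 0 (var w A1).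
    have c0 : 0 < c by rewrite mulr_gt0// sqrtr_gt0.
    have [] := @tail_lin w [set k in js]%SET M c M0 c0.
      rewrite /c exprMn sqr_sqrtr ?var_ge0//; apply: ler_pM => //.
      - by rewrite !mulr_ge0// (le_trans ler01).
      - exact: var_ge0.
      - by apply: var_sub; apply/fintype.subsetP => k; rewrite inE; exact: jsA1.
    by move=> i b; exact: (tail_prob mL c0 i b).
  (* If no variance remains after [j], no further link of nonzero weight exists: [js] is empty and
     the later sum is 0. *)
  rewrite (eq_Ex _ (Z := fun=> 0)) ?Ex_cst ?exprn_ge0 ?invr_ge0// => t.
  rewrite (_ : linX _ _ _ = 0) ?normr0; last first.
    apply: big1 => k; rewrite inE => kjs; case: js kjs ch {IH jsA1 dis dis' jjs ujs mL} => // k'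
        js' kjs [A2 [_ k'A1 wk _ _]].
    exfalso; have : var w A1 >= (w k' * s k') ^+ 2.
      by rewrite -subr_ge0 -var_setD1// var_ge0.
    move/le_trans => /(_ _ V0); rewrite leNgt lt_neqAle eq_sym sqrf_eq0 wk.
    by rewrite sqr_ge0.
  by rewrite ltNge mulr_ge0 ?sqrtr_ge0// ltW.
(* Ratio 4r in the chain means 4c <= |w_j s_j|: the window and the later sum together do not reach
   half the weight of [j]. *)
have aj : 2 * c <= `|w j * s j| / 2.
  suff : 4 * c <= `|w j * s j| by lra.
  rewrite -(@ler_pXn2r _ 2)// ?nnegrE ?mulr_ge0 ?sqrtr_ge0 ?(ltW r0)//.
  rewrite norm_sqr (le_trans _ DA)// /c !exprMn sqr_sqrtr ?var_ge0//.
  by rewrite !mulrA.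
have rC : r * Num.sqrt (var w C) <= c.
  by apply: ler_wpM2l; [exact: ltW|rewrite ler_wsqrtr// var_sub].
have ibA : itg P (fun t => (A' t && (`|Y' t + linX w [set k in js]%SET t| <= r * Num.sqrt (var w
    C))%R)%:R).
  apply: itg_bool; apply: measurable_and; first exact: sigJ_fun mA'.
  apply: measurable_fun_ler => //; apply: measurableT_comp => //.
  by apply: measurable_funD => //; exact: sigJ_fun mY'.
have ibt : itg P (fun t => (c < `|linX w [set k in js]%SET t|)%R%:R).
  apply: itg_bool; apply: measurable_fun_ltr => //; exact: measurableT_comp.
apply: (@le_trans _ _ (Ex P (fun t =>
  (A' t && (`|Y' t + linX w [set k in js]%SET t| <= r * Num.sqrt (var w C))%R)%:R +
  (c < `|linX w [set k in js]%SET t|)%R%:R))).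
  apply: Ex_le; [|exact: itgD|].
    apply: itg_bool; apply: measurable_and; first exact: sigJ_fun mA.
    apply: measurable_fun_ler => //; apply: measurableT_comp => //.
    by apply: measurable_funD; [exact: sigJ_fun mY|exact: measurable_linX].
  move=> t; case At : (A t) => //=; last by rewrite addr_ge0// ler0n.
  have E : Y t + linX w [set k in j :: js]%SET t = Y' t + linX w [set k in js]%SET t.
    by rewrite finset.set_cons linX_setU1 ?inE// /Y' addrAC addrA.
  rewrite E; case: (leP `|Y' t + _|) => h1; last by rewrite addr_ge0// ler0n.
  case: (ltP c) => h2; first by rewrite lerDr ler0n.
  rewrite addr0 /A' At/= andbT.
  suff -> : `|Y' t| <= `|w j * s j| / 2 by [].
  rewrite -(addrK (linX w [set k in js]%SET t) (Y' t)).
  by rewrite (le_trans (ler_normB _ _))// (le_trans _ aj)//; lra.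
rewrite ExD//.
apply: (le_trans (lerD IH Etail)).
have -> : (size js).+1%:R * 2^-1 ^+ M = (size js)%:R * 2^-1 ^+ M + 2^-1 ^+ M :> R.
  by rewrite -natr1 mulrDl mul1r.
rewrite addrA !lerD2r.
rewrite exprSr -mulrA ler_wpM2l// exprn_ge0//.
Qed.

Lemma chain_anticoncentration w (M : nat) (r : R) (js : seq 'I_n) (C : {set 'I_n}) th :
  (0 < M)%N -> 0 < r -> 64 * kappa * M%:R <= r ^+ 2 ->
  chain w (4 * r) [set: 'I_n]%SET js C ->
  Ex P (fun t => (`|linX w (~: C)%SET t - th| <= r * Num.sqrt (var w C))%R%:R) <=
  (1 - (16 * chf_const kappa)^-1) ^+ size js + (size js)%:R * 2^-1 ^+ M.
Proof.
move=> M0 r0 Hr ch; have [_ ujs _ disC] := chain_sub ch.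
(* Removed coordinates off the chain only shift the form, so they are revealed beforehand. *)
pose J := (~: C :\: [set j in js])%SET.
have disJ : fintype.disjoint (mem J) (mem js).
  rewrite disjoint_sym disjoint_has; apply/hasPn => k kjs.
  by rewrite !inE kjs.
have := @chain_prob w M r js [set: 'I_n]%SET C J (fun=> true) (fun t => linX w J t - th) M0 r0 Hr
    ch disJ.
rewrite Ex_cst mulr1 => H.
rewrite (eq_Ex _ (Z := fun t => (true && (`|linX w J t - th + linX w [set j in js]%SET t| <= r *
    Num.sqrt (var w C))%R)%:R)).
  apply: H; first exact: measurable_cst.
  by apply: measurable_funB; [exact: measurable_lin|exact: measurable_cst].
move=> t; rewrite addrAC -linX_setU /=; last first.
  by rewrite fintype.disjoint_subset; apply/fintype.subsetP => k; rewrite !inE => /andP[].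
congr (`|linX w _ t - th| <= _)%R%:R; apply/finset.setP => k; rewrite !inE.
case kjs : (k \in js) => //=; last by rewrite orbF.
by rewrite (disjointFr disC kjs).
Qed.

Definition regular w (tau2 : R) A := forall j, j \in A -> (w j * s j) ^+ 2 <= tau2 * var w A.

Lemma regular_or_heavy w tau2 A : regular w tau2 A \/
  exists2 j, j \in A & tau2 * var w A < (w j * s j) ^+ 2.
Proof.
have [|] := boolP [forall j in A, (w j * s j) ^+ 2 <= tau2 * var w A].
  by move=> /forall_inP H; left.
by rewrite negb_forall_in => /exists_inP[j jA]; rewrite -ltNge => H; right; exists j.
Qed.

Lemma card_setD1D A B j (q : nat) :
  (#|(A :\ j) :\: B| <= q)%N -> (#|A :\: B| <= q.+1)%N.
Proof.
move=> Bq; rewrite (cardsD1 j (A :\: B)%SET) -addn1 addnC; apply: leq_add.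
  rewrite (leq_trans _ Bq)// subset_leq_card//; apply/fintype.subsetP => k.
  by rewrite !inE => /and3P[-> -> ->].
by case: (j \in _).
Qed.

Lemma greedy_head w tau2 (q : nat) A : 0 <= tau2 <= 1 ->
  (exists B : {set 'I_n}, [/\ B \subset A, (#|A :\: B| <= q)%N & regular w tau2 B]) \/
  (exists B : {set 'I_n}, [/\ B \subset A, (#|A :\: B| <= q)%N &
     var w B <= (1 - tau2) ^+ q * var w A]).
Proof.
move=> t01; elim: q A => [|q IH] A.
  right; exists A; split; first exact: fintype.subxx.
    by rewrite finset.setDv cards0.
  by rewrite expr0 mul1r.
have [rA|[j jA Hj]] := regular_or_heavy w tau2 A.
  left; exists A; split => //.
  by rewrite finset.setDv cards0.
have sub (B : {set 'I_n}) : B \subset (A :\ j)%SET -> B \subset A.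
  by move=> BA; rewrite (fintype.subset_trans BA)// subD1set.
have [[B [BA Bq rB]]|[B [BA Bq vB]]] := IH (A :\ j)%SET.
  by left; exists B; split; [exact: sub|exact: (card_setD1D Bq)|].
right; exists B; split; [exact: sub|exact: (card_setD1D Bq)|].
apply: (le_trans vB); rewrite var_setD1// [_ ^+ q.+1]exprSr -[leRHS]mulrA ler_wpM2l//.
  by rewrite exprn_ge0//; lra.
lra.
Qed.

(** As long as a heavy coordinate exists, each removal multiplies the variance by at most 1 - tau2.
    After [q] removals what remains is so small that the first coordinate removed, heavier than tau2
    times the initial variance, dominates it by the factor [D]: this is one link. A regular set met
    on the way ends the search. *)
Lemma regular_or_chain w tau2 (D : R) (q l : nat) A : 0 < tau2 <= 1 -> 0 < D -> (0 < q)%N ->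
  (1 - tau2) ^+ q * D ^+ 2 <= tau2 ->
  (exists B : {set 'I_n}, [/\ B \subset A, (#|A :\: B| <= l * q)%N & regular w tau2 B]) \/
  (exists js (C : {set 'I_n}), [/\ C \subset A, (#|A :\: C| <= l * q)%N, size js = l &
     chain w D A js C]).
Proof.
move=> /andP[t0 t1] D0 q0 Hq; elim: l A => [|l IH] A.
  right; exists [::], A; split => //.
  by rewrite finset.setDv cards0.
have [rA|[j jA Hj]] := regular_or_heavy w tau2 A.
  left; exists A; split => //.
  by rewrite finset.setDv cards0.
have t01 : 0 <= tau2 <= 1 by rewrite ltW.
have sub (B : {set 'I_n}) : B \subset (A :\ j)%SET -> B \subset A.
  by move=> BA; rewrite (fintype.subset_trans BA)// subD1set.
have card (B : {set 'I_n}) : (#|(A :\ j) :\: B| <= q.-1)%N -> (#|A :\: B| <= q)%N.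
  by move=> Bq; rewrite -(prednK q0) (card_setD1D Bq).
have card2 (B C : {set 'I_n}) : C \subset B -> (#|A :\: B| <= q)%N -> (#|B :\: C| <= l * q)%N ->
    (#|A :\: C| <= l.+1 * q)%N.
  move=> CB h1 h2; rewrite mulSn (leq_trans _ (leq_add h1 h2))//.
  rewrite (leq_trans _ (leq_card_setU _ _))// subset_leq_card//.
  by apply/fintype.subsetP => k; rewrite !inE => /andP[-> ->]; case: (k \in B).
(* Only q - 1 further removals: [j] itself is the first of the [q]. *)
have [[B [BA Bq rB]]|[B [BA Bq vB]]] := greedy_head w q.-1 (A :\ j)%SET t01.
  left; exists B; split; [exact: sub| |by []].
  by rewrite (leq_trans (card _ Bq))// leq_pmull.
have [[E [EB Eq rE]]|[js [C [CB Cq sjs ch]]]] := IH B.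
  left; exists E; split => //; first by rewrite (fintype.subset_trans EB)// sub.
  by apply: (card2 B) => //; exact: card.
right; exists (j :: js), C; split => //.
- by rewrite (fintype.subset_trans CB)// sub.
- by apply: (card2 B) => //; exact: card.
- by rewrite /= sjs.
exists B; split => //.
  by rewrite -sqrf_eq0 gt_eqF// (le_lt_trans (mulr_ge0 (ltW t0) (var_ge0 w A)) Hj).
have v1 : var w (A :\ j)%SET <= (1 - tau2) * var w A by rewrite var_setD1//; lra.
have {}vB : var w B <= (1 - tau2) ^+ q * var w A.
  apply: (le_trans vB); rewrite -[X in _ <= _ ^+ X * _](prednK q0) exprSr -mulrA ler_wpM2l//.
  by rewrite exprn_ge0//; lra.
apply: (le_trans (ler_wpM2l (sqr_ge0 D) vB)).
apply: (le_trans _ (ltW Hj)); rewrite mulrA ler_wpM2r ?var_ge0//.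
by rewrite mulrC.
Qed.

End LinearForms.

(** * Upper approximation of halfspaces *)

Section JuntaSums.
Context (R : realType) (n : nat).
Implicit Types (H : {set 'I_n}) (p f : ('I_n -> R) -> R) (k : nat).

(** Dependence is taken on all of R^n, so the product of the ranges enters only in
    [junta_sum_gen_poly]. *)
Definition depends_on H k f := exists2 J : {set 'I_n}, (#|J| <= k)%N &
  forall x y, (forall i, i \in (H :|: J)%SET -> x i = y i) -> f x = f y.

(* Order at most [k] relative to the coordinates in [H], which may occur freely. *)
Definition junta_sum H k p := exists (I : finType) (f : I -> ('I_n -> R) -> R),
  (forall i, depends_on H k (f i)) /\ (forall x, p x = \sum_i f i x).

Definition determined_by H T0 (f : ('I_n -> R) -> T0) :=
  forall x y, (forall i, i \in H -> x i = y i) -> f x = f y.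

Lemma eq_junta_sum H k p p' : p =1 p' -> junta_sum H k p -> junta_sum H k p'.
Proof. by move=> pp' [I [f [fj fE]]]; exists I, f; split => // x; rewrite -pp'. Qed.

Lemma junta_sum1 H k f : depends_on H k f -> junta_sum H k f.
Proof.
move=> fj; exists unit, (fun=> f); split => // x.
by rewrite (bigD1 tt)//= big1 ?addr0// => -[].
Qed.

Lemma depends_on_mono H H' k k' f : H \subset H' -> (k <= k')%N ->
  depends_on H k f -> depends_on H' k' f.
Proof.
move=> HH kk [J Jk fJ]; exists J; first exact: leq_trans kk.
move=> x y xy; apply: fJ => i; rewrite inE => iJ; apply: xy; rewrite inE.
by case/orP: iJ => [/(fintype.subsetP HH) ->//|->]; rewrite orbT.
Qed.

Lemma junta_sum_mono H H' k k' p : H \subset H' -> (k <= k')%N ->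
  junta_sum H k p -> junta_sum H' k' p.
Proof.
by move=> HH kk [I [f [fj fE]]]; exists I, f; split => // i; exact: depends_on_mono (fj i).
Qed.

Lemma junta_sum_determined H p : determined_by H p -> junta_sum H 0 p.
Proof.
move=> pH; apply: junta_sum1; exists finset.set0; first by rewrite cards0.
by move=> x y xy; apply: pH => i iH; apply: xy; rewrite inE iH.
Qed.

Lemma junta_sum_big H k (I : finType) (p : I -> ('I_n -> R) -> R) :
  (forall i, junta_sum H k (p i)) -> junta_sum H k (fun x => \sum_i p i x).
Proof.
move=> pj.
have /choice[Jf pj'] : forall i, exists Jf : {J : finType & J -> ('I_n -> R) -> R},
    (forall j, depends_on H k (projT2 Jf j)) /\
    (forall x, p i x = \sum_(j : projT1 Jf) projT2 Jf j x).
  by move=> i; have [J [f Jf]] := pj i; exists (existT _ J f).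
exists {i : I & projT1 (Jf i)}, (fun u => projT2 (Jf (tag u)) (tagged u)).
split; first by move=> [i j]; have [h _] := pj' i; exact: h.
move=> x; rewrite (eq_bigr (fun i => \sum_(j : projT1 (Jf i)) projT2 (Jf i) j x)).
  by rewrite sig_big_dep.
by move=> i _; have [_ ->] := pj' i.
Qed.

Lemma junta_sumM H k l p p' : junta_sum H k p -> junta_sum H l p' ->
  junta_sum H (k + l) (fun x => p x * p' x).
Proof.
move=> [I [f [fj fE]]] [I' [f' [fj' fE']]].
exists (I * I')%type, (fun u x => f u.1 x * f' u.2 x); split.
  move=> [i i'] /=; have [J Jk fJ] := fj i; have [J' Jk' fJ'] := fj' i'.
  exists (J :|: J')%SET; first by rewrite (leq_trans (leq_card_setU _ _))// leq_add.
  move=> x y xy; congr (_ * _); [apply: fJ|apply: fJ'] => j; rewrite inE => jJ;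
    by apply: xy; rewrite !inE; case/orP: jJ => ->; rewrite ?orbT.
move=> x; rewrite fE fE' big_distrlr/=.
by rewrite pair_big.
Qed.

Lemma junta_sum_cst H (c : R) : junta_sum H 0 (fun=> c).
Proof. exact: junta_sum_determined. Qed.

Lemma junta_sumX H k p e : junta_sum H k p -> junta_sum H (e * k) (fun x => p x ^+ e).
Proof.
move=> pj; elim: e => [|e IH].
  by apply: eq_junta_sum (junta_sum_cst H 1) => x; rewrite expr0.
rewrite mulSn; apply: eq_junta_sum (junta_sumM pj IH) => x.
by rewrite exprS.
Qed.

Lemma junta_sum_prod H k d (p : 'I_d -> ('I_n -> R) -> R) :
  (forall i, junta_sum H k (p i)) -> junta_sum H (d * k) (fun x => \prod_i p i x).
Proof.
elim: d p => [|d IH] p pj.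
  by apply: eq_junta_sum (junta_sum_cst H 1) => x; rewrite big_ord0.
rewrite mulSn; apply: eq_junta_sum (junta_sumM (pj ord0) (IH (fun i => p (lift ord0 i)) _)).
  by move=> x; rewrite big_ord_recl.
by move=> i.
Qed.

(** The coefficients vary with the coordinates in [H] only and so cost nothing; the degree alone
    counts. The univariate polynomial may thus be chosen anew for each value of the head. *)
Lemma junta_sum_horner H K T0 (eta : ('I_n -> R) -> T0) (Phi : T0 -> {poly R}) p :
  determined_by H eta -> junta_sum H 1 p -> (forall y, (size (Phi y) <= K.+1)%N) ->
  junta_sum H K (fun x => (Phi (eta x)).[p x]).
Proof.
move=> eH pj PK.
apply: (@eq_junta_sum _ _ (fun x => \sum_(i < K.+1) (Phi (eta x))`_i * p x ^+ i)).
  move=> x; rewrite -(horner_coef_wide _ (PK _)).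
  by [].
apply: junta_sum_big => i.
apply: (@junta_sum_mono H H (0 + i * 1)); first exact: fintype.subxx.
  by rewrite add0n muln1 -ltnS.
apply: junta_sumM; last exact: junta_sumX.
by apply: junta_sum_determined => x y xy; rewrite (eH _ _ xy).
Qed.

Lemma junta_sum_gen_poly (Om : set ('I_n -> R)) H k p :
  junta_sum H k p -> gen_poly Om (#|H| + k) p.
Proof.
move=> [I [f [fj fE]]]; exists #|I|, (fun i => f (enum_val i)); split.
  move=> i; have [J Jk fJ] := fj (enum_val i); exists (H :|: J)%SET.
    by rewrite (leq_trans (leq_card_setU _ _))// leq_add2l.
  by move=> x y _ _; exact: fJ.
by move=> x _; rewrite fE (reindex (enum_val (A := I)))//=; exact: onW_bij (enum_val_bij _).
Qed.

Lemma lin_determined (m w : 'I_n -> R) H : determined_by H (lin m w H).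
Proof. by move=> x y xy; apply: eq_bigr => j jH; rewrite xy. Qed.

Lemma lin_junta_sum (m w : 'I_n -> R) H A : junta_sum H 1 (lin m w A).
Proof.
apply: (@eq_junta_sum _ _ (fun x => \sum_j (if j \in A then w j * (x j - m j) else 0))).
  by move=> x; rewrite /lin [RHS]big_mkcond.
apply: junta_sum_big => j; apply: junta_sum1; exists [set j]%SET; first by rewrite cards1.
by move=> x y xy; case: ifP => // _; rewrite xy// !inE eqxx orbT.
Qed.

End JuntaSums.

(** * One halfspace: regular, chain and null cases *)

Section HalfspaceApproximation.
Context (d : measure_display) (T : measurableType d) (R : realType).
Variables (P : probability T R) (n : nat) (X : 'I_n -> {RV P >-> R}).
Hypothesis indep : mutually_independent X.
Variables (m s : 'I_n -> R) (kappa : R).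
Hypothesis kappa1 : 1 <= kappa.
Hypothesis sg : forall j, subgauss P kappa (s j) (fun t => X j t - m j).
Implicit Types (w : 'I_n -> R) (A B H C : {set 'I_n}).

(* [W] is the event on which [p] may exceed [h + delta] and [G] controls the
   growth of [p]; the exponent [2 M] is what a product of several such [p]
   needs. *)
Definition upper_approx H (K M : nat) (delta pw : R) w theta (p : ('I_n -> R) -> R) :=
  [/\ junta_sum H K p,
      forall x, (halfspace w theta x)%:R <= p x,
      measurable_fun setT (fun t => p (X^~ t)),
      exists W : T -> bool, [/\ measurable_fun setT W, Ex P (fun t => (W t)%:R) <= pw &
        forall t, ~~ W t -> p (X^~ t) <= (halfspace w theta (X^~ t))%:R + delta] &
      exists G : T -> R, [/\ forall t, 0 <= G t, itg P (fun t => G t ^+ (2 * M)),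
        Ex P (fun t => G t ^+ (2 * M)) <= 2^-1 ^+ M &
        forall t, p (X^~ t) <= (1 + delta) * Num.max 1 (G t) ^+ K]].

Definition shifted_threshold w theta := theta - \sum_i w i * m i.

Lemma halfspaceE w theta x :
  halfspace w theta x = (shifted_threshold w theta <= lin m w [set: 'I_n]%SET x).
Proof.
rewrite /halfspace /shifted_threshold lerBlDr /lin; congr (_ <= _).
have -> : \sum_(j in [set: 'I_n]%SET) w j * (x j - m j) = \sum_j w j * (x j - m j).
  by apply: eq_bigl => j; rewrite inE.
by rewrite -big_split/=; apply: eq_bigr => i _; ring.
Qed.

Definition residual w theta H (x : 'I_n -> R) := shifted_threshold w theta - lin m w H x.

Lemma halfspace_residual w theta H x :
  halfspace w theta x = (residual w theta H x <= lin m w (~: H)%SET x).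
Proof.
rewrite halfspaceE /residual; move: (shifted_threshold w theta) => c.
rewrite lerBlDr; congr (_ <= _).
rewrite /lin [LHS](big_setID H)/= finset.setTI [RHS]addrC.
by rewrite finset.setTD.
Qed.

Lemma residual_determined w theta H : determined_by H (residual w theta H).
Proof. by move=> x y xy; rewrite /residual (@lin_determined _ _ m w H x y xy). Qed.

Lemma measurable_residual w theta H : measurable_fun setT (fun t => residual w theta H (X^~ t)).
Proof. by apply: measurable_funB => //; exact: measurable_linX. Qed.

Lemma measurable_horner (p : {poly R}) (Y : T -> R) : measurable_fun setT Y ->
  measurable_fun setT (fun t => p.[Y t]).
Proof.
move=> mY; rewrite (_ : (fun t => _) = fun t => \sum_(i < size p) p`_i * Y t ^+ i).
  apply: measurable_sum => i; apply: measurable_funM; first exact: measurable_cst.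
  exact: measurable_funX.
by apply/funext => t; rewrite horner_coef.
Qed.

Lemma upper_approx_mono H (K M : nat) (delta pw pw' : R) w theta p : pw <= pw' ->
  upper_approx H K M delta pw w theta p -> upper_approx H K M delta pw' w theta p.
Proof.
move=> pp [h1 h2 h3 [W [w1 w2 w3]] h5]; split => //; exists W; split => //.
exact: le_trans pp.
Qed.

(* Common part of the two heavy-tail cases: when the residual threshold
   exceeds [r] standard deviations, a pure power of the tail is used. *)
Lemma power_ge_halfspace w theta H (c : R) (K : nat) x : 0 < c -> ~~ odd K ->
  c <= residual w theta H x ->
  (halfspace w theta x)%:R <= (lin m w (~: H)%SET x / c) ^+ K.
Proof.
move=> c0 oK cr; rewrite (halfspace_residual _ _ H).
case: (leP (residual w theta H x)) => h; last by rewrite exprn_even_ge0.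
by rewrite exprn_ege1// ler_pdivlMr// mul1r (le_trans cr).
Qed.

Lemma power_small w H (c delta : R) (K : nat) x : 0 < c -> 2^-1 ^+ K <= delta ->
  `|lin m w (~: H)%SET x| <= c / 2 -> (lin m w (~: H)%SET x / c) ^+ K <= delta.
Proof.
move=> c0 Kd h; apply: le_trans Kd; rewrite (le_trans (ler_norm _))// normrX.
apply: ler_exp => //; rewrite normrM normfV (gtr0_norm c0) ler_pdivrMr//.
by rewrite mulrC.
Qed.

(** The factor 6 gives a pure power the same growth function as the step polynomial, for which
    [upper_approx_regular] needs it; its square is the 36 in the condition on [r]. *)
Lemma power_growth w H (c : R) (K : nat) x : 0 < c ->
  (lin m w (~: H)%SET x / c) ^+ K <=
  Num.max 1 (6 * `|lin m w (~: H)%SET x| / c) ^+ K.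
Proof.
move=> c0; rewrite (le_trans (ler_norm _))// normrX; apply: ler_exp => //.
rewrite normrM normfV (gtr0_norm c0) le_max; apply/orP; right.
by rewrite ler_wpM2r ?invr_ge0 ?(ltW c0)// ler_peMl//; lra.
Qed.

Lemma growth_moment w A (M : nat) (r : R) : (0 < M)%N -> 0 < r ->
  36 * 64 * kappa * M%:R <= r ^+ 2 -> 0 < var s w A ->
  itg P (fun t => (6 * `|linX X m w A t| / (r * Num.sqrt (var s w A))) ^+ (2 * M)) /\
  Ex P (fun t => (6 * `|linX X m w A t| / (r * Num.sqrt (var s w A))) ^+ (2 * M)) <= 2^-1 ^+ M.
Proof.
move=> M0 r0 Hr V0; set sig := Num.sqrt _.
have sig0 : 0 < sig by rewrite sqrtr_gt0.
have sig2 : sig ^+ 2 = var s w A by rewrite sqr_sqrtr// ltW.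
have E t : (6 * `|linX X m w A t| / (r * sig)) ^+ (2 * M) = (linX X m w A t / (r * sig / 6)) ^+
    (2 * M).
  rewrite !exprM; congr (_ ^+ M).
  by rewrite -[RHS]norm_sqr normrM normfV (@gtr0_norm _ (r * sig / 6)) ?divr_gt0 ?mulr_gt0//;
      congr (_ ^+ 2); field; rewrite !gt_eqF.
rewrite (_ : (fun t => _) = (fun t => (linX X m w A t / (r * sig / 6)) ^+ (2 * M))); last first.
  by apply/funext.
apply: (tail_lin indep sg) => //; first by rewrite divr_gt0// mulr_gt0.
rewrite expr_div_n exprMn sig2.
have : 36 * 64 * kappa * M%:R * var s w A <= r ^+ 2 * var s w A by rewrite ler_wpM2r// ltW.
lra.
Qed.

Lemma tail_event w A (M : nat) (r : R) : (0 < M)%N -> 0 < r ->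
  36 * 64 * kappa * M%:R <= r ^+ 2 -> 0 < var s w A ->
  Ex P (fun t => (r * Num.sqrt (var s w A) / 2 < `|linX X m w A t|)%R%:R) <= 2^-1 ^+ M.
Proof.
move=> M0 r0 Hr V0; set sig := Num.sqrt _.
have sig0 : 0 < sig by rewrite sqrtr_gt0.
have sig2 : sig ^+ 2 = var s w A by rewrite sqr_sqrtr// ltW.
have c0 : 0 < r * sig / 2 by rewrite divr_gt0// mulr_gt0.
have [] := @tail_lin _ _ _ P n X indep m s kappa sg w A M (r * sig / 2) M0 c0.
  rewrite expr_div_n exprMn sig2.
  have : 36 * 64 * kappa * M%:R * var s w A <= r ^+ 2 * var s w A by rewrite ler_wpM2r// ltW.
  have : 0 <= kappa * M%:R * var s w A.
    by rewrite mulr_ge0 ?(ltW V0)// mulr_ge0// (le_trans ler01).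
  lra.
by move=> i b; apply: (tail_prob _ c0 i b); exact: measurable_linX.
Qed.

Lemma Ex_or (b1 b2 : T -> bool) : measurable_fun setT b1 -> measurable_fun setT b2 ->
  Ex P (fun t => (b1 t || b2 t)%:R) <= Ex P (fun t => (b1 t)%:R) + Ex P (fun t => (b2 t)%:R).
Proof.
move=> m1 m2; have i1 := itg_bool P m1; have i2 := itg_bool P m2.
rewrite -ExD//; apply: Ex_le; first by apply: itg_bool; exact: measurable_or.
  exact: itgD.
by move=> t; case: (b1 t) => /=; rewrite ?lerDl ?add0r.
Qed.

(** The chain keeps the residual threshold at distance more than r deviations of the tail from 0,
    outside a rare event. Below this range the tail cannot undo the inequality and the constant 1 is
    exact; above it a high power of the tail is negligible. In between, the constant 1 is still a
    valid upper bound. *)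
Lemma upper_approx_chain w theta (M K : nat) (r delta : R) js C : (0 < M)%N -> 0 < r ->
  36 * 64 * kappa * M%:R <= r ^+ 2 -> ~~ odd K -> 0 <= delta -> 2^-1 ^+ K <= delta ->
  chain s w (4 * r) [set: 'I_n]%SET js C -> 0 < var s w C ->
  exists p, upper_approx (~: C)%SET K M delta
    ((1 - (16 * chf_const kappa)^-1) ^+ size js + (size js)%:R * 2^-1 ^+ M + 2^-1 ^+ M) w theta p.
Proof.
move=> M0 r0 Hr oK d0 Kd ch V0.
set sig := Num.sqrt (var s w C).
have sig0 : 0 < sig by rewrite sqrtr_gt0.
have c0 : 0 < r * sig by rewrite mulr_gt0.
set H := (~: C)%SET; have HC : (~: H)%SET = C by rewrite finset.setCK.
pose Phi y : {poly R} := if y < r * sig then 1 else ((r * sig)^-1 *: 'X) ^+ K.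
pose p x := (Phi (residual w theta H x)).[lin m w (~: H)%SET x].
have pE x : p x = if residual w theta H x < r * sig then 1 else (lin m w (~: H)%SET x / (r *
    sig)) ^+ K.
  by rewrite /p /Phi; case: ifP => _; rewrite ?hornerC// horner_exp !hornerE mulrC.
exists p; split.
- apply: junta_sum_horner; [exact: residual_determined|exact: lin_junta_sum|].
  move=> y; rewrite /Phi; case: ifP => _; first by rewrite size_poly1.
  rewrite exprZn (leq_trans (size_scale_leq _ _))//.
  by rewrite size_polyXn.
- move=> x; rewrite pE; case: ltP => h; first by case: halfspace; rewrite ?ler01.
  exact: power_ge_halfspace.
- rewrite (_ : (fun t => _) = fun t => if residual w theta H (X^~ t) < r * sig then 1
      else (linX X m w (~: H)%SET t / (r * sig)) ^+ K); last first.
    by apply/funext => t; rewrite pE.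
  apply: measurable_fun_ifT; last first.
    by apply: measurable_funX; apply: measurable_funM => //; exact: measurable_linX.
    exact: measurable_cst.
  by apply: measurable_fun_ltr => //; exact: measurable_residual.
- exists (fun t => (`|linX X m w H t - shifted_threshold w theta| <= r * sig) ||
                  (r * sig / 2 < `|linX X m w C t|)).
  have m1 : measurable_fun setT (fun t => `|linX X m w H t - shifted_threshold w theta| <= r * sig).
    apply: measurable_fun_ler => //; apply: measurableT_comp => //.
    by apply: measurable_funB => //; exact: measurable_linX.
  have m2 : measurable_fun setT (fun t => r * sig / 2 < `|linX X m w C t|).
    by apply: measurable_fun_ltr => //; apply: measurableT_comp => //; exact: measurable_linX.
  split; first exact: measurable_or.
    apply: (le_trans (Ex_or m1 m2)); apply: lerD; last exact: tail_event.
    apply: (chain_anticoncentration indep kappa1 sg) => //.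
    have : 0 <= kappa * M%:R by rewrite mulr_ge0// (le_trans ler01).
    by lra.
  move=> t; rewrite negb_or -ltNge -leNgt => /andP[h1 h2].
  rewrite pE (halfspace_residual _ _ H) HC -/(linX X m w C t).
  have h2' : linX X m w C t <= r * sig / 2 by rewrite (le_trans (ler_norm _)).
  have h2'' : - (r * sig / 2) <= linX X m w C t by move: h2; rewrite ler_norml => /andP[].
  rewrite ltr_normr in h1; case: ltP => h3.
    have -> : residual w theta H (X^~ t) <= linX X m w C t.
      move: h1 h3; rewrite /residual -/(linX X m w H t) => /orP[]; lra.
    by rewrite lerDl.
  have h4 := @power_small w H (r * sig) delta K (X^~ t) c0 Kd; rewrite HC in h4.
  by apply: (le_trans (h4 h2)); rewrite lerDr ler0n.
- exists (fun t => 6 * `|linX X m w C t| / (r * sig)).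
  have [g1 g2] := growth_moment M0 r0 Hr V0.
  split => //; first by move=> t; rewrite divr_ge0 ?mulr_ge0 ?(ltW r0)// ltW.
  move=> t; rewrite pE; case: ifP => _.
    rewrite -[leLHS]mulr1; apply: ler_pM => //; first by rewrite lerDl.
    by rewrite exprn_ege1// le_max lexx.
  have := power_growth w H K (X^~ t) c0; rewrite HC -/(linX X m w C t) => h.
  rewrite (le_trans h)// ler_peMl ?exprn_ge0 ?le_max ?ler01// lerDl//.
Qed.

(** For a residual threshold within r deviations of 0, [Q] is applied to the distance to the
    threshold in units of 4 r sig. A tail up to r sig / 2 then gives an argument within [-1/2, 1/2],
    and the critical window sig/N becomes 1/(4rN). Residuals outside this range are treated as in
    the chain case. *)
Lemma upper_approx_regular w theta (M K N : nat) (r delta tau2 : R) B (Q : {poly R}) :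
  (0 < M)%N -> (0 < N)%N -> 1 <= r -> 36 * 64 * kappa * M%:R <= r ^+ 2 ->
  ~~ odd K -> 0 <= delta -> 2^-1 ^+ K <= delta ->
  chf_const kappa * N%:R ^+ 2 * tau2 <= 1 -> regular s w tau2 B -> 0 < var s w B ->
  (size Q <= K.+1)%N -> (forall t, 0 <= Q.[t]) -> (forall t, 0 <= t -> 1 <= Q.[t]) ->
  (forall t, `|t| <= 1 / 2 -> Q.[t] <= 1 + delta) ->
  (forall t, -(1 / 2) <= t <= - (4 * r * N%:R)^-1 -> Q.[t] <= delta) ->
  (forall t, 1 / 2 <= `|t| -> Q.[t] <= (12 * `|t|) ^+ K) ->
  exists p, upper_approx (~: B)%SET K M delta (36 / N%:R + 2^-1 ^+ M) w theta p.
Proof.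
move=> M0 N0 r1 Hr oK d0 Kd Ht reg V0 sQ Q0 Q1 Qmid Qleft Qout.
have r0 : 0 < r by lra.
set sig := Num.sqrt (var s w B).
have sig0 : 0 < sig by rewrite sqrtr_gt0.
have c0 : 0 < r * sig by rewrite mulr_gt0.
have N0' : 0 < N%:R :> R by rewrite ltr0n.
set H := (~: B)%SET; have HB : (~: H)%SET = B by rewrite finset.setCK.
pose Phi y : {poly R} := if y <= - (r * sig) then 1 else
  if r * sig <= y then ((r * sig)^-1 *: 'X) ^+ K else
  Q \Po ((4 * r * sig)^-1 *: ('X - y%:P)).
pose p x := (Phi (residual w theta H x)).[lin m w (~: H)%SET x].
have pE x : p x = if residual w theta H x <= - (r * sig) then 1 else
   if r * sig <= residual w theta H x then (lin m w (~: H)%SET x / (r * sig)) ^+ K else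
   Q.[(lin m w (~: H)%SET x - residual w theta H x) / (4 * r * sig)].
  rewrite /p /Phi; case: ifP => _; first by rewrite hornerC.
  case: ifP => _; first by rewrite horner_exp !hornerE mulrC.
  by rewrite horner_comp !hornerE mulrC.
have Qge x y : (y <= x)%R%:R <= Q.[(x - y) / (4 * r * sig)].
  case: (leP y x) => h; last exact: Q0.
  by apply: Q1; rewrite divr_ge0 ?subr_ge0// !mulr_ge0// ltW.
exists p; split.
- apply: junta_sum_horner; [exact: residual_determined|exact: lin_junta_sum|].
  move=> y; rewrite /Phi; case: ifP => _; first by rewrite size_poly1.
  case: ifP => _; first by rewrite exprZn (leq_trans (size_scale_leq _ _))// size_polyXn.
  rewrite (leq_trans (size_comp_poly_leq _ _))//.
  have s2 : (size ((4 * r * sig)^-1 *: ('X - y%:P)) <= 2)%N.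
    by rewrite (leq_trans (size_scale_leq _ _))// size_XsubC.
  rewrite ltnS (leq_trans (n := (size Q).-1 * 1))//.
    by rewrite leq_mul2l; apply/orP; right; case: (size _) s2 => [|[|[|]]].
  by rewrite muln1; case: (size Q) sQ.
- move=> x; rewrite pE; case: (leP (residual w theta H x) (- (r * sig))) => h.
    by case: (halfspace w theta x); rewrite ?ler01.
  case: ifP => h2; first exact: power_ge_halfspace.
  by rewrite (halfspace_residual _ _ H).
- rewrite (_ : (fun t => _) = fun t => if residual w theta H (X^~ t) <= - (r * sig) then 1
      else if r * sig <= residual w theta H (X^~ t) then (linX X m w (~: H)%SET t / (r * sig)) ^+ K
      else Q.[(linX X m w (~: H)%SET t - residual w theta H (X^~ t)) / (4 * r * sig)]); last first.
    by apply/funext => t; rewrite pE.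
  have mr := measurable_residual w theta H.
  have ml : measurable_fun setT (linX X m w (~: H)%SET) by exact: measurable_linX.
  apply: measurable_fun_ifT; [exact: measurable_fun_ler|exact: measurable_cst|].
  apply: measurable_fun_ifT; [exact: measurable_fun_ler| |].
    by apply: measurable_funX; exact: measurable_funM.
  apply: measurable_horner; apply: measurable_funM; last exact: measurable_cst.
  exact: measurable_funB.
- exists (fun t => (`|linX X m w [set: 'I_n]%SET t - shifted_threshold w theta| <= sig / N%:R) ||
                  (r * sig / 2 < `|linX X m w B t|)).
  have m1 : measurable_fun setT (fun t => `|linX X m w [set: 'I_n]%SET t - shifted_threshold w
      theta| <= sig / N%:R).
    apply: measurable_fun_ler => //; apply: measurableT_comp => //.
    by apply: measurable_funB => //; exact: measurable_linX.
  have m2 : measurable_fun setT (fun t => r * sig / 2 < `|linX X m w B t|).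
    by apply: measurable_fun_ltr => //; apply: measurableT_comp => //; exact: measurable_linX.
  split; first exact: measurable_or.
    apply: (le_trans (Ex_or m1 m2)); apply: lerD; last exact: tail_event.
    apply: (anticoncentration indep kappa1 sg) => //.
    have chp : 0 <= chf_const kappa * N%:R ^+ 2.
      by rewrite mulr_ge0 ?sqr_ge0//; have := chf_const_ge2 kappa1; lra.
    move=> j jB; apply: (le_trans (ler_wpM2l chp (reg j jB))).
    by rewrite mulrA -[leRHS]mul1r ler_wpM2r// ltW.
  move=> t; rewrite negb_or -ltNge -leNgt => /andP[h1 h2].
  rewrite pE (halfspace_residual _ _ H) HB -/(linX X m w B t).
  set eta := residual w theta H (X^~ t).
  have Eeta : linX X m w [set: 'I_n]%SET t - shifted_threshold w theta = linX X m w B t - eta.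
    have : linX X m w [set: 'I_n]%SET t = linX X m w H t + linX X m w B t.
      rewrite /linX /lin (big_setID H)/= finset.setTI finset.setTD; congr (_ + _).
      by apply: eq_bigl => j; rewrite HB.
    by rewrite /eta /residual -/(linX X m w H t) => ->; ring.
  rewrite {}Eeta in h1.
  set S := linX X m w B t in h1 h2 *.
  have [h2a h2b] : - (r * sig / 2) <= S /\ S <= r * sig / 2.
    by move: h2; rewrite ler_norml => /andP[].
  case: (leP eta (- (r * sig))) => h3.
    have -> : eta <= S by lra.
    by rewrite lerDl.
  case: (leP (r * sig) eta) => h4.
    have h5 := @power_small w H (r * sig) delta K (X^~ t) c0 Kd; rewrite HB in h5.
    by apply: (le_trans (h5 h2)); rewrite lerDr ler0n.
  have s4 : 0 < 4 * r * sig by rewrite mulr_gt0// mulr_gt0.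
  case: (leP eta S) => h5.
    apply: Qmid; rewrite normrM normfV (gtr0_norm s4) ler_pdivrMr// ler_norml; lra.
  rewrite add0r; apply: Qleft; apply/andP; split.
    by rewrite ler_pdivlMr//; lra.
  rewrite ler0_norm in h1; last by lra.
  rewrite ler_pdivrMr//.
  have -> : - (4 * r * N%:R)^-1 * (4 * r * sig) = - (sig / N%:R).
    by field; rewrite !gt_eqF.
  lra.
- exists (fun t => 6 * `|linX X m w B t| / (r * sig)).
  have [g1 g2] := growth_moment M0 r0 Hr V0.
  split => //; first by move=> t; rewrite divr_ge0 ?mulr_ge0 ?(ltW r0)// ltW.
  have P1 (g : R) : 1 <= Num.max 1 g ^+ K by rewrite exprn_ege1// le_max lexx.
  have P2 (x g : R) : x <= Num.max 1 g ^+ K -> x <= (1 + delta) * Num.max 1 g ^+ K.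
    by move=> /le_trans; apply; rewrite ler_peMl ?lerDl//; exact: le_trans (P1 g).
  move=> t; rewrite pE; case: (leP _ (- (r * sig))) => h3; first exact/P2/P1.
  case: (leP (r * sig)) => h4.
    by apply: P2; have := power_growth w H K (X^~ t) c0; rewrite HB.
  rewrite HB -/(linX X m w B t).
  set eta := residual w theta H (X^~ t) in h3 h4 *.
  set S := linX X m w B t.
  have s4 : 0 < 4 * r * sig by rewrite mulr_gt0// mulr_gt0.
  have [h5|h5] := leP `|(S - eta) / (4 * r * sig)| (1 / 2).
    rewrite (le_trans (Qmid _ h5))// -[leLHS]mulr1 ler_wpM2l//; lra.
  apply: P2; apply: (le_trans (Qout _ (ltW h5))); apply: ler_exp => //.
  rewrite le_max; apply/orP; right.
  move: h5; rewrite normrM normfV (gtr0_norm s4) ltr_pdivlMr// => h5.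
  (* Here |S - eta| > 2 r sig and |eta| < r sig, so |S| > r sig and |S - eta| <= 2 |S|; the base 12
     of [Qout] over the scale 4 r sig becomes 6 |S| / (r sig). *)
  have h6 : `|S - eta| <= `|S| + r * sig.
    by rewrite (le_trans (ler_normB _ _))// lerD2l ler_norml; lra.
  rewrite mulrA ler_pdivrMr//.
  have -> : 6 * `|S| / (r * sig) * (4 * r * sig) = 24 * `|S|.
    by field; rewrite !gt_eqF.
  lra.
Qed.

(** With zero variance the moment bound no longer grows with l: l^2 E|Y|^2 stays below 8 for all l,
    which forces the second moment to vanish. *)
Lemma var0_ae w A : var s w A = 0 -> {ae P, forall t, linX X m w A t = 0}.
Proof.
move=> V0; set Y := linX X m w A.
have mY : measurable_fun setT Y by exact: measurable_linX.
have H := mgf_lin indep sg w A; rewrite -/Y V0 in H.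
have [i2 b2] := mgf_pow mY H (isT : (0 < 2)%N).
set e := Ex P (fun t => `|Y t| ^+ 2).
have e0 : 0 <= e by apply: Ex_ge0 => t; rewrite exprn_ge0.
have {}b2 l : l ^+ 2 * e <= 8.
  have := b2 l; rewrite mulr0 expR0 mulr1.
  rewrite (_ : (fun t => _) = (fun t => l ^+ 2 * `|Y t| ^+ 2)); last first.
    by apply/funext => t; rewrite !norm_sqr exprMn.
  by rewrite ExZ// -/e => /le_trans; apply; lra.
have {}e0 : e = 0.
  apply/eqP; rewrite eq_le e0 andbT leNgt; apply/negP => ep.
  have := b2 (4 / e); rewrite expr_div_n -mulrA.
  have -> : e ^- 2 * e = e^-1 by field; rewrite gt_eqF.
  have := b2 4; have := b2 1 => h1 h2 h3.
  have e1 : e * e^-1 = 1 by rewrite mulfV// gt_eqF.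
  have eV : 0 < e^-1 by rewrite invr_gt0.
  nra.
have E : (\int[P]_(t in setT) `|((Y t) ^+ 2)%:E| = 0)%E.
  rewrite (_ : 0%E = e%:E); last by rewrite e0.
  rewrite /e -EFin_Ex//; apply: eq_integral => t _ /=.
  by rewrite normrX.
have mY2 : measurable_fun setT (fun t => ((Y t) ^+ 2)%:E).
  by apply/measurable_EFinP; exact: measurable_funX.
have /(ae_eq_integral_abs P measurableT mY2) := E.
apply: filterS => t /= /(_ Logic.I) [] /eqP.
by rewrite sqrf_eq0 => /eqP.
Qed.

Lemma Ex_ae0 (Y : T -> R) : measurable_fun setT Y -> (forall t, 0 <= Y t) ->
  {ae P, forall t, Y t = 0} -> itg P Y /\ Ex P Y = 0.
Proof.
move=> mY Y0 aeY.
have E : (\int[P]_t (Y t)%:E = 0)%E.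
  rewrite (ae_eq_integral (cst 0%E))//.
  - exact: integral0.
  - exact/measurable_EFinP.
  - by apply: filterS aeY => t /= -> _.
by split; [apply: itg_ge0P => //; rewrite E|rewrite /Ex /Rintegral E].
Qed.

(** The tail vanishes only almost surely, while the halfspace must be dominated at every point. For
    a residual y > 0 the square of tail/y does both: it is almost surely 0, and at least 1 wherever
    the tail reaches y. *)
Lemma upper_approx_null w theta (M K : nat) (delta pw : R) A : (0 < M)%N -> (2 <= K)%N ->
  0 <= delta -> 0 <= pw -> var s w A = 0 ->
  exists p, upper_approx (~: A)%SET K M delta pw w theta p.
Proof.
move=> M0 K2 d0 pw0 V0.
set H := (~: A)%SET; have HA : (~: H)%SET = A by rewrite finset.setCK.
have aeS := var0_ae V0.
(* For y > 0, [expR (- ln y)] is the inverse of y, in a form whose measurability follows from that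
   of [expR] and [ln]. *)
pose Phi y : {poly R} := if y <= 0 then 1 else (expR (- ln y) *: 'X) ^+ 2.
pose p x := (Phi (residual w theta H x)).[lin m w (~: H)%SET x].
have pE x : p x = if residual w theta H x <= 0 then 1 else (lin m w A x * expR (- ln (residual w
    theta H x))) ^+ 2.
  by rewrite /p /Phi HA; case: ifP => _; rewrite ?hornerC// horner_exp !hornerE mulrC.
have mr := measurable_residual w theta H.
have mS : measurable_fun setT (linX X m w A) by exact: measurable_linX.
have mV : measurable_fun setT (fun t => expR (- ln (residual w theta H (X^~ t)))).
  apply: measurableT_comp => //; apply: measurableT_comp => //.
  by apply: measurableT_comp => //; exact: measurable_ln.
have mb : measurable_fun setT (fun t => linX X m w A t != 0).
  apply: measurable_neg; rewrite (_ : (fun t => _) = fun t => (linX X m w A t <= 0) && (0 <= linX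
      X m w A t)).
    by apply: measurable_and; exact: measurable_fun_ler.
  by apply/funext => t; rewrite eq_le.
exists p; split.
- apply: junta_sum_horner; [exact: residual_determined|exact: lin_junta_sum|].
  move=> y; rewrite /Phi; case: ifP => _; first by rewrite size_poly1.
  by rewrite exprZn (leq_trans (size_scale_leq _ _))// size_polyXn.
- move=> x; rewrite pE; case: (leP (residual w theta H x) 0) => h.
    by case: (halfspace w theta x); rewrite ?ler01.
  rewrite expRN lnK//.
  by have := @power_ge_halfspace w theta H (residual w theta H x) 2 x h isT (lexx _); rewrite HA.
- rewrite (_ : (fun t => _) = fun t => if residual w theta H (X^~ t) <= 0 then 1
      else (linX X m w A t * expR (- ln (residual w theta H (X^~ t)))) ^+ 2); last first.
    by apply/funext => t; rewrite pE.
  apply: measurable_fun_ifT; [exact: measurable_fun_ler|exact: measurable_cst|].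
  by apply: measurable_funX; exact: measurable_funM.
- exists (fun t => linX X m w A t != 0); split => //.
    have aeb : {ae P, forall t, (linX X m w A t != 0)%:R = 0 :> R}.
      by apply: filterS aeS => t /= ->; rewrite eqxx.
    by have [_ ->] := Ex_ae0 (measurable_bR mb) (fun=> ler0n _ _) aeb.
  move=> t; rewrite negbK => /eqP S0; rewrite pE (halfspace_residual _ _ H) HA.
  rewrite -/(linX X m w A t) S0; case: (leP (residual w theta H (X^~ t)) 0) => _; rewrite ?lerDl//.
  by rewrite mul0r expr0n/= add0r.
- exists (fun t => (linX X m w A t != 0)%:R * `|linX X m w A t * expR (- ln (residual w theta H
    (X^~ t)))|).
  have mG : measurable_fun setT (fun t => (linX X m w A t != 0)%:R * `|linX X m w A t * expR (-
      ln (residual w theta H (X^~ t)))|).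
    apply: measurable_funM; first exact: measurable_bR.
    by apply: measurableT_comp => //; exact: measurable_funM.
  have [] := @Ex_ae0 (fun t => ((linX X m w A t != 0)%:R * `|linX X m w A t * expR (- ln
      (residual w theta H (X^~ t)))|) ^+ (2 * M)).
  + exact: measurable_funX.
  + by move=> t; rewrite exprn_ge0// mulr_ge0.
  + apply: filterS aeS => t /= ->; rewrite eqxx mul0r expr0n.
    by case: (M) M0.
  move=> i1 E1; split => //.
    by rewrite E1 exprn_ge0// invr_ge0.
  move=> t; rewrite pE.
  set g := _ * `|_|.
  have P1 : 1 <= Num.max 1 g ^+ K by rewrite exprn_ege1// le_max lexx.
  suff h : (if residual w theta H (X^~ t) <= 0 then 1 else (linX X m w A t * expR (- ln (residual
      w theta H (X^~ t)))) ^+ 2) <= Num.max 1 g ^+ K.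
    by apply: (le_trans h); rewrite ler_peMl ?lerDl//; exact: le_trans P1.
  case: ifP => _ //.
  have [S0|S0] := eqVneq (linX X m w A t) 0.
    by rewrite S0 mul0r expr0n/=; exact: le_trans P1.
    rewrite -norm_sqr (@le_trans _ _ (Num.max 1 g ^+ 2))//.
    by apply: ler_exp => //; rewrite /g S0 mul1r le_max lexx orbT.
  by apply: ler_weXn2l => //; rewrite le_max lexx.
Qed.

End HalfspaceApproximation.

(** * Intersections of halfspaces *)

Section Products.
Variable R : realType.

Lemma prod_perturb (I : Type) (r : seq I) (h : I -> R) (delta : R) :
  0 <= delta -> (forall i, 0 <= h i <= 1) ->
  \prod_(i <- r) (h i + delta) <= \prod_(i <- r) h i + ((1 + delta) ^+ size r - 1).
Proof.
move=> d0 h01; elim: r => [|i r IH]; first by rewrite !big_nil expr0; lra.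
rewrite !big_cons /= exprS.
have /andP[h0 h1] := h01 i.
have : (h i + delta) * \prod_(j <- r) (h j + delta) <=
    (h i + delta) * (\prod_(j <- r) h j + ((1 + delta) ^+ size r - 1)).
  by rewrite ler_wpM2l// addr_ge0.
move/le_trans; apply.
have P1 : \prod_(j <- r) h j <= 1.
  by elim: r {IH} => [|j r IH]; rewrite ?big_nil// big_cons; have := h01 j; nra.
have P0 : 0 <= \prod_(j <- r) h j by apply: prodr_ge0 => j _; have /andP[] := h01 j.
have E0 : 1 <= (1 + delta) ^+ size r by rewrite exprn_ege1// lerDl.
nra.
Qed.

(** Takes the place of Hoelder's inequality: a product of d factors is at most a common bound on
    their d-th powers, so moments of order K d of each single growth function suffice. *)
Lemma prod_le_of_pow (I : finType) (y : I -> R) (Q : R) : (0 < #|I|)%N ->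
  1 <= Q -> (forall i, 0 <= y i) -> (forall i, y i ^+ #|I| <= Q) -> \prod_i y i <= Q.
Proof.
move=> I0 Q1 y0 yQ.
have P0 : 0 <= \prod_i y i by apply: prodr_ge0.
rewrite -(@ler_pXn2r _ #|I|)// ?nnegrE//; last by rewrite (le_trans ler01).
have h : \prod_i y i ^+ #|I| <= \prod_(i : I) Q.
  by apply: ler_prod => i _; rewrite exprn_ge0/=.
by rewrite -prodrXl (le_trans h)// prodr_const cardT -cardE.
Qed.

Lemma expDn_le2 (delta : R) d : 0 <= delta -> d%:R * delta <= 1 / 2 ->
  (1 + delta) ^+ d <= 1 + 2 * (d%:R * delta).
Proof.
move=> d0 dd.
have B (k : nat) : (k <= d)%N -> (1 + delta) ^+ k <= 1 + 2 * (k%:R * delta).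
  elim: k => [|k IH] kd; first by rewrite expr0 mul0r mulr0 addr0.
  rewrite exprS -natr1.
  have kd' : k%:R * delta <= d%:R * delta by rewrite ler_wpM2r// ler_nat ltnW.
  have k1 : (k%:R + 1) * delta <= d%:R * delta by rewrite natr1 ler_wpM2r// ler_nat.
  have := IH (ltnW kd).
  have h : (1 + delta) * (1 + delta) ^+ k <= (1 + delta) * (1 + 2 * (k%:R * delta)).
    by rewrite ler_wpM2l// ?addr_ge0// IH// ltnW.
  move=> _; apply: (le_trans h).
  have : 0 <= delta * (1 - 2 * (k%:R * delta)) by rewrite mulr_ge0//; lra.
  lra.
exact: B.
Qed.

End Products.

(** * Multiplying the upper approximations of the halfspaces *)

Section Sandwich.
Context (dsp : measure_display) (T : measurableType dsp) (R : realType).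
Variables (P : probability T R) (n d : nat) (X : 'I_n -> {RV P >-> R}).
Hypothesis indep : mutually_independent X.
Variables (m s : 'I_n -> R) (kappa : R).
Hypothesis kappa1 : 1 <= kappa.
Hypothesis sg : forall j, subgauss P kappa (s j) (fun t => X j t - m j).

Lemma upper_approx_exists w theta (M K N l q : nat) (r delta tau2 : R) (Q : {poly R}) :
  (0 < M)%N -> (0 < N)%N -> (0 < q)%N -> 1 <= r -> 36 * 64 * kappa * M%:R <= r ^+ 2 ->
  ~~ odd K -> (2 <= K)%N -> 0 <= delta -> 2^-1 ^+ K <= delta ->
  0 < tau2 <= 1 -> chf_const kappa * N%:R ^+ 2 * tau2 <= 1 ->
  (1 - tau2) ^+ q * (4 * r) ^+ 2 <= tau2 ->
  (size Q <= K.+1)%N -> (forall t, 0 <= Q.[t]) -> (forall t, 0 <= t -> 1 <= Q.[t]) ->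
  (forall t, `|t| <= 1 / 2 -> Q.[t] <= 1 + delta) ->
  (forall t, -(1 / 2) <= t <= - (4 * r * N%:R)^-1 -> Q.[t] <= delta) ->
  (forall t, 1 / 2 <= `|t| -> Q.[t] <= (12 * `|t|) ^+ K) ->
  exists (H : {set 'I_n}) p, (#|H| <= l * q)%N /\
    upper_approx X H K M delta
      (36 / N%:R + (1 - (16 * chf_const kappa)^-1) ^+ l + (l.+1)%:R * 2^-1 ^+ M) w theta p.
Proof.
move=> M0 N0 q0 r1 Hr oK K2 d0 Kd t01 tN tq sQ Q0 Q1 Qmid Qleft Qout.
have r0 : 0 < r by lra.
have qq0 : 0 <= 1 - (16 * chf_const kappa)^-1.
  rewrite subr_ge0 invf_le1; have := chf_const_ge2 kappa1; lra.
have M20 : 0 <= 2^-1 ^+ M :> R by rewrite exprn_ge0// invr_ge0.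
have N20 : 0 <= 36 / N%:R :> R by rewrite divr_ge0.
set qq := 1 - _ in qq0 *.
have ql0 : 0 <= qq ^+ l by rewrite exprn_ge0.
set pw := _ + _ * 2^-1 ^+ M.
have pwE : pw = 36 / N%:R + qq ^+ l + l%:R * 2^-1 ^+ M + 2^-1 ^+ M.
  by rewrite /pw -[l.+1%:R]natr1 [(l%:R + 1) * _]mulrDl mul1r addrA.
have l20 : 0 <= l%:R * 2^-1 ^+ M :> R by rewrite mulr_ge0.
have pw0 : 0 <= pw by rewrite pwE; lra.
have cardC (B : {set 'I_n}) : (#|[set: 'I_n] :\: B| <= l * q)%N -> (#|~: B|%SET <= l * q)%N.
  by rewrite finset.setTD.
have r40 : 0 < 4 * r by rewrite mulr_gt0.
have [[B [_ /cardC Bq rB]]|[js [C [_ /cardC Cq sjs ch]]]] :=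
    regular_or_chain s w l [set: 'I_n]%SET t01 r40 q0 tq.
  have [V0|V0] := eqVneq (var s w B) 0.
    have [p pP] := upper_approx_null indep sg theta M0 K2 d0 pw0 V0.
    by exists (~: B)%SET, p.
  have {}V0 : 0 < var s w B by rewrite lt_neqAle eq_sym V0 var_ge0.
  have [p pP] := upper_approx_regular indep kappa1 sg theta M0 N0 r1 Hr oK d0 Kd tN rB V0 sQ Q0
      Q1 Qmid Qleft Qout.
  exists (~: B)%SET, p; split => //.
  by apply: upper_approx_mono pP; rewrite pwE; lra.
have [V0|V0] := eqVneq (var s w C) 0.
  have [p pP] := upper_approx_null indep sg theta M0 K2 d0 pw0 V0.
  by exists (~: C)%SET, p.
have {}V0 : 0 < var s w C by rewrite lt_neqAle eq_sym V0 var_ge0.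
have [p pP] := upper_approx_chain indep kappa1 sg theta M0 r0 Hr oK d0 Kd ch V0.
exists (~: C)%SET, p; split => //.
by apply: upper_approx_mono pP; rewrite pwE sjs; lra.
Qed.

Lemma halfspaces_interE (w : 'I_d -> 'I_n -> R) theta x :
  halfspaces_inter w theta x = \prod_i (halfspace (w i) (theta i) x)%:R.
Proof.
rewrite /halfspaces_inter; case: forallP => [h|nh].
  by rewrite big1// => i _; rewrite h.
have /existsP[i hi] : [exists i, ~~ halfspace (w i) (theta i) x].
  by rewrite -negb_forall; apply/forallP.
by rewrite (bigD1 i)//= (negbTE hi) mul0r.
Qed.

Lemma measurable_halfspace (w : 'I_n -> R) theta :
  measurable_fun setT (fun t => halfspace w theta (X^~ t)).
Proof.
apply: measurable_fun_ler; first exact: measurable_cst.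
by apply: measurable_sum => i; apply: measurable_funM => //; exact: measurable_cst.
Qed.

Lemma product_sandwich (w : 'I_d -> 'I_n -> R) theta (H : 'I_d -> {set 'I_n}) p
    (K M h : nat) (delta pw eps : R) : (0 < d)%N ->
  (forall i, #|H i| <= h)%N ->
  (forall i, upper_approx X (H i) K M delta pw (w i) (theta i) (p i)) ->
  (K * d <= 2 * M)%N -> 0 <= delta -> d%:R * delta <= 1 / 2 ->
  2 * d%:R * (delta + pw + 2^-1 ^+ M) <= eps ->
  gen_poly (range_prod X) (d * h + d * K) (fun x => \prod_i p i x) /\
  sandwiching_upper X eps (halfspaces_inter w theta) (fun x => \prod_i p i x).
Proof.
move=> d0 Hh pP KM de0 dd Heps.
pose U := (\bigcup_i H i)%SET.
have Uh : (#|U| <= d * h)%N.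
  rewrite (@leq_trans (\sum_(i < d) #|H i|))//.
    rewrite /U; elim/big_rec2: _ => [|i A B _ IH]; first by rewrite cards0.
    by rewrite (leq_trans (leq_card_setU _ _))// leq_add2l.
  rewrite (@leq_trans (\sum_(i < d) h))//; first exact: leq_sum.
  by rewrite sum_nat_const card_ord.
split.
  have : junta_sum U (d * K) (fun x => \prod_i p i x).
    apply: junta_sum_prod => i; have [h1 _ _ _ _] := pP i.
    apply: junta_sum_mono h1 => //.
    exact: finset.bigcup_sup.
  move/(junta_sum_gen_poly (range_prod X)) => [N [q [qj qE]]].
  exists N, q; split => // i; have [J JU Jq] := qj i.
  by exists J => //; rewrite (leq_trans JU)// leq_add2r.
pose hb i t : R := (halfspace (w i) (theta i) (X^~ t))%:R.
pose F t := \prod_i p i (X^~ t).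
have p0 i x : 0 <= p i x.
  by have [_ h2 _ _ _] := pP i; rewrite (le_trans _ (h2 x)).
have hp x : halfspaces_inter w theta x <= \prod_i p i x.
  rewrite halfspaces_interE; apply: ler_prod => i _.
  by have [_ -> _ _ _] := pP i; rewrite ler0n.
have hfE t : halfspaces_inter w theta (X^~ t) = \prod_i hb i t.
  exact: halfspaces_interE.
have mh i : measurable_fun setT (hb i).
  exact/measurable_bR/measurable_halfspace.
have mf : measurable_fun setT (fun t => halfspaces_inter w theta (X^~ t)).
  rewrite (_ : (fun t => _) = fun t => \prod_i hb i t); last exact/funext.
  by apply: measurable_prod => i _.
have mF : measurable_fun setT F.
  by apply: measurable_prod => i _; have [] := pP i.
have f01 t : 0 <= halfspaces_inter w theta (X^~ t) <= 1.
  by rewrite /halfspaces_inter; case: forallP => _; rewrite !lexx !ler01.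
have itf : itg P (fun t => halfspaces_inter w theta (X^~ t)).
  by apply: (@itg_bnd _ _ _ P 1) => // t; have /andP[? ?] := f01 t; rewrite ger0_norm.
have /choice[W WP] : forall i, exists W : T -> bool,
    [/\ measurable_fun setT W, Ex P (fun t => (W t)%:R) <= pw &
      forall t, ~~ W t -> p i (X^~ t) <= hb i t + delta] by move=> i; have [] := pP i.
have /choice[G GP] : forall i, exists G : T -> R,
   [/\ forall t, 0 <= G t, itg P (fun t => G t ^+ (2 * M)),
        Ex P (fun t => G t ^+ (2 * M)) <= 2^-1 ^+ M &
        forall t, p i (X^~ t) <= (1 + delta) * Num.max 1 (G t) ^+ K].
  by move=> i; have [] := pP i.
pose S t := \sum_i G i t ^+ (2 * M); pose V t : R := \sum_i (W i t)%:R.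
have GM i t : 0 <= G i t ^+ (2 * M) by rewrite exprn_ge0//; have [] := GP i.
have S0 t : 0 <= S t by apply: sumr_ge0 => i _.
have V0 t : 0 <= V t by apply: sumr_ge0 => i _; rewrite ler0n.
have dE : (1 + delta) ^+ d <= 1 + 2 * (d%:R * delta) by exact: expDn_le2.
have de1 : 0 <= 1 + delta by lra.
(* A bound valid everywhere. The factor 2 comes from (1 + delta)^d, and the growth functions of
   power K d <= 2M are absorbed by their sum [S]. *)
have FS t : F t <= 2 * (1 + S t).
  have F1 : F t <= (1 + delta) ^+ d * \prod_i Num.max 1 (G i t) ^+ K.
    rewrite -[d in _ ^+ d]card_ord -prodr_const -big_split/=.
    by apply: ler_prod => i _; rewrite p0/=; have [_ _ _ ->] := GP i.
  have F2 : \prod_i Num.max 1 (G i t) ^+ K <= 1 + S t.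
    apply: prod_le_of_pow; first by rewrite card_ord.
    - by rewrite lerDl.
    - by move=> i; rewrite exprn_ge0// le_max ler01.
    move=> i; rewrite card_ord -exprM.
    have g0 : 0 <= G i t by have [] := GP i.
    have gS : G i t ^+ (2 * M) <= S t.
      by rewrite /S (bigD1 i)//= lerDl sumr_ge0.
    have m1 : 1 <= Num.max 1 (G i t) by rewrite le_max lexx.
    apply: (@le_trans _ _ (Num.max 1 (G i t) ^+ (2 * M))); first exact: ler_weXn2l.
    have [_|_] := leP 1 (G i t); first by rewrite (le_trans gS)// lerDr.
    by rewrite expr1n lerDl.
  have pr0 : 0 <= \prod_i Num.max 1 (G i t) ^+ K.
    by apply: prodr_ge0 => i _; rewrite exprn_ge0// le_max ler01.
  apply: (le_trans F1); apply: ler_pM => //; first by rewrite exprn_ge0.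
  by apply: (le_trans dE); lra.
(* If some bad event [W i] occurs then V >= 1 and [FS] suffices; otherwise every factor is within
   delta of its indicator, and the product loses at most (1 + delta)^d - 1. *)
have FB t : F t <= halfspaces_inter w theta (X^~ t) + 2 * (d%:R * delta) + 2 * V t + 2 * S t.
  have ff := f01 t; have /andP[ff0 _] := ff; have dd0 : 0 <= d%:R * delta by rewrite mulr_ge0.
  have [/existsP[i Wi]|/existsPn nW] := boolP [exists i, W i t].
    have V1 : 1 <= V t by rewrite /V (bigD1 i)//= Wi lerDl sumr_ge0.
    by have := FS t; lra.
  have F1 : F t <= \prod_i (hb i t + delta).
    by apply: ler_prod => i _; rewrite p0/=; have [_ _ ->] := WP i.
  have F2 := @prod_perturb R 'I_d (index_enum 'I_d) (fun i => hb i t) delta de0.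
  have sz : size (index_enum 'I_d) = d by rewrite -[RHS]card_ord cardT enumT.
  rewrite sz -hfE in F2.
  have := S0 t; have := V0 t.
  have : F t <= halfspaces_inter w theta (X^~ t) + ((1 + delta) ^+ d - 1).
    by apply: (le_trans F1); apply: F2 => i; rewrite /hb; case: halfspace; rewrite !lexx ?ler01.
  lra.
have iV : itg P V by apply: itg_sum => i; apply: itg_bool; have [] := WP i.
have iS : itg P S by apply: itg_sum => i; have [] := GP i.
have iB : itg P (fun t => halfspaces_inter w theta (X^~ t) + 2 * (d%:R * delta) + 2 * V t + 2 * S
    t).
  apply: itgD; last exact: itgZ.
  apply: itgD; last exact: itgZ.
  by apply: itgD => //; exact: itg_cst.
have F0 t : 0 <= F t by apply: prodr_ge0.
have iF : itg P F by apply: (itg_le iB) => // t; rewrite ger0_norm.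
have EV : Ex P V <= d%:R * pw.
  rewrite Ex_sum; last by move=> i; apply: itg_bool; have [] := WP i.
  rewrite mulr_natl -[d in _ *+ d]card_ord -sumr_const; apply: ler_sum => i _.
  by have [] := WP i.
have ES : Ex P S <= d%:R * 2^-1 ^+ M.
  rewrite Ex_sum; last by move=> i; have [] := GP i.
  rewrite mulr_natl -[d in _ *+ d]card_ord -sumr_const; apply: ler_sum => i _.
  by have [] := GP i.
have EF : Ex P F <= Ex P (fun t => halfspaces_inter w theta (X^~ t)) + eps.
  apply: (le_trans (Ex_le iF iB FB)).
  rewrite ExD; [|apply: itgD; [apply: itgD => //; exact: itg_cst|exact: itgZ]|exact: itgZ].
  rewrite ExD; [|apply: itgD => //; exact: itg_cst|exact: itgZ].
  rewrite ExD//; last exact: itg_cst.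
  rewrite Ex_cst !ExZ//; lra.
split => //.
have EE (Y : T -> R) : itg P Y -> ('E_P[Y] = (Ex P Y)%:E)%E.
  by move=> iY; rewrite unlock; exact: EFin_Ex.
rewrite !EE// -EFinB lee_fin lerBlDr.
exact: EF.
Qed.

End Sandwich.

(** * Discrete, uniform and Gaussian variables *)

Section Density.
Context (d : measure_display) (T : measurableType d) (R : realType).
Import HBNNSimple.

(** The Gaussian law is described by its values on sets; this converts the description into
    integrals, through simple functions and monotone limits. *)
Lemma ge0_integral_density (mu nu : {measure set T -> \bar R}) (g : T -> R) :
  measurable_fun setT g -> (forall x, 0 <= g x) ->
  (forall A, measurable A -> nu A = (\int[mu]_(x in A) (g x)%:E)%E) ->
  forall f : T -> \bar R, measurable_fun setT f -> (forall x, 0 <= f x)%E ->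
  (\int[nu]_x f x = \int[mu]_x (f x * (g x)%:E))%E.
Proof.
move=> mg g0 nuE f mf f0.
have nnE (h : {nnsfun T >-> R}) :
    (\int[nu]_x (h x)%:E = \int[mu]_x ((h x)%:E * (g x)%:E))%E.
  under [LHS]eq_integral do rewrite fimfunE -fsumEFin//.
  rewrite [LHS]ge0_integral_fsum//; last 2 first.
    - by move=> r; exact/measurable_EFinP/measurableT_comp.
    - by move=> n x _; rewrite EFinM nnfun_muleindic_ge0.
  under [RHS]eq_integral.
    move=> x xD; rewrite fimfunE -fsumEFin// ge0_mule_fsuml; last first.
      by move=> r; rewrite EFinM nnfun_muleindic_ge0.
    over.
  rewrite [RHS]ge0_integral_fsum//; last 2 first.
    - move=> r; apply/measurable_EFinP/measurable_funM => //.
      by apply: measurable_funM => //; exact: measurable_cst.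
    - by move=> n x _; rewrite mule_ge0 ?lee_fin// -?lee_fin EFinM nnfun_muleindic_ge0.
  apply: eq_fsbigr => r /[!inE] -[x _ hx]; rewrite /= in hx.
  have r0 : 0 <= r by rewrite -hx.
  rewrite (integralZl_indic_nnsfun _ measurableT)//=.
  rewrite integral_indic// setIT nuE//.
  rewrite [RHS](_ : _ = \int[mu]_y (r%:E * ((g y)%:E * (\1_(h @^-1` [set r]) y)%:E)))%E; last first.
    by apply: eq_integral => y _; rewrite EFinM -muleA; congr (_ * _)%E; rewrite muleC.
  rewrite ge0_integralZl//; last 2 first.
    - apply/measurable_EFinP/measurable_funM => //; exact: measurable_indic.
    - by move=> y _; rewrite mule_ge0 ?lee_fin.
  congr (_ * _)%E; rewrite [LHS]integral_mkcond; apply: eq_integral => y _.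
  by rewrite epatch_indic.
pose f_ := nnsfun_approx measurableT mf.
transitivity (lim (\int[nu]_x (f_ n x)%:E @[n --> \oo])%E).
  rewrite -monotone_convergence//=.
  - apply: eq_integral => ? /[!inE] xD; apply/esym/cvg_lim => //=.
    exact: cvg_nnsfun_approx.
  - by move=> n; exact/measurable_EFinP/measurable_funTS.
  - by move=> n ? _; rewrite lee_fin.
  - by move=> ? _ ? ? mn; rewrite lee_fin; exact/lefP/nd_nnsfun_approx.
transitivity (lim (\int[mu]_x ((f_ n x)%:E * (g x)%:E)%E @[n --> \oo])%E).
  by apply: congr_lim; apply/funext => n /=; exact: nnE.
rewrite -monotone_convergence//=.
- apply: eq_integral => x _; apply/cvg_lim => //=.
  apply: cvgeZr => //; exact: cvg_nnsfun_approx.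
- move=> n; apply/measurable_EFinP; apply: measurable_funM => //.
- by move=> n ? _; rewrite lee_fin mulr_ge0.
- move=> x _ a b ab; rewrite lee_wpmul2r ?lee_fin//; exact/lefP/nd_nnsfun_approx.
Qed.

End Density.

Section AlmostEverywhere.
Context (d : measure_display) (T : measurableType d) (R : realType).
Variable P : probability T R.
Implicit Types X Y Z : T -> R.

Lemma ae_eq_itg Y Z : measurable_fun setT Y -> measurable_fun setT Z ->
  {ae P, forall t, Y t = Z t} -> itg P Z -> itg P Y.
Proof.
move=> mY mZ YZ /integrableP[_ Zoo]; apply/integrableP; split; first exact/measurable_EFinP.
rewrite (ae_eq_integral (fun t => `|(Z t)%:E|)%E)//.
- by apply: measurableT_comp => //; exact/measurable_EFinP.
- by apply: measurableT_comp => //; exact/measurable_EFinP.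
- by apply: filterS YZ => t /= -> _.
Qed.

Lemma ae_eq_Ex Y Z : measurable_fun setT Y -> measurable_fun setT Z ->
  {ae P, forall t, Y t = Z t} -> Ex P Y = Ex P Z.
Proof.
move=> mY mZ YZ; rewrite /Ex /Rintegral; congr fine; apply: ae_eq_integral => //.
- exact/measurable_EFinP.
- exact/measurable_EFinP.
- by apply: filterS YZ => t /= -> _.
Qed.

Lemma ae_itg_bnd c Y : measurable_fun setT Y -> {ae P, forall t, `|Y t| <= c} -> itg P Y.
Proof.
move=> mY Yc.
have mc : measurable_fun setT (fun t => if `|Y t| <= c then Y t else 0).
  apply: measurable_fun_ifT => //.
  by apply: measurable_fun_ler => //; exact: measurableT_comp.
apply: (@ae_eq_itg _ (fun t => if `|Y t| <= c then Y t else 0)) => //.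
  by apply: filterS Yc => t ->.
apply: (@itg_bnd _ _ _ P `|c|) => // t.
by case: ifPn => h; rewrite ?normr0// (le_trans h)// ler_norm.
Qed.

Lemma ae_Ex_le Y Z : itg P Y -> itg P Z -> {ae P, forall t, Y t <= Z t} -> Ex P Y <= Ex P Z.
Proof.
move=> iY iZ YZ; have mY := itg_measurable iY; have mZ := itg_measurable iZ.
have mM : measurable_fun setT (fun t => Num.min (Y t) (Z t)) by exact: measurable_minr.
have YM : {ae P, forall t, Y t = Num.min (Y t) (Z t)}.
  by apply: filterS YZ => t; case: leP.
rewrite (ae_eq_Ex mY mM YM); apply: Ex_le => //.
  by apply: (ae_eq_itg mM mY) => //; apply: filterS YM => t <-.
by move=> t; rewrite ge_min lexx orbT.
Qed.

Lemma subgauss_mono kappa kappa' s Y : kappa <= kappa' ->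
  subgauss P kappa s Y -> subgauss P kappa' s Y.
Proof.
move=> kk [s0 mY EY sE mgf]; split => // l; have [i b] := mgf l; split => //.
rewrite (le_trans b)// ler_expR ler_wpM2r ?sqr_ge0// ler_wpM2r// sqr_ge0//.
Qed.

(** A form of Hoeffding's lemma: in [expR_le_id_sqr] the linear term has mean 0 and the exponent 4
    l^2 B^2 is at most 4 L l^2 s^2. *)
Lemma subgauss_bounded X (m B L s : R) : measurable_fun setT X ->
  {ae P, forall t, `|X t - m| <= B} -> Ex P X = m -> 0 <= s ->
  s ^+ 2 <= Ex P (fun t => (X t - m) ^+ 2) -> B ^+ 2 <= L * s ^+ 2 ->
  subgauss P (4 * L) s (fun t => X t - m).
Proof.
move=> mX XB EX s0 sE BL.
have mY : measurable_fun setT (fun t => X t - m) by exact: measurable_funB.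
have iY : itg P (fun t => X t - m) := ae_itg_bnd mY XB.
have iX : itg P X.
  have := itgD iY (itg_cst P m); congr (itg P _).
  by apply/funext => t; rewrite subrK.
have EY : Ex P (fun t => X t - m) = 0.
  by rewrite ExB//; [rewrite EX Ex_cst subrr|exact: itg_cst].
split => // l.
have mE : measurable_fun setT (fun t => expR (l * (X t - m))).
  by apply: measurableT_comp => //; apply: measurable_funM => //; exact: measurable_cst.
have bE : {ae P, forall t, expR (l * (X t - m)) <= l * (X t - m) + expR (4 * (l ^+ 2 * B ^+ 2))}.
  apply: filterS XB => t /= h.
  rewrite (le_trans (expR_le_id_sqr _))// lerD2l ler_expR ler_wpM2l//.
  by rewrite exprMn ler_wpM2l ?sqr_ge0// -[leLHS]norm_sqr; exact: ler_exp (normr_ge0 _) h.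
have iR : itg P (fun t => l * (X t - m) + expR (4 * (l ^+ 2 * B ^+ 2))).
  by apply: itgD; [exact: itgZ|exact: itg_cst].
have iE : itg P (fun t => expR (l * (X t - m))).
  apply: (@ae_itg_bnd (expR (`|l| * B))) => //.
  apply: filterS XB => t /= h; rewrite ger0_norm ?expR_ge0// ler_expR.
  by rewrite (le_trans (ler_norm _))// normrM ler_wpM2l.
split => //.
rewrite (le_trans (ae_Ex_le iE iR bE))//.
rewrite ExD; [|exact: itgZ|exact: itg_cst].
rewrite ExZ// EY mulr0 add0r Ex_cst ler_expR.
by have := sqr_ge0 l; nra.
Qed.

Lemma measurable_event (b : T -> bool) : measurable_fun setT b -> measurable [set t | b t].
Proof. by move=> mb; have := mb measurableT [set true] I; rewrite setTI. Qed.

Lemma Ex_event (b : T -> bool) : measurable_fun setT b ->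
  (P [set t | b t] = (Ex P (fun t => (b t)%:R))%:E)%E.
Proof.
move=> mb; rewrite -EFin_Ex; last exact: itg_bool.
rewrite (eq_integral (fun t => (\1_[set t | b t] t)%:E)).
  by rewrite integral_indic ?setIT//; exact: measurable_event.
move=> t _; rewrite indicE; case: (boolP (b t)) => bt.
  by rewrite mem_set.
by rewrite memNset//; exact/negP.
Qed.

(** With probability at least 1/2 the squared deviation is at least c^2. A bounded density thus
    gives a lower bound on the variance without computing it. *)
Lemma spread_variance X (m c : R) : measurable_fun setT X -> itg P (fun t => (X t - m) ^+ 2) -> 0
    <= c ->
  (P [set t | (`|X t - m| < c)%R] <= (1 / 2)%:E)%E ->
  c ^+ 2 / 2 <= Ex P (fun t => (X t - m) ^+ 2).
Proof.
move=> mX iX c0.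
have mb : measurable_fun setT (fun t => `|X t - m| < c).
  by apply: measurable_fun_ltr => //; apply: measurableT_comp => //; exact: measurable_funB.
rewrite Ex_event// lee_fin => Pc.
have ib := itg_bool P mb.
have iL : itg P (fun t => c ^+ 2 - c ^+ 2 * (`|X t - m| < c)%R%:R).
  by apply: itgB; [exact: itg_cst|exact: itgZ].
apply: le_trans (_ : _ <= Ex P (fun t => c ^+ 2 - c ^+ 2 * (`|X t - m| < c)%R%:R)) _.
  rewrite ExB; [|exact: itg_cst|exact: itgZ].
  rewrite Ex_cst ExZ//; have := sqr_ge0 c; nra.
apply: Ex_le => // t; case: (ltP `|X t - m| c) => h /=.
  by rewrite mulr1 subrr sqr_ge0.
by rewrite mulr0 subr0 -[leRHS]norm_sqr; exact: ler_exp.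
Qed.

(** A value in the countable range may have probability 0, so a bound on nonzero probabilities is
    available only almost surely. *)
Lemma discrete_ae_atom (Y : {RV P >-> R}) : discrete_rv Y -> {ae P, forall t, pmf Y (Y t) != 0}.
Proof.
move=> /pfcard_geP[rY0|[g]].
  have YN (t : T) : False.
    by have : range Y (Y t) by [exists t]; rewrite rY0.
  by apply: aeW => t; case: (YN t).
pose N (n : nat) := if pmf Y (g n) == 0 then Y @^-1` [set g n] else set0.
apply: (negligibleS (A := \bigcup_n N n)).
  move=> t /= /negP; rewrite negbK => p0.
  have [n _ gn] := @surj _ _ _ _ g (Y t) (ex_intro2 _ _ t I erefl).
  by exists n => //; rewrite /N gn p0.
apply: negligible_bigcup => n; rewrite /N; case: eqP => [p0|_]; last exact: negligible_set0.
have mE : measurable (Y @^-1` [set g n]).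
  by rewrite -[_ @^-1` _]setTI; exact: measurable_funPT.
apply/negligibleP => //.
by rewrite -[LHS]fineK ?fin_num_measure// -/(pmf Y (g n)) p0.
Qed.

Lemma tight (Y : {RV P >-> R}) (alpha : R) : 0 < alpha ->
  exists K : R, 1 - alpha < Ex P (fun t => (`|Y t| <= K)%R%:R).
Proof.
move=> a0; apply: contrapT => /forallNP nK.
have mb K : measurable_fun setT (fun t => `|Y t| <= K).
  by apply: measurable_fun_ler => //; exact: measurableT_comp.
pose F (n : nat) := [set t | `|Y t| <= n%:R].
have mF n : measurable (F n) by exact: measurable_event.
have UF : \bigcup_n F n = setT.
  apply/seteqP; split => // t _; exists (Num.trunc `|Y t|).+1 => //.
  by rewrite /F /= ltW// truncnS_gt.
have := @nondecreasing_cvg_mu _ _ _ P F mF.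
rewrite UF => /(_ measurableT) h.
have {}h : P \o F @ \oo --> P [set: T].
  apply: h => i j ij; apply/subsetPset => t; rewrite /F /= => Yi.
  by rewrite (le_trans Yi)// ler_nat.
have : (P [set: T] <= (1 - alpha)%:E)%E.
  rewrite -(cvg_lim _ h)//; apply: lime_le; first by apply/cvg_ex; exists (P [set: T]).
  apply: nearW => n /=; rewrite /F Ex_event// lee_fin leNgt.
  exact/negP/nK.
by rewrite probability_setT lee_fin; lra.
Qed.

(** An atom v contributes at least alpha (v - m)^2 to the variance V. Hence |Y - m| <= sqrt(V/alpha)
    almost surely, and the bounded case applies with L = 1/alpha. *)
Lemma discrete_subgauss (Y : {RV P >-> R}) (alpha : R) : discrete_rv Y -> 0 < alpha ->
  (forall v, pmf Y v != 0 -> alpha <= pmf Y v) ->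
  exists m s, subgauss P (4 * alpha^-1) s (fun t => Y t - m).
Proof.
move=> dY a0 pa; have aeA := discrete_ae_atom dY.
(* A set of probability above 1 - alpha meets every atom, so |Y| <= K almost surely; this makes the
   squared deviation integrable. *)
have [K PK] := tight Y a0.
have mbK : measurable_fun setT (fun t => `|Y t| <= K).
  by apply: measurable_fun_ler => //; exact: measurableT_comp.
have mbv v : measurable_fun setT (fun t => Y t == v) by exact: measurable_fun_eqr.
have pmfE v : pmf Y v = Ex P (fun t => (Y t == v)%R%:R).
  rewrite /pmf (_ : Y @^-1` [set v] = [set t | Y t == v]) ?Ex_event//.
  by apply/seteqP; split => t /eqP.
have YK : {ae P, forall t, `|Y t| <= K}.
  apply: filterS aeA => t /pa; rewrite pmfE => h; rewrite leNgt; apply/negP => Kt.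
  have : Ex P (fun t' => (`|Y t'| <= K)%R%:R + (Y t' == Y t)%R%:R) <= 1.
    rewrite -[leRHS](Ex_cst P); apply: Ex_le.
    - by apply: itgD; apply: itg_bool.
    - exact: itg_cst.
    - move=> t'; case: eqP => [->|_]; first by rewrite [_ <= K]leNgt Kt add0r.
      by rewrite addr0 lern1; case: (_ <= _).
  rewrite ExD; [|exact: itg_bool|exact: itg_bool].
  by lra.
have mY : measurable_fun setT Y by [].
pose m := Ex P Y; pose V := Ex P (fun t => (Y t - m) ^+ 2).
have mYm : measurable_fun setT (fun t => Y t - m) by exact: measurable_funB.
have iV : itg P (fun t => (Y t - m) ^+ 2).
  apply: (@ae_itg_bnd ((K + `|m|) ^+ 2)); first exact: measurable_funX.
  apply: filterS YK => t h; rewrite normrX; apply: ler_exp => //.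
  by rewrite (le_trans (ler_normB _ _))// lerD2r.
have V0 : 0 <= V by apply: Ex_ge0 => t; rewrite sqr_ge0.
have ia0 : 0 <= alpha^-1 by rewrite invr_ge0 ltW.
exists m, (Num.sqrt V).
apply: (@subgauss_bounded Y m (Num.sqrt (alpha^-1 * V))) => //; last 2 first.
- by rewrite sqr_sqrtr.
- by rewrite !sqr_sqrtr// mulr_ge0.
apply: filterS aeA => t /pa; rewrite pmfE => h.
rewrite -sqrtr_sqr ler_sqrt; last by rewrite mulr_ge0.
rewrite ler_pdivlMl//.
have : Ex P (fun t' => (Y t - m) ^+ 2 * (Y t' == Y t)%R%:R) <= V.
  apply: Ex_le => //; first by apply: itgZ; exact: itg_bool.
  by move=> t'; case: eqP => [->|_]; rewrite ?mulr1// mulr0 sqr_ge0.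
rewrite ExZ; last exact: itg_bool.
apply: le_trans; rewrite mulrC ler_wpM2l// sqr_ge0//.
Qed.

(** The mean is only located within the interval, which already gives |Y - m| <= b - a. An interval
    of radius (b - a)/4 has probability at most 1/2, so the variance is at least (b - a)^2/32. *)
Lemma uniform_subgauss (Y : {RV P >-> R}) : uniform_rv Y ->
  exists m s, subgauss P (4 * 32) s (fun t => Y t - m).
Proof.
move=> [a [b [ab YE]]].
have ba : 0 < b - a by rewrite subr_gt0.
pose c := (a + b) / 2; pose h := (b - a) / 2.
have Yab : {ae P, forall t, `|Y t - c| <= h}.
  have mS : measurable (~` `[a, b]%classic : set R) by exact: measurableC.
  apply: (@negligibleS _ _ _ P (Y @^-1` (~` `[a, b]%classic))).
    move=> t /= /negP h1; rewrite in_itv/=; apply/negP; apply: contra h1 => /andP[h1 h2].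
    by rewrite ler_norml /c /h; apply/andP; split; lra.
  apply/negligibleP; first by rewrite -[_ @^-1` _]setTI; exact: measurable_funPT.
  rewrite -[LHS]/(distribution P Y (~` `[a, b]%classic)) YE// /uniform_prob.
  by rewrite integral_uniform_pdf setICl integral_set0.
have mY : measurable_fun setT Y by [].
pose m := Ex P Y.
have iY : itg P Y.
  apply: (@ae_itg_bnd (h + `|c|)) => //; apply: filterS Yab => t ht.
  by rewrite -[Y t](subrK c) (le_trans (ler_normD _ _))// lerD2r.
have mc : `|m - c| <= h.
  have iYc : itg P (fun t => Y t - c) by apply: itgB => //; exact: itg_cst.
  have EYc : Ex P (fun t => Y t - c) = m - c.
    by rewrite ExB// ?Ex_cst//; exact: itg_cst.
  rewrite ler_norml -EYc -[X in - X](Ex_cst P) -{2}[h](Ex_cst P); apply/andP; split.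
    rewrite -mulN1r -ExZ; last exact: itg_cst.
    apply: ae_Ex_le => //; first exact/itgZ/itg_cst.
    by apply: filterS Yab => t; rewrite ler_norml mulN1r => /andP[].
  apply: ae_Ex_le => //; first exact: itg_cst.
  by apply: filterS Yab => t; rewrite ler_norml => /andP[].
have Ym : {ae P, forall t, `|Y t - m| <= b - a}.
  apply: filterS Yab => t; rewrite !ler_norml => /andP[? ?].
  move: mc; rewrite ler_norml => /andP[? ?]; apply/andP; have hE : h = (b - a) / 2 by []; split;
      lra.
have mYm : measurable_fun setT (fun t => Y t - m) by exact: measurable_funB.
have iV : itg P (fun t => (Y t - m) ^+ 2).
  apply: (@ae_itg_bnd ((b - a) ^+ 2)); first exact: measurable_funX.
  by apply: filterS Ym => t ht; rewrite normrX; exact: ler_exp.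
pose s := (b - a) / Num.sqrt 32.
have s2 : s ^+ 2 = (b - a) ^+ 2 / 32 by rewrite expr_div_n sqr_sqrtr.
exists m, s; apply: (@subgauss_bounded Y m (b - a)) => //.
- by rewrite divr_ge0 ?sqrtr_ge0// ltW.
- rewrite s2; have -> : (b - a) ^+ 2 / 32 = ((b - a) / 4) ^+ 2 / 2 by field.
  apply: spread_variance => //; first by rewrite divr_ge0// ltW.
  pose J : interval R := `](m - (b - a) / 4), (m + (b - a) / 4)[.
  rewrite (_ : [set t | _] = Y @^-1` [set` J]); last first.
    by apply/seteqP; split => t /=; rewrite in_itv/= ltr_distl.
  rewrite -[leLHS]/(distribution P Y _) YE// /uniform_prob.
  apply: (@le_trans _ _ (\int[lebesgue_measure]_(x in [set` J]) ((b - a)^-1)%:E)%E).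
    apply: ge0_le_integral => //.
    + by move=> x _; rewrite lee_fin uniform_pdf_ge0.
    + by apply/measurable_EFinP/measurable_funTS; exact: measurable_uniform_pdf.
    + by move=> x _; rewrite lee_fin /uniform_pdf; case: ifP => // _; rewrite invr_ge0 ltW.
  rewrite integral_cst//= lebesgue_measure_itv/= lte_fin ifT; last by lra.
  rewrite -EFinB -EFinM lee_fin (_ : _ * _ = 1 / 2)//; field.
  by rewrite gt_eqF.
- by rewrite s2; have := sqr_ge0 (b - a); lra.
Qed.

(** In place of a derivative at l = 0: the test value l = u y, with [u] so small that u c <= 1/4 and
    u y^2 <= 1, already forces y = 0. It yields the Gaussian mean from the moment generating
    function. *)
Lemma exp_bound_mean0 (y c : R) : 0 < c -> (forall l, 1 + l * y <= expR (l ^+ 2 * c)) -> y = 0.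
Proof.
move=> c0 H.
have y2 := sqr_ge0 y.
have D0 : 0 < 4 * c + y ^+ 2 by lra.
pose u := (4 * c + y ^+ 2)^-1.
have u0 : 0 < u by rewrite invr_gt0.
have uD : u * (4 * c + y ^+ 2) = 1 by rewrite mulVf// gt_eqF.
have cu : u * c <= 1 / 4 by nra.
have yu : u * y ^+ 2 <= 1 by nra.
have x0 : 0 <= u * c * (u * y ^+ 2) by apply: mulr_ge0; apply: mulr_ge0 => //; exact: ltW.
have x4 : u * c * (u * y ^+ 2) <= 1 / 4.
  rewrite -[1 / 4]mulr1; apply: ler_pM => //; first by rewrite mulr_ge0// ltW.
  by rewrite mulr_ge0// ltW.
have e2 : expR (u * c * (u * y ^+ 2)) <= 1 + 4 / 3 * (u * c * (u * y ^+ 2)).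
  move: x0 x4; set x := u * c * _ => x0 x4.
  have := expR_ge1Dx (- x); rewrite expRN => h.
  have e0 := expR_gt0 x.
  have : expR x * (1 - x) <= 1.
    by rewrite -[leRHS](@mulfV _ (expR x)) ?gt_eqF// ler_wpM2l// ltW.
  nra.
have := H (u * y); rewrite (_ : (u * y) ^+ 2 * c = u * c * (u * y ^+ 2)); last by ring.
move=> h.
have h2 : u * y ^+ 2 <= 4 / 3 * (u * c * (u * y ^+ 2)) by lra.
have h3 : u * c * (u * y ^+ 2) <= 1 / 4 * (u * y ^+ 2).
  by rewrite ler_wpM2r// mulr_ge0// ltW.
have : y ^+ 2 <= 0.
  have : u * y ^+ 2 <= 0 by lra.
  by rewrite pmulr_rle0.
by move=> h4; apply/eqP; rewrite -sqrf_eq0 eq_le h4 y2.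
Qed.

Lemma normal_pdf_shift (mu sigma l x : R) : 0 < sigma ->
  expR (l * (x - mu)) * normal_pdf mu sigma x =
  expR (l ^+ 2 * (sigma ^+ 2 / 2)) * normal_pdf (mu + l * sigma ^+ 2) sigma x.
Proof.
move=> s0; rewrite !normal_pdfE ?gt_eqF// mulrCA [RHS]mulrCA; congr (_ * _).
rewrite /normal_fun -!expRD; congr expR.
by rewrite -mulr_natr; field; rewrite gt_eqF.
Qed.

Lemma ge0_integral_law (Y : {RV P >-> R}) (g : R -> R) :
  (forall A : set R, measurable A ->
    distribution P Y A = (\int[lebesgue_measure]_(x in A) (g x)%:E)%E) ->
  forall f : R -> \bar R, measurable_fun setT f -> (forall x, 0 <= f x)%E ->
  measurable_fun setT g -> (forall x, 0 <= g x) ->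
  (\int[P]_t f (Y t) = \int[lebesgue_measure]_x (f x * (g x)%:E))%E.
Proof.
move=> YE f mf f0 mg g0.
(* [lebesgue_measure] lives on [measurableTypeR R], whose display differs from
   that of the codomain [R] of [Y]. *)
pose Yg : T -> measurableTypeR R := Y.
have mYg : measurable_fun setT Yg by exact: (@measurable_funPT _ _ _ _ Y).
pose mixin := isMeasurableFun.Build _ _ _ _ Yg mYg.
pose YM : {mfun T >-> measurableTypeR R} := HB.pack Yg mixin.
transitivity (\int[pushforward P YM]_x f x)%E; last exact: ge0_integral_density.
by rewrite ge0_integral_pushforward.
Qed.

(** The density is at most 1/(sigma sqrt(2 pi)), so an interval of length sigma has probability at
    most 1/2 and the variance is at least sigma^2/8 = s^2. The exact exponent l^2 sigma^2/2 is then
    4 l^2 s^2. *)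
Lemma gaussian_subgauss (Y : {RV P >-> R}) : gaussian_rv Y ->
  exists m s, subgauss P 4 s (fun t => Y t - m).
Proof.
move=> [mu [sigma [s0 YE]]]; have sn0 : sigma != 0 by rewrite gt_eqF.
have mY : measurable_fun setT Y by [].
have mYm : measurable_fun setT (fun t => Y t - mu) by exact: measurable_funB.
have mE l : measurable_fun setT (fun t => expR (l * (Y t - mu))).
  by apply: measurableT_comp => //; apply: measurable_funM => //; exact: measurable_cst.
have mgf l : (\int[P]_t (expR (l * (Y t - mu)))%:E = (expR (l ^+ 2 * (sigma ^+ 2 / 2)))%:E)%E.
  pose g x : \bar R := (expR (l * (x - mu)))%:E.
  have mg : measurable_fun setT g.
    apply/measurable_EFinP; apply: measurableT_comp => //.
    by apply: measurable_funM; [exact: measurable_cst|exact: measurable_funB].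
  have g0 x : (0 <= g x)%E by rewrite lee_fin expR_ge0.
  rewrite (@ge0_integral_law _ _ YE g mg g0); last 2 first.
  - exact: measurable_normal_pdf.
  - by move=> x; exact: normal_pdf_ge0.
  transitivity (\int[lebesgue_measure]_x ((expR (l ^+ 2 * (sigma ^+ 2 / 2)))%:E *
      (normal_pdf (mu + l * sigma ^+ 2) sigma x)%:E))%E.
    by apply: eq_integral => x _; rewrite /g -!EFinM normal_pdf_shift.
  rewrite ge0_integralZl//.
  - by rewrite integral_normal_pdf mule1.
  - by apply/measurable_EFinP; exact: measurable_normal_pdf.
  - by move=> x _; rewrite lee_fin normal_pdf_ge0.
have iE l : itg P (fun t => expR (l * (Y t - mu))).
  apply: itg_ge0P => //.
  by rewrite mgf ltry.
have EE l : Ex P (fun t => expR (l * (Y t - mu))) = expR (l ^+ 2 * (sigma ^+ 2 / 2)).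
  by rewrite /Ex /Rintegral mgf.
have iY : itg P (fun t => Y t - mu).
  apply: (itg_le (itgD (iE 1) (iE (-1)))) => // t.
  rewrite mul1r mulN1r; have := expR_ge1Dx (Y t - mu); have := expR_ge1Dx (- (Y t - mu)).
  have := expR_gt0 (Y t - mu); have := expR_gt0 (- (Y t - mu)).
  by move=> *; rewrite ler_norml; apply/andP; split; lra.
have EY : Ex P (fun t => Y t - mu) = 0.
  apply: (@exp_bound_mean0 _ (sigma ^+ 2 / 2)) => [|l]; first by rewrite divr_gt0// exprn_gt0.
  rewrite -EE -ExZ// -[X in X + _](Ex_cst P 1) -ExD//; [|exact: itg_cst|exact: itgZ].
  apply: Ex_le => //; first by apply: itgD; [exact: itg_cst|exact: itgZ].
  by move=> t; exact: expR_ge1Dx.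
have iV : itg P (fun t => (Y t - mu) ^+ 2).
  apply: (itg_le (itgD (iE 2) (iE (-2)))) => [|t]; first exact: measurable_funX.
  rewrite ger0_norm ?sqr_ge0//; set y := Y t - mu; move: y => y.
  have := expR_ge1Dx y; have := expR_ge1Dx (- y).
  have -> : 2 * y = y + y by ring. have -> : -2 * y = - y - y by ring.
  rewrite !expRD; have := expR_gt0 y; have := expR_gt0 (- y); have := sqr_ge0 y.
  by move=> *; have [?|?] := leP 0 y; nra.
pose s := sigma / Num.sqrt 8.
have s2 : s ^+ 2 = sigma ^+ 2 / 8 by rewrite expr_div_n sqr_sqrtr.
exists mu, s; split => //.
- by rewrite divr_ge0 ?sqrtr_ge0// ltW.
- rewrite s2; have -> : sigma ^+ 2 / 8 = (sigma / 2) ^+ 2 / 2 by field.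
  apply: spread_variance => //; first by rewrite divr_ge0// ltW.
  pose J : interval R := `](mu - sigma / 2), (mu + sigma / 2)[.
  rewrite (_ : [set t | _] = Y @^-1` [set` J]); last first.
    by apply/seteqP; split => t /=; rewrite in_itv/= ltr_distl.
  rewrite -[leLHS]/(distribution P Y _) YE// /normal_prob.
  apply: (@le_trans _ _ (\int[lebesgue_measure]_(x in [set` J]) (normal_peak sigma)%:E)%E).
    apply: ge0_le_integral => //.
    + by move=> x _; rewrite lee_fin normal_pdf_ge0.
    + by apply/measurable_EFinP/measurable_funTS; exact: measurable_normal_pdf.
    + by move=> x _; rewrite lee_fin normal_pdf_ub.
  rewrite integral_cst//= lebesgue_measure_itv/= lte_fin ifT; last by lra.
  rewrite -EFinB -EFinM lee_fin (_ : mu + _ - _ = sigma); last by field.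
  have D0 : 0 < sigma ^+ 2 * pi *+ 2.
    by rewrite mulrn_wgt0// mulr_gt0 ?pi_gt0// exprn_gt0.
  rewrite /normal_peak mulrC ler_pdivrMr ?sqrtr_gt0//.
  suff : 2 * sigma <= Num.sqrt (sigma ^+ 2 * pi *+ 2) by lra.
  have t0 : 0 <= 2 * sigma by rewrite mulr_ge0// ltW.
  rewrite -[leLHS](ger0_norm t0) -sqrtr_sqr ler_sqrt ?(ltW D0)//.
  rewrite -mulr_natr; have := pi_ge2 R; have := sqr_ge0 sigma; nra.
- move=> l; split => //; rewrite EE ler_expR s2.
  by have -> : 4 * l ^+ 2 * (sigma ^+ 2 / 8) = l ^+ 2 * (sigma ^+ 2 / 2) by field.
Qed.

End AlmostEverywhere.

(** * Choice of the parameters *)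

Section Powers.
Variable R : realType.

Lemma bernoulli (a : R) k : 0 <= a -> 1 + k%:R * a <= (1 + a) ^+ k.
Proof.
move=> a0; elim: k => [|k IH]; first by rewrite mul0r addr0 expr0.
rewrite exprS -natr1.
have h : (1 + a) * (1 + k%:R * a) <= (1 + a) * (1 + a) ^+ k by rewrite ler_wpM2l// addr_ge0.
apply: le_trans h; have : 0 <= k%:R * (a * a) by rewrite !mulr_ge0.
nra.
Qed.

Lemma two_exp_le (x e : nat) : (0 < x)%N -> 2 ^+ e <= (1 + x%:R^-1) ^+ (x * e) :> R.
Proof.
move=> x0; rewrite exprM; apply: ler_exp => //.
have xi : 0 <= x%:R^-1 :> R by rewrite invr_ge0.
have := bernoulli x xi; rewrite mulfV ?pnatr_eq0 -?lt0n//.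
Qed.

Lemma exp_le_half (x e : nat) : (0 < x)%N -> (1 - x%:R^-1) ^+ (x * e) <= 2^-1 ^+ e :> R.
Proof.
move=> x0; have xp : 0 < x%:R :> R by rewrite ltr0n.
have xi : 0 < x%:R^-1 :> R by rewrite invr_gt0.
have xi1 : x%:R^-1 <= 1 :> R by rewrite invf_le1// ler1n.
have h2 := two_exp_le e x0.
have e0 : 0 < 2 ^+ e :> R by rewrite exprn_gt0.
have h : (1 - x%:R^-1) ^+ (x * e) * (1 + x%:R^-1) ^+ (x * e) <= 1 :> R.
  rewrite -exprMn exprn_ile1//; last by nra.
  by rewrite mulr_ge0//; lra.
have p0 : 0 <= (1 - x%:R^-1) ^+ (x * e) :> R by rewrite exprn_ge0//; lra.
rewrite exprVn -[leRHS]mul1r ler_pdivlMr//; nra.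
Qed.

Lemma sqr_small (z e : R) : 0 < z -> z <= 1 -> 3 * z <= e ->
  (1 + z) ^+ 2 <= 1 + e /\ z ^+ 2 <= e.
Proof. by move=> z0 z1 ze; split; nra. Qed.

End Powers.

(** * Balancing the errors and fixing the integer parameters *)

Section Core.
Context (dsp : measure_display) (T : measurableType dsp) (R : realType).
Variables (P : probability T R) (n d : nat) (X : 'I_n -> {RV P >-> R}).
Hypothesis indep : mutually_independent X.
Variables (m0 s : 'I_n -> R) (kappa : R).
Hypothesis kappa1 : 1 <= kappa.
Hypothesis sg : forall j, subgauss P kappa (s j) (fun t => X j t - m0 j).

(** [M] is half of [d] times the degree 8m + 2. Four error terms are each made at most delta = 1/(16
    D): the smoothing error of the step, 36/N, the escape bound of a chain of length [l], and the
    tails (l + 2) 2^-M. Multiplied by 2d they cost at most eps/2, by [d <= D * eps]. *)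
Lemma sandwich_of_parameters (w : 'I_d -> 'I_n -> R) theta (eps : R) (D N r G l C e q B : nat) :
  let m := (4 * (r * N) * G)%N in let M := ((4 * m).+1 * d)%N in
  (0 < d <= D)%N -> (0 < G)%N -> (0 < B)%N -> d%:R <= D%:R * eps -> (576 * D <= N)%N -> (0 < r)%N ->
  chf_const kappa <= C%:R ->
  (48 * D * (32 * (r * N)) <= 2 ^ G)%N ->
  l = (16 * C * e)%N -> (16 * D <= 2 ^ e)%N -> (16 * D * l.+2 <= 2 ^ M)%N ->
  q = (C * N ^ 2 * B)%N -> (16 * r ^ 2 * (C * N ^ 2) <= 2 ^ B)%N ->
  36 * 64 * kappa * M%:R <= r%:R ^+ 2 ->
  exists p, gen_poly (range_prod X) (d * (l * q) + d * (8 * m).+2) p /\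
    sandwiching_upper X eps (halfspaces_inter w theta) p.
Proof.
move=> m M /andP[d0 dD] G0 B0 dDe DN r0 cC HG lE He HlM qE HB.
have D0 : (0 < D)%N by exact: leq_trans dD.
have N0 : (0 < N)%N by rewrite (leq_trans _ DN)// muln_gt0.
have chf2 := chf_const_ge2 kappa1.
have C2 : 2 <= C%:R :> R by exact: le_trans cC.
have C0 : (0 < C)%N by rewrite -(ltr0n R); lra.
have Dp : 0 < D%:R :> R by rewrite ltr0n.
have Np : 0 < N%:R :> R by rewrite ltr0n.
have rp : 0 < r%:R :> R by rewrite ltr0n.
have r1 : 1 <= r%:R :> R by rewrite ler1n.
have N1 : 1 <= N%:R :> R by rewrite ler1n.
have rN1 : 1 <= r%:R * N%:R :> R by rewrite -natrM ler1n muln_gt0 r0.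
have D1 : 1 <= D%:R :> R by rewrite ler1n.
have DNR : 576 * D%:R <= N%:R :> R by rewrite -natrM ler_nat.
have m0' : (0 < m)%N by rewrite /m !muln_gt0 r0 N0.
have M0 : (0 < M)%N by rewrite /M muln_gt0.
pose delta : R := (16 * D%:R)^-1.
have del0 : 0 < delta by rewrite invr_gt0 mulr_gt0.
have delD : delta * (16 * D%:R) = 1 by rewrite mulVf// gt_eqF// mulr_gt0.
(* The window 1/(4rN) of [upper_approx_regular] is 2a, the width of the jump of the step
   polynomial. *)
pose a : R := (8 * (r * N))%N%:R^-1.
have rN0 : (0 < 8 * (r * N))%N by rewrite !muln_gt0 r0.
have a0 : 0 < a by rewrite invr_gt0 ltr0n.
have aE : a * (8 * (r%:R * N%:R)) = 1 by rewrite -!natrM mulVf// gt_eqF// ltr0n.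
have a4 : a <= 1 / 4 by nra.
pose Z := a / 4 * (1 + a) ^+ (2 * m).
(* 48 D = 3 / delta, as [sqr_small] asks for 3/Z <= delta. *)
have Z3 : 48 * D%:R <= Z.
  have h : 2 ^+ G <= (1 + a) ^+ (2 * m).
    have -> : (2 * m = 8 * (r * N) * G)%N by rewrite /m; ring.
    exact: two_exp_le.
  have HG' : 48 * D%:R * (32 * (r%:R * N%:R)) <= 2 ^+ G :> R.
    by rewrite -!natrM -natrX ler_nat.
  have : 48 * D%:R * (32 * (r%:R * N%:R)) * (a / 4) <= (1 + a) ^+ (2 * m) * (a / 4).
    by rewrite ler_wpM2r ?divr_ge0 ?(ltW a0)// (le_trans HG').
  rewrite /Z; set E := (1 + a) ^+ _.
  have -> : 48 * D%:R * (32 * (r%:R * N%:R)) * (a / 4) = 48 * D%:R * (a * (8 * (r%:R * N%:R))).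
    by field.
  by rewrite aE mulr1 [E * _]mulrC.
have Z1 : 1 <= Z by lra.
have Z0 : 0 < Z by lra.
have Zi : Z^-1 * Z = 1 by rewrite mulVf// gt_eqF.
have Zi0 : 0 < Z^-1 by rewrite invr_gt0.
have Zid : 3 * Z^-1 <= delta.
  rewrite -(ler_pM2r Z0) -mulrA Zi; nra.
have Zi1 : Z^-1 <= 1 by rewrite invf_le1.
have [Zmid Zleft] := sqr_small Zi0 Zi1 Zid.
rewrite exprVn in Zleft.
have [] := @step_polynomial R a m _ Z1; first by rewrite a0.
move=> Q [sQ Q0 Q1 [Qmid Qleft] Qout].
have dd : d%:R * delta <= 1 / 2.
  have : d%:R <= D%:R :> R by rewrite ler_nat.
  nra.
have dde : d%:R * delta <= eps / 16.
  have : d%:R * delta <= D%:R * eps * delta by rewrite ler_wpM2r// ltW.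
  nra.
have hM : l.+2%:R * 2^-1 ^+ M <= delta.
  rewrite exprVn ler_pdivrMr ?exprn_gt0// -(ler_pM2l Dp).
  have : 16 * D%:R * l.+2%:R <= 2 ^+ M :> R by rewrite -!natrM -natrX ler_nat.
  have : 0 < 2 ^+ M :> R by rewrite exprn_gt0.
  nra.
have hl : (1 - (16 * chf_const kappa)^-1) ^+ l <= delta.
  have h16 : 0 < 16 * chf_const kappa by lra.
  have hC16 : (16 * C)%N%:R^-1 <= (16 * chf_const kappa)^-1 :> R.
    by rewrite natrM lef_pV2 ?posrE//; [rewrite ler_wpM2l|lra].
  have i1 : (16 * chf_const kappa)^-1 <= 1 by rewrite invf_le1//; lra.
  apply: (@le_trans _ _ ((1 - (16 * C)%N%:R^-1) ^+ l)).
    by apply: ler_exp; lra.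
  rewrite lE (le_trans (exp_le_half _ _ _))// ?muln_gt0//.
  rewrite exprVn lef_pV2 ?posrE ?exprn_gt0 ?mulr_gt0//.
  by rewrite -natrM -natrX ler_nat.
have hN : 36 / N%:R <= delta.
  by rewrite ler_pdivrMr//; nra.
pose Tn := (C * N ^ 2)%N.
have Tn0 : (0 < Tn)%N by rewrite muln_gt0 C0 expn_gt0 N0.
pose tau2 : R := Tn%:R^-1.
have tau0 : 0 < tau2 by rewrite invr_gt0 ltr0n.
have tau1 : tau2 <= 1 by rewrite invf_le1 ?ltr0n// ler1n.
have tauE : tau2 * (C%:R * N%:R ^+ 2) = 1 by rewrite -natrX -natrM mulVf// gt_eqF// ltr0n.
have tN : chf_const kappa * N%:R ^+ 2 * tau2 <= 1.
  by rewrite -[leRHS]tauE [leLHS]mulrC ler_wpM2l ?(ltW tau0)// ler_wpM2r// sqr_ge0.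
have tq : (1 - tau2) ^+ q * (4 * r%:R) ^+ 2 <= tau2.
  have h : (1 - tau2) ^+ q <= 2^-1 ^+ B by rewrite qE; exact: exp_le_half.
  have HB' : 16 * r%:R ^+ 2 * Tn%:R <= 2 ^+ B :> R by rewrite -!natrX -!natrM ler_nat.
  have h2 : 2^-1 ^+ B * (4 * r%:R) ^+ 2 <= tau2.
    rewrite exprVn mulrC ler_pdivrMr ?exprn_gt0// /tau2 ler_pdivlMl ?ltr0n//.
    by apply: le_trans HB'; rewrite exprMn; lra.
  by apply: le_trans h2; rewrite ler_wpM2r// sqr_ge0.
have KE : (2 <= (8 * m).+2)%N by [].
have oK : ~~ odd (8 * m).+2 by rewrite /= negbK oddM.
have G2K : 2^-1 ^+ (8 * m).+2 <= delta.
  have GK : (G <= (8 * m).+2)%N.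
    rewrite (@leq_trans m)//; first by rewrite /m leq_pmull// !muln_gt0 r0.
    by do 2 apply: leqW; exact: leq_pmull.
  apply: (@le_trans _ _ (2^-1 ^+ G)).
    by apply: ler_wiXn2l GK; rewrite ?invr_ge0 ?invf_le1 ?ler1n.
  rewrite exprVn lef_pV2 ?posrE ?exprn_gt0 ?mulr_gt0//.
  rewrite -natrM -natrX ler_nat (leq_trans _ HG)//.
  rewrite (@leq_trans (48 * D)%N)//; first by rewrite leq_mul2r orbT.
  by rewrite leq_pmulr// !muln_gt0 r0.
move=> HM.
have ex i : exists Hp : {set 'I_n} * (('I_n -> R) -> R), (#|Hp.1| <= l * q)%N /\
    upper_approx X Hp.1 (8 * m).+2 M delta
      (36 / N%:R + (1 - (16 * chf_const kappa)^-1) ^+ l + (l.+1)%:R * 2^-1 ^+ M) (w i) (theta i)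
          Hp.2.
  have q0 : (0 < q)%N.
    by rewrite qE muln_gt0 Tn0.
  have [|||H [p [Hq pP]]] := @upper_approx_exists _ _ _ _ _ _ indep _ _ _ kappa1 sg (w i) (theta
      i) M
      (8 * m).+2 N l q r%:R delta tau2 Q M0 N0 q0 r1 HM oK KE (ltW del0) G2K _ tN tq sQ Q0 Q1 _ _
          Qout.
  - by rewrite tau0.
  - by move=> t /Qmid/le_trans; apply; exact: Zmid.
  - move=> t /andP[t1 t2].
    apply: le_trans (Qleft _ _) _; last exact: Zleft.
    rewrite t1 (le_trans t2)// lerN2.
    rewrite -(ler_pM2r (_ : 0 < 4 * r%:R * N%:R)) ?mulr_gt0// mulVf ?gt_eqF ?mulr_gt0//.
    by have := aE; lra.
  by exists (H, p).
have [Hp HpP] := choice ex.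
exists (fun x => \prod_i (Hp i).2 x).
apply: (@product_sandwich _ _ _ _ _ _ _ w theta (fun i => (Hp i).1) (fun i => (Hp i).2)
  (8 * m).+2 M (l * q) delta _ eps d0) => //.
- by move=> i; have [] := HpP i.
- by move=> i; have [_] := HpP i; exact.
- have -> : ((8 * m).+2 * d = 2 * M)%N by rewrite /M mulnA mulnS mulnA.
  exact: leqnn.
- exact: ltW.
- have : l.+2%:R * 2^-1 ^+ M = (l.+1)%:R * 2^-1 ^+ M + 2^-1 ^+ M :> R.
    by rewrite -[l.+2%:R]natr1 [_ * 2^-1 ^+ M]mulrDl mul1r.
  move: hM hl hN; set x1 := l.+2%:R * _; set x2 := _ ^+ l; set x3 := 36 / _; set x4 := l.+1%:R *
      _; set x5 := 2^-1 ^+ M.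
  move=> hM hl hN x1E.
  have S4 : delta + (x3 + x2 + x4) + x5 <= 4 * delta by lra.
  have : 2 * d%:R * (delta + (x3 + x2 + x4) + x5) <= 2 * d%:R * (4 * delta).
    by rewrite ler_wpM2l// mulr_ge0.
  have e0 : 0 <= eps.
    by have := ler0n R d; nra.
  lra.
Qed.

End Core.

(** The constraints are circular: r^2 must dominate [M], which contains [r], and 2^G must dominate
    [r], which contains [G]. Both loops close, since [M] grows only linearly in [r] and [r] only
    linearly in [G]. *)
Lemma parameters (c0 k1 n0 : nat) : (0 < c0)%N -> (0 < k1)%N -> (0 < n0)%N ->
  exists CC : nat, forall A L D d : nat, (0 < A)%N -> (0 < L)%N -> (0 < d <= D)%N -> (D <= 2 ^
      L)%N ->
  exists r G e B : nat,
    let N := (n0 * D)%N in let m := (4 * (r * N) * G)%N in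
    let M := ((4 * m).+1 * d)%N in let C := (c0 * A ^ 2)%N in
    let l := (16 * C * e)%N in let q := (C * N ^ 2 * B)%N in
    [/\ [/\ 0 < r, 0 < G & 0 < B]%N, (k1 * A * M <= r ^ 2)%N,
        (48 * D * (32 * (r * N)) <= 2 ^ G)%N /\ (16 * D <= 2 ^ e)%N,
        (16 * D * l.+2 <= 2 ^ M)%N /\ (16 * r ^ 2 * (C * N ^ 2) <= 2 ^ B)%N &
        (d * (l * q) + d * (8 * m).+2 <= CC * (A ^ 5 * L ^ 2 * (D ^ 2 * d ^ 2)))%N].
Proof.
move=> c00 k10 n00.
(* 17 because M <= 17 r N G d; with this [b], r^2 equals k1 A times that bound. *)
have [b [bE b0]] : exists b, b = (17 * k1)%N /\ (0 < b)%N.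
  by exists (17 * k1)%N; rewrite muln_gt0.
pose h := (48 * 32 * (b * n0 ^ 2) + 16 * (90 * c0) + 16 * (b ^ 2 * c0 * n0 ^ 4))%N.
have h2 : (h <= 2 ^ h)%N by rewrite ltnW// ltn_expl.
have h_1 : (48 * 32 * (b * n0 ^ 2) <= 2 ^ h)%N.
  by apply: leq_trans h2; rewrite /h -addnA leq_addr.
have h_2 : (16 * (90 * c0) <= 2 ^ h)%N.
  by apply: leq_trans h2; rewrite /h addnAC leq_addl.
have h_3 : (16 * (b ^ 2 * c0 * n0 ^ 4) <= 2 ^ h)%N.
  by apply: leq_trans h2; rewrite /h leq_addl.
move: h {h2} h_1 h_2 h_3 => h h_1 h_2 h_3.
(* The first summand pays for the removed coordinates, where A^5 arises from two factors [C] and one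
   [B]; the second pays for the degrees. *)
exists (320 * (h + 6) * (c0 ^ 2 * n0 ^ 2) + 160 * (h + 6) ^ 2 * (b * n0 ^ 2))%N.
move=> A L D d A0 L0 /andP[d0 dD] DL.
have D0 : (0 < D)%N by exact: leq_trans dD.
(* [h] absorbs the constants, 4L the factor D^3 d, and 2A the powers of A, bounded crudely through A
   <= 2^A since polynomial factors in 1/alpha are allowed. Doubling to [G] makes room for the factor
   G <= 2^H inside [r]. *)
pose H := (h + 4 * L + 2 * A)%N; pose G := (2 * H)%N.
have A2 : (A <= 2 ^ A)%N by rewrite ltnW// ltn_expl.
have L2 : (L <= 2 ^ L)%N by rewrite ltnW// ltn_expl.
have dL : (d <= 2 ^ L)%N by exact: leq_trans dD DL.
have H0 : (0 < H)%N by rewrite /H; clear -A0; lia.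
have GH : (G <= 2 ^ H)%N.
  rewrite /G; case: (H) H0 => // k _; rewrite expnS leq_mul2l/=; exact: ltn_expl.
have HAL : (H <= (h + 6) * (A * L))%N by rewrite /H; clear -A0 L0; nia.
have N0 : (0 < n0 * D)%N by rewrite muln_gt0 n00.
have G0 : (0 < G)%N by rewrite muln_gt0.
pose r := (b * A * (n0 * D * G * d))%N.
have r0 : (0 < r)%N by rewrite /r !muln_gt0 b0 A0 n00 D0 H0 d0.
exists r, G, (L + 4)%N, (4 * H)%N => N m M C l q.
have N0' : (0 < N)%N := N0.
have rN0 : (0 < r * N)%N by rewrite muln_gt0 r0.
have m0 : (0 < m)%N by rewrite /m muln_gt0 G0 andbT muln_gt0 rN0.
have le5 : (L + 4 <= 5 * L)%N by clear -L0; lia.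
have C0 : (0 < C)%N by rewrite muln_gt0 c00 expn_gt0 A0.
have lE : (l.+2 <= 90 * c0 * (A ^ 2 * L))%N.
  rewrite (@leq_trans (18 * C * (L + 4)))%N//.
    have : (1 <= C * (L + 4))%N by rewrite muln_gt0 C0 addn_gt0 orbT.
    by rewrite /l -!mulnA; clear; lia.
  rewrite (@leq_trans (18 * C * (5 * L)))%N//; first by rewrite leq_mul2l le5 orbT.
  by rewrite /C; apply: eq_leq; ring.
split.
- by rewrite r0 G0 muln_gt0 H0.
- rewrite (@leq_trans (k1 * A * (17 * (r * N * G) * d)))%N//.
    rewrite leq_mul2l leq_mul2r; apply/orP; right; apply/orP; right.
    have : (0 < r * N * G)%N by rewrite muln_gt0 rN0.
    by rewrite /m; clear; lia.
  by apply: eq_leq; rewrite -mulnn {2}/r bE /N; ring.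
- split.
    have -> : (48 * D * (32 * (r * N)) = 48 * 32 * (b * n0 ^ 2) * (A * (D ^ 3 * d) * G))%N.
      by rewrite /r /N; ring.
    apply: (@leq_trans (2 ^ h * (2 ^ A * ((2 ^ L) ^ 3 * 2 ^ L) * 2 ^ H)))%N.
      by rewrite !leq_mul// leq_exp2r.
    rewrite -!expnM -!expnD leq_exp2l// /G /H; clear; lia.
  by rewrite addnC expnD leq_mul.
- split.
    apply: (@leq_trans (2 ^ h * (2 ^ L * ((2 ^ A) ^ 2 * 2 ^ L))))%N.
      apply: (@leq_trans (16 * D * (90 * c0 * (A ^ 2 * L))))%N; first by rewrite leq_mul2l lE orbT.
      have -> : (16 * D * (90 * c0 * (A ^ 2 * L)) = 16 * (90 * c0) * (D * (A ^ 2 * L)))%N by ring.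
      by rewrite !leq_mul// leq_exp2r.
    rewrite -!expnM -!expnD leq_exp2l//.
    apply: (@leq_trans G)%N; first by rewrite /G /H; clear; lia.
    apply: (@leq_trans m)%N; first by rewrite /m leq_pmull// muln_gt0 rN0.
    rewrite /M (@leq_trans (4 * m).+1)//; last by rewrite leq_pmulr.
    by apply: leqW; exact: leq_pmull.
  have -> : (16 * r ^ 2 * (C * N ^ 2) = 16 * (b ^ 2 * c0 * n0 ^ 4) * (A ^ 4 * (D ^ 4 * d ^ 2) * G
      ^ 2))%N.
    by rewrite /r /C /N; ring.
  apply: (@leq_trans (2 ^ h * ((2 ^ A) ^ 4 * ((2 ^ L) ^ 4 * (2 ^ L) ^ 2) * (2 ^ H) ^ 2)))%N.
    by rewrite !leq_mul// leq_exp2r.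
  rewrite -!expnM -!expnD leq_exp2l// /H; clear; lia.
- rewrite mulnDl leq_add//.
    have -> : (d * (l * q) = 16 * c0 * (A ^ 2 * (L + 4)) * (c0 * A ^ 2 * (n0 ^ 2 * D ^ 2) * (4 *
        H)) * d)%N.
      by rewrite /l /q /C /N; ring.
    apply: (@leq_trans (16 * c0 * (A ^ 2 * (5 * L)) * (c0 * A ^ 2 * (n0 ^ 2 * D ^ 2) *
        (4 * ((h + 6) * (A * L)))) * (d * d)))%N.
      by rewrite !leq_mul// leq_pmulr.
    by apply: eq_leq; ring.
  apply: (@leq_trans (d * (10 * m)))%N.
    by rewrite leq_mul2l; apply/orP; right; clear -m0; lia.
  have -> : (d * (10 * m) = 40 * (b * n0 ^ 2) * (A * 1 * 1 * (D ^ 2 * d ^ 2) * G ^ 2))%N.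
    by rewrite /m /r /N; ring.
  apply: (@leq_trans (40 * (b * n0 ^ 2) * (A * A * A * (D ^ 2 * d ^ 2) * (2 * ((h + 6) * (A *
      L))) ^ 2)))%N.
    by rewrite !leq_mul// leq_exp2r// leq_mul.
  by apply: eq_leq; ring.
Qed.

(** These cases are set apart because the parameters are chosen under d/eps >= 1. *)
Lemma trivial_sandwich (dsp : measure_display) (T : measurableType dsp) (R : realType)
    (P : probability T R) (n d : nat) (X : 'I_n -> {RV P >-> R}) (w : 'I_d -> 'I_n -> R)
    (theta : 'I_d -> R) (eps : R) : 0 < eps -> 1 <= eps \/ d = 0%N ->
  gen_poly (range_prod X) 0 (fun=> 1) /\
  sandwiching_upper X eps (halfspaces_inter w theta) (fun=> 1).
Proof.
move=> eps0 triv; split.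
  rewrite -[0%N](cards0 'I_n) -[#|_|]addn0; apply: junta_sum_gen_poly.
  exact: junta_sum_cst.
split; first by move=> x _; rewrite lern1 /halfspaces_inter; case: [forall _, _].
  exact: itg_cst.
have E1 : ('E_P[fun=> 1%R] = 1)%E by rewrite expectation_cst.
rewrite E1.
have [eps1|d0] := triv.
  apply: (@le_trans _ _ 0%E); first by rewrite -EFinB lee_fin subr_le0.
  by rewrite unlock; apply: integral_ge0 => t _; rewrite lee_fin ler0n.
rewrite (_ : (fun t => _) = fun=> 1); last first.
  apply/funext => t; rewrite /halfspaces_inter; case: forallP => // -[] i.
  by have := ltn_ord i; rewrite [X in (_ < X)%N]d0.
by rewrite expectation_cst -EFinB lee_fin lerBlDr lerDl ltW.
Qed.

(** 128 = 4 * 32 is the uniform constant; 128 A also covers 4 for Gaussians and 4/alpha for discrete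
    variables. *)
Lemma family_subgauss (dsp : measure_display) (T : measurableType dsp) (R : realType)
    (P : probability T R) (n : nat) (X : 'I_n -> {RV P >-> R}) (alpha : R) (A : nat) :
  0 < alpha <= 1 -> alpha^-1 <= A%:R ->
  ((forall j, discrete_rv (X j)) /\ is_least_outcome_prob X alpha) \/
  ((forall j, gaussian_rv (X j) \/ uniform_rv (X j)) /\ alpha = 1) ->
  exists m s, forall j : 'I_n, subgauss P (128 * A%:R) (s j) (fun t => X j t - m j).
Proof.
move=> /andP[a0 a1] aA laws.
have A1 : 1 <= A%:R :> R by rewrite (le_trans _ aA)// invf_ge1.
suff : forall j, exists ms : R * R, subgauss P (128 * A%:R) ms.2 (fun t => X j t - ms.1).
  by move=> /choice[ms H]; exists (fun j => (ms j).1), (fun j => (ms j).2).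
move=> j; suff : exists kappa m s, kappa <= 128 * A%:R /\ subgauss P kappa s (fun t => X j t - m).
  by move=> [kappa [m [s [kk sg]]]]; exists (m, s); exact: subgauss_mono sg.
have [[dX [_ lb]]|[gu _]] := laws.
  have [|m [s sg]] := discrete_subgauss (dX j) a0.
    by move=> v pv; apply: lb; split => //; exists j, v.
  by exists (4 * alpha^-1), m, s; split => //; lra.
have [gX|uX] := gu j.
  have [m [s sg]] := gaussian_subgauss gX.
  by exists 4, m, s; split => //; lra.
have [m [s sg]] := uniform_subgauss uX.
by exists (4 * 32), m, s; split => //; lra.
Qed.

Lemma nat_above (R : realType) (x : R) : 1 <= x -> exists A : nat, (0 < A)%N /\ x <= A%:R <= 2 * x.
Proof.
move=> x1; exists (Num.truncn x).+1; split => //.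
have := @truncn_itv _ x; rewrite (le_trans ler01 x1) => /(_ isT)/andP[h1 h2].
by rewrite (ltW h2)/= -natr1; lra.
Qed.

Lemma log2_le (R : realType) (D : nat) (t : R) : (0 < D)%N -> D%:R <= 2 * t ->
  exists L : nat, [/\ (0 < L)%N, (D <= 2 ^ L)%N & L%:R <= 4 * ln (2 + t)].
Proof.
move=> D0 Dt.
have [h1 h2] := andP (trunc_log_bounds (leqnn 2) D0).
set k := trunc_log 2 D in h1 h2.
exists k.+1; split => //; first exact: ltnW.
have D1 : 1 <= D%:R :> R by rewrite ler1n.
have t0 : 0 < t by lra.
have ln2 : 1 / 2 <= ln (2 : R).
  have e12 : expR (1 / 2 : R) <= 2.
    have : expR (1 / 2 : R) ^+ 2 <= 2 ^+ 2.
      rewrite expr2 -expRD -splitr; have := expR1_le4 R; lra.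
    by rewrite ler_pXn2r// ?nnegrE ?expR_ge0.
  by rewrite -[leLHS]expRK ler_ln ?posrE ?expR_gt0.
have h3 : 2 ^+ k.+1 <= (2 + t) ^+ 2.
  have : 2 ^+ k <= 2 * t :> R by rewrite (le_trans _ Dt)// -natrX ler_nat.
  rewrite exprS; nra.
have h4 : ln (2 ^+ k.+1) <= ln ((2 + t) ^+ 2).
  by rewrite ler_ln ?posrE ?exprn_gt0//; lra.
rewrite !lnXn// in h4; last by lra.
rewrite -(mulr_natl (ln 2)) -(mulr_natl (ln (2 + t))) in h4.
have : 0 <= k.+1%:R :> R by [].
nra.
Qed.

Theorem theorem2p3 (R : realType) :
  exists (C : R) (c e : nat),
    forall (disp : measure_display) (T : measurableType disp)
      (P : probability T R) (n d : nat) (X : 'I_n -> {RV P >-> R})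
      (w : 'I_d -> 'I_n -> R) (theta : 'I_d -> R) (alpha eps : R),
    mutually_independent X ->
    0 < alpha <= 1 ->
    ((forall j, discrete_rv (X j)) /\ is_least_outcome_prob X alpha) \/
    ((forall j, gaussian_rv (X j) \/ uniform_rv (X j)) /\ alpha = 1) ->
    0 < eps ->
    exists (k : nat) (p : ('I_n -> R) -> R),
      [/\ k%:R <= softO C c (d%:R ^+ 4 / eps ^+ 2) * (alpha^-1) ^+ e,
          gen_poly (range_prod X) k p &
          sandwiching_upper X eps (halfspaces_inter w theta) p].
Proof.
(* [chf_const] is quadratic, so its value at kappa = 128 A is A^2 times its value at 128. *)
have c1 : 1 <= chf_const (128 : R).
  by apply: le_trans (chf_const_ge2 _); rewrite ?ler1n.
have [c0 [c00 /andP[c0E _]]] := nat_above c1.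
have [k1 [k10 k1E]] : exists k1 : nat, (0 < k1)%N /\ k1%:R = 36 * 64 * 128 :> R.
  by exists (36 * 64 * 128)%N; rewrite !muln_gt0 !natrM.
(* 576 = 36 * 16 makes 36/N at most 1/(16 D). *)
have [CC HCC] := @parameters c0 k1 576 c00 k10 isT.
(* 32 = 2^5 from A <= 2/alpha, 16 = 4^2 from L <= 4 ln(2 + t), and 4 = 2^2 from D <= 2 d/eps. *)
exists (32 * 16 * 4 * CC%:R), 2%N, 5%N.
move=> disp T P n d X w theta alpha eps indep a01 laws eps0.
have a0 : 0 < alpha by case/andP: a01.
have ai1 : 1 <= alpha^-1 by rewrite invf_ge1//; case/andP: a01.
set t := d%:R ^+ 4 / eps ^+ 2.
have t0 : 0 <= t by rewrite divr_ge0 ?exprn_ge0// ltW.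
have ln0 : 0 <= ln (2 + t) by rewrite ln_ge0//; lra.
have rhs0 : 0 <= softO (32 * 16 * 4 * CC%:R) 2 t * alpha^-1 ^+ 5.
  rewrite /softO; apply: mulr_ge0; last by rewrite exprn_ge0// (le_trans ler01).
  by apply: mulr_ge0; [apply: mulr_ge0 => //; rewrite !mulr_ge0|exact: exprn_ge0].
have [eps1|eps1] := leP 1 eps.
  have [gp sw] := trivial_sandwich X w theta eps0 (or_introl eps1).
  by exists 0%N, (fun=> 1).
have [d0|] := posnP d.
  have [gp sw] := trivial_sandwich X w theta eps0 (or_intror d0).
  by exists 0%N, (fun=> 1).
move=> d0.
have d1 : 1 <= d%:R :> R by rewrite ler1n.
have [A [A0 /andP[aA Aa]]] := nat_above ai1.
have de1 : 1 <= d%:R / eps by rewrite ler_pdivlMr// mul1r; lra.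
have [D [D0 /andP[dD Dd]]] := nat_above de1.
have dDe : d%:R <= D%:R * eps by rewrite -ler_pdivrMr.
have dleD : (d <= D)%N.
  rewrite -(ler_nat R) (le_trans dDe)// -[leRHS]mulr1 ler_wpM2l// ltW//.
have tE : t = (d%:R / eps) ^+ 2 * d%:R ^+ 2.
  by rewrite /t; field; rewrite gt_eqF.
have det : d%:R / eps <= t.
  rewrite tE; move: de1; set x := _ / _ => x1.
  have : 1 <= d%:R ^+ 2 :> R by rewrite exprn_ege1.
  nra.
have [|L [L0 DL Lln]] := @log2_le R D t D0; first by lra.
have [m [s sg]] := family_subgauss a01 aA laws.
have A1 : 1 <= A%:R :> R by rewrite ler1n.
have kappa1 : 1 <= 128 * A%:R :> R by lra.
have dD' : (0 < d <= D)%N by rewrite d0.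
have [r [G [e [B]]]] := HCC A L D d A0 L0 dD' DL.
set N := (576 * D)%N; set mm := (4 * (r * N) * G)%N; set M := ((4 * mm).+1 * d)%N.
set C := (c0 * A ^ 2)%N; set l := (16 * C * e)%N; set q := (C * N ^ 2 * B)%N.
move=> [[r0 G0 B0] HM [HG He] [HlM HB] Hk].
have [||p [gp sw]] := @sandwich_of_parameters _ _ _ P n d X indep m s _ kappa1 sg w theta eps D N r G l C e q B
    dD' G0 B0 dDe (leqnn _) r0 _ HG erefl He HlM erefl HB _.
- rewrite /chf_const /C natrM natrX exprMn mulrA.
  by rewrite ler_wpM2r// exprn_ge0.
- rewrite -natrX (le_trans _ (_ : (k1 * A * M)%:R <= _))//; last by rewrite ler_nat.
  by rewrite !natrM k1E !mulrA.
exists (d * (l * q) + d * (8 * mm).+2)%N, p; split => //.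
apply: (@le_trans _ _ (CC%:R * (A%:R ^+ 5 * L%:R ^+ 2 * (D%:R ^+ 2 * d%:R ^+ 2)))).
  by rewrite -!natrX -!natrM ler_nat.
have hA : A%:R ^+ 5 <= 32 * alpha^-1 ^+ 5.
  by rewrite (_ : 32 = 2 ^+ 5); [rewrite -exprMn; exact: ler_exp|ring].
have hL : L%:R ^+ 2 <= 16 * ln (2 + t) ^+ 2.
  by rewrite (_ : 16 = 4 ^+ 2); [rewrite -exprMn; exact: ler_exp|ring].
have hD : D%:R ^+ 2 * d%:R ^+ 2 <= 4 * t.
  rewrite tE mulrA ler_wpM2r ?exprn_ge0//.
  by rewrite (_ : 4 = 2 ^+ 2); [rewrite -exprMn; exact: ler_exp|ring].
rewrite /softO.
have -> : 32 * 16 * 4 * CC%:R * t * ln (2 + t) ^+ 2 * alpha^-1 ^+ 5 =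
    CC%:R * (32 * alpha^-1 ^+ 5 * (16 * ln (2 + t) ^+ 2) * (4 * t)) by ring.
by rewrite ler_wpM2l// ler_pM// ler_pM.
Qed.
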